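(* Suppose that $(\mathcal{M}, \mathcal{A}) \models \mathrm{GBC} + \text{``}\mathrm{Ord}\text{ is weakly compact''}$ is countable and let $\mathcal{U}$ be an $(\mathcal{M}, \mathcal{A})$-generic ultrafilter. Write $\mathcal{G} = \mathcal{G}_{\mathcal{U}, (\mathcal{M}, \mathcal{A})}$ for the corresponding Gaifman functor. Let $i : \mathbb{K} \rightarrow \mathbb{L}$ be an embedding of linear orders. (a) For each $n \in \mathbb{N}$, each formula $\phi(x_1, \dots, x_n)$ of $\mathcal{L}^0_{\mathcal{A}}$ and all $l_1 <_\mathbb{L} \dots <_\mathbb{L} l_n$ in $\mathbb{L}$: $\mathcal{G}(\mathbb{L}) \models \phi(c_{l_1}, \dots, c_{l_n})$ if and only if $\{ \langle \alpha_1, \dots, \alpha_n \rangle \in (\mathrm{Ord}^\mathcal{M})^n \mid (\mathcal{M}, A)_{A \in \mathcal{A}} \models \phi(\alpha_1, \dots, \alpha_n) \} \in \mathcal{U}^n$. (b) $\mathcal{G}(i) : \mathcal{G}(\mathbb{K}) \rightarrow \mathcal{G}(\mathbb{L})$ is an elementary embedding. (c) $\mathcal{G}$ is a functor (from the category of linear orders with embeddings to the category of models of the $\mathcal{L}^0_\mathcal{A}$-theory of $(\mathcal{M},A)_{A\in\mathcal{A}}$ with elementary embeddings). (d) If $\mathbb{L} \neq \varnothing$, then $\mathrm{SSy}_\mathcal{M}(\mathcal{G}(\mathbb{L})) = (\mathcal{M}, \mathcal{A})$. (e) $|\mathcal{G}(\mathbb{L})| = |\mathbb{L}| + \aleph_0$.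 (f) $i$ is initial iff $\mathcal{G}(i)$ is rank-initial. (g) $i$ is an isomorphism iff $\mathcal{G}(i)$ is an isomorphism. (h) Let $l_0 \in \mathbb{L}$. Then $i$ is strictly bounded above by $l_0$ iff the restriction of $\mathcal{G}(i)$ to $\mathrm{Ord}^{\mathcal{G}(\mathbb{K})}$ is strictly bounded above by $c_{l_0}$. (i) If $\mathbb{L} \setminus i(\mathbb{K})$ has no least element, then $\{ c_l \mid l \in \mathbb{L} \setminus i(\mathbb{K})\}$ is downwards cofinal in $\mathrm{Ord}^{\mathcal{G}(\mathbb{L})} \setminus \mathrm{Ord}^{\mathcal{G}(i(\mathbb{K}))}$. (j) Let $\mathbb{L}'$ be a linear order and let $j, j' : \mathbb{L} \rightarrow \mathbb{L}'$ be embeddings. Then $i$ is an equalizer of $j, j' : \mathbb{L} \rightarrow \mathbb{L}'$ iff $\mathcal{G}(i)$ is an equalizer of $\mathcal{G}(j), \mathcal{G}(j') : \mathcal{G}(\mathbb{L}) \rightarrow \mathcal{G}(\mathbb{L}')$. (k) Let $i' : \mathbb{K} \rightarrow \mathbb{L}$ be an embedding. Then $i(k) < i'(k)$ for all $k \in \mathbb{K}$ iff $\mathcal{G}(i)(\xi) < \mathcal{G}(i')(\xi)$ for all $\xi \in \mathrm{Ord}^{\mathcal{G}(\mathbb{K})} \setminus \mathrm{Ord}^\mathcal{M}$.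
   Context: $\mathcal{L}^0$ is the first-order language $\{\in\}$. $\mathcal{L}^1$ is the two-sorted language of sets and classes (sets being a subsort of classes) with $\in$ between sets and classes. An $\mathcal{L}^1$-structure is written $(\mathcal{M},\mathcal{A})$, with $\mathcal{M}$ the $\mathcal{L}^0$-structure of sets and $\mathcal{A}$ the collection of classes, taken as subsets of $\mathcal{M}$. $\mathrm{GBC}$ is Gödel–Bernays class theory with choice: Class Extensionality; Pair, Union, Powerset, Infinity for sets; every non-empty class has an $\in$-minimal element; $\{x\mid\phi(x,\vec A)\}$ is a class for every formula $\phi$ without class quantifiers (class parameters allowed); the intersection of a set with such a class is a set; the image of a set under a class function is a set; and Choice. A binary tree is a class $\mathcal{T}$ of functions from ordinals to $2$, closed under restriction to smaller ordinals, and ordered by $f<_\mathcal{T}g$ iff $\mathrm{dom}(f)<\mathrm{dom}(g)$ and $g$ extends $f$. Its height is $\{\mathrm{dom}(f)\mid f\in\mathcal{T}\}$. For a tree of height $\mathrm{Ord}$, a branch is a class function $F:\mathrm{Ord}\to\mathcal{T}$ with $\mathrm{dom}(F(\alpha))=\alpha$ for all $\alpha$ and $F(\alpha)<_\mathcal{T}F(\beta)$ for all $\alpha<\beta$. ``$\mathrm{Ord}$ is weakly compact'' says: every binary tree of height $\mathrm{Ord}$ has a branch. Let $\mathbb{B}=\{A\subseteq\mathrm{Ord}^\mathcal{M}\mid A\in\mathcal{A}\}$ (a Boolean algebra), and let $\mathbb{P}$ be the partial order of unbounded members of $\mathbb{B}$ under inclusion. An $(\mathcal{M},\mathcal{A})$-generic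 ultrafilter is a filter $\mathcal{U}$ on $\mathbb{P}$ that meets every dense subset of $\mathbb{P}$ that is definable in $(\mathcal{M},\mathcal{A})$ with parameters. Such a $\mathcal{U}$ is a non-principal ultrafilter on $\mathbb{B}$ and is iterable: for every sequence $(S_\alpha)_{\alpha\in\mathrm{Ord}^\mathcal{M}}$ of members of $\mathbb{B}$ coded by a class in $\mathcal{A}$, $\{\alpha\mid S_\alpha\in\mathcal{U}\}\in\mathcal{A}$. For $n\in\mathbb{N}$, $\mathcal{U}^n$ is the ultrafilter on $\mathbb{B}^n=\{X\subseteq(\mathrm{Ord}^\mathcal{M})^n\mid X\in\mathcal{A}\}$ defined by $\mathcal{U}^0=\{\{\langle\rangle\}\}$ and $X\in\mathcal{U}^{n+1}\Leftrightarrow\{\alpha\mid X_\alpha\in\mathcal{U}^n\}\in\mathcal{U}$, where $X_\alpha=\{\langle\alpha_2,\dots,\alpha_{n+1}\rangle\mid\langle\alpha,\alpha_2,\dots,\alpha_{n+1}\rangle\in X\}$. $\mathcal{L}^0_\mathcal{A}$ is $\mathcal{L}^0$ with added constants for all elements of $\mathcal{M}$ and added relation and function symbols for all relations and functions on $\mathcal{M}$ coded in $\mathcal{A}$; $(\mathcal{M},A)_{A\in\mathcal{A}}$ is the canonical expansion of $\mathcal{M}$ to $\mathcal{L}^0_\mathcal{A}$. $\Gamma_n$ is the set of $\phi(x_1,\dots,x_n)\in\mathcal{L}^0_\mathcal{A}$ with $\{\langle\alpha_1,\dots,\alpha_n\rangle\mid(\mathcal{M},A)_{A\in\mathcal{A}}\models\phi(\alpha_1,\dots,\alpha_n)\}\in\mathcal{U}^n$.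 For a linear order $\mathbb{L}$, add new constants $c_l$ ($l\in\mathbb{L}$), giving the language $\mathcal{L}^0_{\mathcal{A},\mathbb{L}}$, and let $T_{\mathcal{U},\mathbb{L}}=\{\phi(c_{l_1},\dots,c_{l_n})\mid n\in\mathbb{N},\ l_1<_\mathbb{L}\dots<_\mathbb{L}l_n,\ \phi\in\Gamma_n\}$. This is a complete theory with definable Skolem functions containing the elementary diagram of $(\mathcal{M},A)_{A\in\mathcal{A}}$. $\mathcal{G}(\mathbb{L})=\mathcal{G}_{\mathcal{U},(\mathcal{M},\mathcal{A})}(\mathbb{L})$ (the iterated ultrapower along $\mathbb{L}$) is its prime model, taken to be an elementary extension of $(\mathcal{M},A)_{A\in\mathcal{A}}$; each of its elements is of the form $f(c_{l_1},\dots,c_{l_n})$ with $f$ a function coded in $\mathcal{A}$ and $l_1<\dots<l_n$ in $\mathbb{L}$. For an embedding $i:\mathbb{K}\to\mathbb{L}$, $\mathcal{G}(i)(f(c_{k_1},\dots,c_{k_n}))=f(c_{i(k_1)},\dots,c_{i(k_n)})$. $\mathcal{G}$ is called the Gaifman functor. In (i), $\mathcal{G}(i(\mathbb{K}))$ is identified with its canonical copy inside $\mathcal{G}(\mathbb{L})$, namely the image of $\mathcal{G}$ applied to the inclusion $i(\mathbb{K})\subseteq\mathbb{L}$. $\mathrm{SSy}_\mathcal{M}(\mathcal{N})=(\mathcal{M},\{\{x\in\mathcal{M}\mid\mathcal{N}\models x\in c\}\mid c\in\mathcal{N}\})$. An embedding of linear orders is initial if its range is downward closed. An embedding $e:\mathcal{N}\to\mathcal{N}'$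 of models of set theory is rank-initial if whenever $a\in\mathcal{N}$, $b\in\mathcal{N}'$ and $\mathcal{N}'\models\mathrm{rank}(b)\le\mathrm{rank}(e(a))$, then $b\in e(\mathcal{N})$. $e$ is an equalizer of $g,g'$ if the range of $e$ is exactly $\{x\mid g(x)=g'(x)\}$. *)

(* Defs.v *)
From HB Require Import structures.
From mathcomp Require Import all_boot all_order.
From mathcomp Require Import boolp classical_sets functions cardinality.
From Stdlib Require Import ClassicalEpsilon.
Set Implicit Arguments.
Unset Strict Implicit.
Unset Printing Implicit Defensive.

Local Open Scope classical_set_scope.

(* The new element comes first: position 0 is the most recent variable. *)
Notation tcons x t := [tuple of x :: t].

Record signature := Signature {
  fsym : nat -> Type;
  rsym : nat -> Type }.

Record structure (S : signature) := Structure {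
  univ :> Type;
  univ_inh : inhabited univ;
  fint : forall k, fsym S k -> k.-tuple univ -> univ;
  rint : forall k, rsym S k -> set (k.-tuple univ) }.

Inductive term (S : signature) (n : nat) : Type :=
| Var of 'I_n
| App k of fsym S k & ('I_k -> term S n).

(* [formula S n]: formulas with free variables among x_0, ..., x_(n-1);
   de Bruijn indices, [All] binds index 0. *)
Inductive formula (S : signature) (n : nat) : Type :=
| Bot
| Eq of term S n & term S n
| Rel k of rsym S k & ('I_k -> term S n)
| Imp of formula S n & formula S n
| All of formula S n.+1.

Notation sentence S := (formula S 0).

Section Semantics.
Variables (S : signature) (N : structure S).

Fixpoint eval n (e : n.-tuple N) (t : term S n) : N :=
  match t with
  | Var i => tnth e i
  | App _ f ts => fint f [tuple eval e (ts i) | i < _]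
  end.

Fixpoint sat n (e : n.-tuple N) (phi : formula S n) : Prop :=
  match phi with
  | Bot => False
  | Eq t u => eval e t = eval e u
  | Rel _ r ts => rint r [tuple eval e (ts i) | i < _]
  | Imp phi psi => sat e phi -> sat e psi
  | All phi => forall x : N, sat (tcons x e) phi
  end.

Definition models (T : set (sentence S)) : Prop :=
  forall phi, T phi -> sat [tuple] phi.

Definition theory : set (sentence S) := [set phi | sat [tuple] phi].

End Semantics.

Section Maps.
Variables (S : signature) (N N' : structure S) (h : N -> N').

Definition elementary_embedding : Prop :=
  forall n (phi : formula S n) (e : n.-tuple N),
    sat e phi <-> sat (map_tuple h e) phi.

Definition isomorphism : Prop :=
  [/\ bijective h,
      forall k (f : fsym S k) (t : k.-tuple N),
        h (fint f t) = fint f (map_tuple h t)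
    & forall k (r : rsym S k) (t : k.-tuple N),
        rint r t <-> rint r (map_tuple h t)].

End Maps.

Definition prime_model S (T : set (sentence S)) (N : structure S) : Prop :=
  models N T /\
  forall N' : structure S, models N' T ->
    exists h : N -> N', elementary_embedding h.

Inductive const_fsym (S : signature) (C : Type) : nat -> Type :=
| OldF k of fsym S k : const_fsym S C k
| NewC of C : const_fsym S C 0.

Definition with_consts (S : signature) (C : Type) : signature :=
  {| fsym := const_fsym S C; rsym := rsym S |}.

Definition reduct S C (N : structure (with_consts S C)) : structure S :=
  {| univ := N; univ_inh := univ_inh N;
     fint := fun k (f : fsym S k) => @fint _ N k (OldF C f);
     rint := fun k (r : rsym S k) => @rint _ N k r |}.

Definition new_const S C (N : structure (with_consts S C)) (c : C) : reduct N :=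
  @fint _ N 0 (NewC S c) [tuple].

(* [inst_formula l phi] is phi(c_{l_1}, ..., c_{l_n}): the [m] most recent
   variables (those bound inside [phi]) stay, the other [n] are replaced. *)
Section Instantiation.
Variables (S : signature) (C : Type) (n : nat) (l : n.-tuple C).

Fixpoint inst_term m (t : term S (m + n)) : term (with_consts S C) m :=
  match t with
  | Var i => match fintype.split i with
             | inl j => Var _ j
             | inr j => @App (with_consts S C) m 0 (NewC S (tnth l j))
                          (tnth [tuple])
             end
  | App k f ts =>
      @App (with_consts S C) m k (OldF C f) (fun i => inst_term (ts i))
  end.

Fixpoint inst_formula_under m (phi : formula S (m + n)) :
    formula (with_consts S C) m :=
  match phi with
  | Bot => Bot _ _
  | Eq t u => Eq (inst_term t) (inst_term u)
  | Rel k r ts =>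
      @Rel (with_consts S C) m k r (fun i => inst_term (ts i))
  | Imp phi psi => Imp (inst_formula_under phi) (inst_formula_under psi)
  | All phi => All (@inst_formula_under m.+1 phi)
  end.

Definition inst_formula (phi : formula S n) : sentence (with_consts S C) :=
  @inst_formula_under 0 phi.

End Instantiation.

Record eps_structure := EpsStructure {
  sets :> Type;
  sets_inh : inhabited sets;
  isin : sets -> sets -> Prop }.

Section SetTheory.
Variable M : eps_structure.
Implicit Types (x y z f d : M) (X F : set M).

Definition ext x : set M := [set y | isin y x].

Definition is_empty z := forall w, ~ isin w z.
Definition is_upair x y z := forall w, isin w z <-> w = x \/ w = y.
Definition is_opair x y z :=
  exists s p, [/\ is_upair x x s, is_upair x y p & is_upair s p z].
Definition is_succ x z := forall w, isin w z <-> isin w x \/ w = x.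
Definition is_union x z := forall w, isin w z <-> exists2 y, isin y x & isin w y.
Definition subset_in x y := forall w, isin w x -> isin w y.
Definition is_power x z := forall w, isin w z <-> subset_in w x.

Definition transitive_in x := forall y, isin y x -> subset_in y x.

(* Transitive and well-ordered by ∈. *)
Definition is_ord x :=
  [/\ transitive_in x,
      forall y z, isin y x -> isin z x -> [\/ isin y z, y = z | isin z y]
    & forall s, subset_in s x -> ~ is_empty s ->
        exists2 y, isin y s & forall z, isin z s -> ~ isin z y].

Definition Ord : set M := [set x | is_ord x].

Definition ord_lt x y := isin x y.
Definition ord_le x y := isin x y \/ x = y.

(* Classes of ordered pairs, seen as relations and (partial) functions. *)
Definition crel F x y := exists2 p, is_opair x y p & F p.
Definition class_fun F :=
  (forall p, F p -> exists x y, is_opair x y p) /\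
  (forall x y y', crel F x y -> crel F x y' -> y = y').

Definition app f x y := crel (ext f) x y.
Definition is_fun f := class_fun (ext f).
Definition is_dom f d := forall x, isin x d <-> exists y, app f x y.

(* [g] is the restriction of [f] to [d]. *)
Definition is_restr f d g :=
  forall p, isin p g <->
    isin p f /\ exists x y, is_opair x y p /\ isin x d.

(* [y] is 0 or 1. *)
Definition in_two y := forall w, isin w y -> is_empty w.

(* [a] is the rank of [x], computed by a function [f] on a transitive set that
   satisfies f(y) = sup {f(z) + 1 | z ∈ y}. *)
Definition is_rank x a :=
  exists f d,
    [/\ is_fun f, is_dom f d, transitive_in d,
        forall y v, app f y v -> forall w,
          isin w v <-> exists z u, [/\ isin z y, app f z u & ord_le w u]
      & app f x a].

Definition rank_le x y := exists a b, [/\ is_rank x a, is_rank y b & ord_le a b].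

(* <> is the empty set, <x> is x, <x, t> is the ordered pair of x and t. *)
Fixpoint tuple_code (s : seq M) z : Prop :=
  match s with
  | [::] => is_empty z
  | [:: x] => z = x
  | x :: s' => exists2 y, tuple_code s' y & is_opair x y z
  end.

End SetTheory.

Arguments Ord : clear implicits.

Definition rank_initial (N N' : eps_structure) (e : N -> N') : Prop :=
  forall (a : N) (b : N'), rank_le b (e a) -> exists a', b = e a'.

Record class_structure := ClassStructure {
  set_part :> eps_structure;
  classes : set (set set_part) }.

(* Two-sorted formulas with [m] free set variables and [n] free class
   variables.  Sets being a subsort of classes, a class term is a variable of
   either sort. *)
Definition cterm (m n : nat) : Type := ('I_m + 'I_n)%type.

Inductive formula1 (m n : nat) : Type :=
| Bot1
| In1 of 'I_m & cterm m n
| Eq1 of cterm m n & cterm m n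
| Imp1 of formula1 m n & formula1 m n
| AllSet of formula1 m.+1 n
| AllClass of formula1 m n.+1.

Fixpoint predicative m n (phi : formula1 m n) : Prop :=
  match phi with
  | Imp1 phi psi => predicative phi /\ predicative psi
  | AllSet phi => predicative phi
  | AllClass _ => False
  | _ => True
  end.

Section ClassTheory.
Variable MA : class_structure.
Local Notation M := (set_part MA).
Local Notation A := (@classes MA).

Definition ceval m n (a : m.-tuple M) (E : n.-tuple (set M)) (t : cterm m n) :
    set M :=
  match t with
  | inl i => ext (tnth a i)
  | inr j => tnth E j
  end.

Fixpoint sat1 m n (a : m.-tuple M) (E : n.-tuple (set M)) (phi : formula1 m n) :
    Prop :=
  match phi with
  | Bot1 => False
  | In1 i t => ceval a E t (tnth a i)
  | Eq1 t u => ceval a E t = ceval a E u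
  | Imp1 phi psi => sat1 a E phi -> sat1 a E psi
  | AllSet phi => forall x : M, sat1 (tcons x a) E phi
  | AllClass phi => forall X : set M, A X -> sat1 a (tcons X E) phi
  end.

Definition all_classes n (E : n.-tuple (set M)) := forall j, A (tnth E j).

Record GBC : Prop := {
  (* sets are a subsort of classes *)
  gbc_subsort : forall x : M, A (ext x);
  (* classes being subsets of [M], only the case of sets has content *)
  gbc_extensionality : forall x y : M, ext x = ext y -> x = y;
  gbc_pair : forall x y : M, exists z, is_upair x y z;
  gbc_union : forall x : M, exists z, is_union x z;
  gbc_power : forall x : M, exists z, is_power x z;
  gbc_infinity : exists z : M,
    (exists2 e, is_empty e & isin e z) /\
    (forall x, isin x z -> exists2 s, is_succ x s & isin s z);
  gbc_foundation : forall X : set M, A X -> X !=set0 ->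
    exists2 x, X x & forall y, X y -> ~ isin y x;
  gbc_comprehension : forall m n (phi : formula1 m.+1 n)
    (a : m.-tuple M) (E : n.-tuple (set M)),
    predicative phi -> all_classes E ->
    A [set x | sat1 (tcons x a) E phi];
  gbc_separation : forall (x : M) (X : set M), A X ->
    exists z : M, ext z = ext x `&` X;
  gbc_replacement : forall (F : set M) (x : M), A F -> class_fun F ->
    exists z : M, ext z = [set w | exists2 y, isin y x & crel F y w];
  gbc_choice : forall x : M, (forall y, isin y x -> ~ is_empty y) ->
    exists f : M, [/\ is_fun f, is_dom f x
                    & forall y v, app f y v -> isin v y] }.

Definition binary_tree (T : set M) : Prop :=
  [/\ A T,
      forall f, T f -> exists d, [/\ is_ord d, is_fun f, is_dom f d
                                   & forall x y, app f x y -> in_two y]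
    & forall f d b g, T f -> is_dom f d -> isin b d -> is_restr f b g -> T g].

Definition tree_lt (f g : M) : Prop :=
  (exists a b, [/\ is_dom f a, is_dom g b & ord_lt a b]) /\ subset_in f g.

Definition tree_height (T : set M) : set M :=
  [set d | exists2 f, T f & is_dom f d].

Definition branch (T F : set M) : Prop :=
  [/\ A F, class_fun F,
      [set a | exists f, crel F a f] = Ord M,
      forall a f, crel F a f -> T f /\ is_dom f a
    & forall a b f g, ord_lt a b -> crel F a f -> crel F b g -> tree_lt f g].

Definition Ord_weakly_compact : Prop :=
  forall T : set M, binary_tree T -> tree_height T = Ord M ->
    exists F, branch T F.

Definition BB : set (set M) := [set X | X `<=` Ord M /\ A X].

Definition unbounded (X : set M) : Prop :=
  forall a, Ord M a -> exists2 b, X b & ord_lt a b.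

Definition PP : set (set M) := [set X | BB X /\ unbounded X].

Definition PP_filter (U : set (set M)) : Prop :=
  [/\ U `<=` PP, U !=set0,
      forall X Y, U X -> PP Y -> X `<=` Y -> U Y
    & forall X Y, U X -> U Y -> exists2 Z, U Z & Z `<=` X /\ Z `<=` Y].

Definition PP_dense (D : set (set M)) : Prop :=
  D `<=` PP /\ forall X, PP X -> exists2 Y, D Y & Y `<=` X.

(* Definable with parameters, class quantifiers allowed. *)
Definition definable (D : set (set M)) : Prop :=
  exists m n (phi : formula1 m n.+1) (a : m.-tuple M) (E : n.-tuple (set M)),
    all_classes E /\ D = [set X | A X /\ sat1 a (tcons X E) phi].

Definition generic_ultrafilter (U : set (set M)) : Prop :=
  PP_filter U /\
  forall D, PP_dense D -> definable D -> U `&` D !=set0.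

Definition coded_rel n (R : set (n.-tuple M)) : Prop :=
  A [set z | exists2 t, R t & tuple_code t z].

Definition coded_fun n (f : n.-tuple M -> M) : Prop :=
  coded_rel [set t : n.+1.-tuple M | exists s : n.-tuple M,
    t = [tuple of rcons s (f s)]].

Definition Ord_tuples n : set (n.-tuple M) :=
  [set t | forall i, Ord M (tnth t i)].

Definition BBn n : set (set (n.-tuple M)) :=
  [set X | X `<=` @Ord_tuples n /\ coded_rel X].

Definition slice n (X : set (n.+1.-tuple M)) (a : M) : set (n.-tuple M) :=
  [set t : n.-tuple M | X (tcons a t)].

Fixpoint Upow (U : set (set M)) n : set (set (n.-tuple M)) :=
  match n with
  | 0 => [set [set [tuple]]]
  | n'.+1 => [set X | BBn X /\ U [set a | Ord M a /\ Upow U (slice X a)]]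
  end.

Inductive fsymA : nat -> Type :=
| ConstA of M : fsymA 0
| FunA k (f : k.-tuple M -> M) of coded_fun f : fsymA k.

Inductive rsymA : nat -> Type :=
| MemA : rsymA 2
| RelA k (R : set (k.-tuple M)) of coded_rel R : rsymA k.

Definition L0A : signature := {| fsym := fsymA; rsym := rsymA |}.

Definition fintA k (f : fsymA k) : k.-tuple M -> M :=
  match f in fsymA k return k.-tuple M -> M with
  | ConstA x => fun=> x
  | FunA _ f _ => f
  end.

Definition rintA k (r : rsymA k) : set (k.-tuple M) :=
  match r in rsymA k return set (k.-tuple M) with
  | MemA => [set t | isin (tnth t ord0) (tnth t ord_max)]
  | RelA _ R _ => R
  end.

Definition expansion : structure L0A :=
  @Structure L0A M (sets_inh M) fintA rintA.

Definition eps_reduct (N : structure L0A) : eps_structure :=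
  {| sets := N; sets_inh := univ_inh N;
     isin := fun x y => @rint _ N 2 MemA [tuple x; y] |}.

(* The embedding of M in a model N of the elementary diagram, along which M is
   identified with a substructure of N. *)
Definition std (N : structure L0A) (x : M) : eps_reduct N :=
  @fint _ N 0 (ConstA x) [tuple].

Definition SSy (N : structure L0A) : class_structure :=
  @ClassStructure M
    [set X | exists c : eps_reduct N, X = [set x | isin (std N x) c]].

Variable U : set (set M).

Definition truth_set n (phi : formula L0A n) : set (n.-tuple M) :=
  [set t | Ord_tuples t /\ @sat _ expansion n t phi].

Definition Gam n : set (formula L0A n) := [set phi | Upow U (truth_set phi)].

Definition T_U d (L : orderType d) : set (sentence (with_consts L0A L)) :=
  [set sigma | exists n (l : n.-tuple L) (phi : formula L0A n),
    [/\ sorted <%O l, Gam phi & sigma = inst_formula l phi]].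

Definition trivial_structure (S : signature) : structure S :=
  {| univ := unit; univ_inh := inhabits tt;
     fint := fun _ _ _ => tt; rint := fun _ _ => set0 |}.

(* A prime model of T_{U,L}, unique up to isomorphism; [trivial_structure] is a
   junk value for the case that there is none. *)
Definition gaifman_full d (L : orderType d) : structure (with_consts L0A L) :=
  epsilon (inhabits (trivial_structure _)) (prime_model (@T_U d L)).

Definition gaifman d (L : orderType d) : structure L0A :=
  reduct (gaifman_full L).

Definition gaifman_eps d (L : orderType d) : eps_structure :=
  eps_reduct (gaifman L).

Definition gaifman_const d (L : orderType d) (l : L) : gaifman_eps L :=
  @new_const _ _ (gaifman_full L) l.

(* [gaifman_map i] sends f(c_{k_1}, ..., c_{k_n}) to f(c_{i(k_1)}, ..., c_{i(k_n)});
   its graph is given first because the elements of the prime model are not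
   given syntactically. *)
Definition gaifman_graph d (K : orderType d) d' (L : orderType d') (i : K -> L)
    (x : gaifman_eps K) (y : gaifman_eps L) : Prop :=
  exists n (f : n.-tuple M -> M) (cf : coded_fun f) (k : n.-tuple K),
    [/\ sorted <%O k,
        x = @fint _ (gaifman K) n (FunA cf) (map_tuple (@gaifman_const _ K) k)
      & y = @fint _ (gaifman L) n (FunA cf)
              (map_tuple (fun k => gaifman_const (i k)) k)].

Definition gaifman_map d (K : orderType d) d' (L : orderType d') (i : K -> L)
    (x : gaifman_eps K) : gaifman_eps L :=
  epsilon (sets_inh (gaifman_eps L)) (gaifman_graph i x).

End ClassTheory.

Arguments expansion : clear implicits.
Arguments Ord_tuples : clear implicits.
Arguments generic_ultrafilter : clear implicits.
Arguments Upow : clear implicits.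
Arguments T_U {MA} U {d} L.
Arguments gaifman {MA} U {d} L.
Arguments gaifman_eps {MA} U {d} L.
Arguments gaifman_const {MA} U {d L} l.
Arguments gaifman_map {MA} U {d K d' L} i x.

Definition order_embedding d (K : orderType d) d' (L : orderType d')
    (i : K -> L) : Prop := {mono i : x y / (x <= y)%O}.

Definition order_isomorphism d (K : orderType d) d' (L : orderType d')
    (i : K -> L) : Prop := order_embedding i /\ bijective i.

Definition initial_map d (K : orderType d) d' (L : orderType d')
    (i : K -> L) : Prop :=
  forall l k, (l <= i k)%O -> range i l.

Definition equalizer (X Y Z : Type) (e : X -> Y) (g g' : Y -> Z) : Prop :=
  range e = [set y | g y = g' y].

Definition suborder d (L : orderType d) (B : set L) : Type :=
  {l : L | l \in B}.

HB.instance Definition _ d (L : orderType d) (B : set L) :=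
  SubChoice.on (suborder B).
HB.instance Definition _ d (L : orderType d) (B : set L) :=
  [SubChoice_isSubOrder of suborder B by <: with d].

Definition suborder_incl d (L : orderType d) (B : set L) (l : suborder B) : L :=
  val l.

Definition downward_cofinal (N : eps_structure) (X Y : set N) : Prop :=
  X `<=` Y /\ forall y, Y y -> exists2 x, X x & ord_le x y.

(* Main.v *)
From HB Require Import structures.
From mathcomp Require Import all_boot all_order.
From mathcomp Require Import boolp classical_sets functions cardinality.
From Stdlib Require Import ClassicalEpsilon.
Require Import Defs.
Set Implicit Arguments.
Unset Strict Implicit.
Unset Printing Implicit Defensive.
Import Order.TTheory.
Local Open Scope classical_set_scope.
Local Open Scope card_scope.

(** The model attached to a linear order [L] is a limit of ultrapowers.  Its
    elements can be described by functions [f] of an assignment [s : L -> M] that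
    are definable from classes, and so depend on finitely many coordinates; two of
    them are identified when they agree for almost all [s], and the constant
    [c_l] is the coordinate [s l].  Here almost all ([QU]) means: for [U]-almost
    all values of the smallest relevant coordinate, for [U]-almost all values of
    the next one, and so on.  Most clauses of the theorem become statements
    about values of definable functions at almost all assignments.

    Global choice.  Choice is assumed for sets only, whereas the ultrapower needs
    definable Skolem functions.  They come from weak compactness of [Ord]: the
    nodes of a binary tree record choices of injections of rank segments
    into [Ord], and a branch picks, for each rank, an injection that is determined
    by the set of ordinals coding it, since the coded relation is membership and
    membership can be collapsed in only one way.  This numbers the whole
    universe ([global_numbering]), and least numbers give Skolem functions
    ([dterm_select]).

    The ultrafilter.  Genericity is used through three density arguments: [U]
    decides every class ([Uq_ultra]), is complete with respect to partitions
    indexed by a set ([Uq_complete]), and the quantifier for [U]-almost all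
    ordinals preserves definability ([Uq_iterable], [dfn_Uq]).  The last density
    argument uses weak compactness once more.  Thus the iterated
    quantifiers [WL] and [QU] stay definable and commute with negation.

    The prime model.  Los's theorem ([Los]) makes [limit_power] a model of the
    theory.  In any model of the theory a definable function together with
    constants denotes an element ([denotes]), and what is true of elements so
    denoted is determined by [QU] ([denotes_sat]).  So [limit_power] embeds in every
    model and is prime ([limit_prime]).  The Gaifman model is only known to be some
    prime model; embedding it in [limit_power] shows that its elements
    are all denoted ([gaifman_rep]).  The outcome is a presentation of the functor
    on elements [gval f]: truth is truth for almost all assignments ([gval_sat]),
    all elements have this form ([gval_surj]), and an embedding acts by
    renaming the variables of [f] ([gaifman_map_gval]).  This gives the truth
    lemma, elementarity and functoriality.

    Supports.  The remaining clauses compare the sets of coordinates on which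
    elements depend.  Three facts are used.  A coordinate differs from every
    function that does not depend on it ([var_not_in_support]), since [U] contains
    no singleton.  An element whose rank is at most that of an element supported
    on an initial part of the coordinates is itself independent of the later
    ones ([rank_le_support]), by completeness.  If an element can be described
    without a coordinate, this coordinate can be removed from every description
    of it ([drop_variable]), so that a support of least size is contained in every
    other one.

    If [i] is initial, an element of rank at most that of an element in the range
    of the map is then supported on the range of [i], hence lies in the range.
    For downward cofinality, let [a] be the first coordinate outside the
    range on which an ordinal depends; any [b] below [a] outside the range works,
    because an ordinal below [c_b] would not depend on [a].  For the equalizers, an
    element on which two maps agree has a least support on which
    they agree pointwise.  For the comparison of two maps, the image under [i'] of
    a non-standard ordinal depends on the image of the last coordinate in its
    least support, which lies above everything on which its image under [i]
    depends.  Standard systems are classes because [QU] preserves definability, and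
    a class [X] is coded by its part of rank below [c_l].  The
    cardinality is found by coding elements by finite sequences from [L] and one of
    countably many classes, the square of an infinite type being injectable into
    the type. *)

(** * Definable predicates *)

Lemma tnth_tcons0 T n (x : T) (t : n.-tuple T) : tnth (tcons x t) ord0 = x.
Proof. by []. Qed.

Lemma tnth_tconsS T n (x : T) (t : n.-tuple T) j :
  tnth (tcons x t) (lift ord0 j) = tnth t j.
Proof. by rewrite (tnth_nth x) /= (tnth_nth x). Qed.

Lemma tuple_eq T n (t t' : n.-tuple T) :
  (forall j, tnth t j = tnth t' j) -> t = t'.
Proof. exact: eq_from_tnth. Qed.

Definition ren_lift p p' (r : 'I_p -> 'I_p') (j : 'I_p.+1) : 'I_p'.+1 :=
  if unlift ord0 j is Some k then lift ord0 (r k) else ord0.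

Lemma ren_liftP T p p' (r : 'I_p -> 'I_p') (x : T) (t : p.-tuple T)
    (t' : p'.-tuple T) :
  (forall j, tnth t j = tnth t' (r j)) ->
  forall j, tnth (tcons x t) j = tnth (tcons x t') (ren_lift r j).
Proof.
move=> tE j; rewrite /ren_lift; case: unliftP => [k|] ->.
  by rewrite !tnth_tconsS.
by rewrite !tnth_tcons0.
Qed.

Definition ren_cterm m n m' n' (r : 'I_m -> 'I_m') (q : 'I_n -> 'I_n')
    (t : cterm m n) : cterm m' n' :=
  match t with inl j => inl (r j) | inr j => inr (q j) end.

Fixpoint ren1 m n (phi : formula1 m n) m' n' (r : 'I_m -> 'I_m')
    (q : 'I_n -> 'I_n') : formula1 m' n' :=
  match phi with
  | Bot1 => Bot1 _ _
  | In1 j t => In1 (r j) (ren_cterm r q t)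
  | Eq1 t u => Eq1 (ren_cterm r q t) (ren_cterm r q u)
  | Imp1 phi psi => Imp1 (ren1 phi r q) (ren1 psi r q)
  | AllSet phi => AllSet (ren1 phi (ren_lift r) q)
  | AllClass phi => AllClass (ren1 phi r (ren_lift q))
  end.

Lemma ren1_predicative m n (phi : formula1 m n) m' n' (r : 'I_m -> 'I_m')
    (q : 'I_n -> 'I_n') : predicative phi -> predicative (ren1 phi r q).
Proof.
elim: phi m' n' r q => {m n} //= m n.
  by move=> phi IH1 psi IH2 m' n' r q [? ?]; split; [exact: IH1|exact: IH2].
by move=> phi IH m' n' r q ?; exact: IH.
Qed.

Definition inh_wit (T : Type) (h : inhabited T) : T := epsilon h (fun=> True).

Section Definability.
Variable MA : class_structure.
Local Notation M := (set_part MA).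
Local Notation A := (@classes MA).

Lemma sat1_ren m n (phi : formula1 m n) m' n' (r : 'I_m -> 'I_m')
    (q : 'I_n -> 'I_n') (a : m.-tuple M) (E : n.-tuple (set M)) a' E' :
  (forall j, tnth a j = tnth a' (r j)) ->
  (forall j, tnth E j = tnth E' (q j)) ->
  sat1 a E phi <-> sat1 a' E' (ren1 phi r q).
Proof.
elim: phi m' n' r q a E a' E' => {m n} /=.
- by [].
- move=> m n j t m' n' r q a E a' E' aE EE.
  by rewrite -aE; case: t => k /=; rewrite ?aE ?EE.
- move=> m n t u m' n' r q a E a' E' aE EE.
  by case: t => k; case: u => l /=; rewrite ?aE ?EE.
- move=> m n phi IH1 psi IH2 m' n' r q a E a' E' aE EE.
  have e1 := IH1 _ _ _ _ _ _ _ _ aE EE; have e2 := IH2 _ _ _ _ _ _ _ _ aE EE; tauto.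
- move=> m n phi IH m' n' r q a E a' E' aE EE.
  by split=> H x; apply/(IH _ _ _ _ _ _ _ _ (ren_liftP x aE) EE); exact: H.
- move=> m n phi IH m' n' r q a E a' E' aE EE.
  by split=> H X AX; apply/(IH _ _ _ _ _ _ _ _ aE (ren_liftP X EE)); exact: H.
Qed.

Definition aval (V : Type) (s : V -> M) (r : V + M) : M :=
  match r with inl v => s v | inr c => c end.

(** Definability of a predicate of set variables indexed by [V] and of one class
    variable, by a formula without class quantifiers and with parameters.  Using
    meta-level predicates and an arbitrary index type avoids writing formulas: the
    closure lemmas below follow the syntax of the predicate, and [dfn_tac]
    applies them.  The class variable serves to define dense sets
    of classes. *)
Definition dfn (V : Type) (P : (V -> M) -> set M -> Prop) : Prop :=
  exists m n (phi : formula1 m n.+1) (a : 'I_m -> V + M) (E : n.-tuple (set M)),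
   [/\ predicative phi, all_classes E &
    forall s Y, P s Y <-> sat1 [tuple aval s (a j) | j < m] (tcons Y E) phi].

Lemma dfn_iff V (P Q : (V -> M) -> set M -> Prop) :
  (forall s Y, P s Y <-> Q s Y) -> dfn P -> dfn Q.
Proof.
move=> PQ [m [n [phi [a [E [pp cE H]]]]]].
by exists m, n, phi, a, E; split=> // s Y; rewrite -PQ.
Qed.

Lemma dfn_bot V : dfn (fun (s : V -> M) Y => False).
Proof. by exists 0, 0, (Bot1 _ _), (fun=> inr (inh_wit (sets_inh M))), [tuple]; split=> // -[]. Qed.

Lemma dfn_imp V (P Q : (V -> M) -> set M -> Prop) :
  dfn P -> dfn Q -> dfn (fun s Y => P s Y -> Q s Y).
Proof.
move=> [m [n [phi [a [E [pp cE H]]]]]] [m' [n' [phi' [a' [E' [pp' cE' H']]]]]].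
exists (m + m'), (n + n'),
  (Imp1 (ren1 phi (lshift m') (ren_lift (lshift n')))
        (ren1 phi' (@rshift m m') (ren_lift (@rshift n n')))),
  (fun j => match fintype.split j with inl k => a k | inr k => a' k end),
  [tuple of E ++ E'].
split.
- by split; exact: ren1_predicative.
- move=> j; rewrite -(splitK j); case: (fintype.split j) => k /=.
    by rewrite tnth_lshift.
  by rewrite tnth_rshift.
- move=> s Y /=.
  rewrite H H'.
  have e1 := sat1_ren phi (r := lshift m') (q := ren_lift (lshift n'))
    (a := [tuple aval s (a j) | j < m]) (E := tcons Y E)
    (a' := [tuple aval s match fintype.split j with inl k => a k | inr k => a' k end | j < m + m'])
    (E' := tcons Y [tuple of E ++ E']).
  have e2 := sat1_ren phi' (r := @rshift m m') (q := ren_lift (@rshift n n'))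
    (a := [tuple aval s (a' j) | j < m']) (E := tcons Y E')
    (a' := [tuple aval s match fintype.split j with inl k => a k | inr k => a' k end | j < m + m'])
    (E' := tcons Y [tuple of E ++ E']).
  rewrite e1 ?e2 //.
  + by move=> j; rewrite !tnth_mktuple (unsplitK (inr j)).
  + by apply: ren_liftP => j; rewrite tnth_rshift.
  + by move=> j; rewrite !tnth_mktuple (unsplitK (inl j)).
  + by apply: ren_liftP => j; rewrite tnth_lshift.
Qed.

Definition ocons V (x : M) (s : V -> M) (o : option V) : M :=
  if o is Some v then s v else x.

Lemma dfn_all V (P : (V -> M) -> set M -> M -> Prop) :
  dfn (fun (s : option V -> M) Y => P (fun v => s (Some v)) Y (s None)) ->
  dfn (fun s Y => forall x, P s Y x).
Proof.
move=> [m [n [phi [a [E [pp cE H]]]]]].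
pose d := inh_wit (sets_inh M).
exists m, n, (AllSet (ren1 phi (fun j => if a j is inl None then ord0 else lift ord0 j) id)),
  (fun j => match a j with inl (Some v) => inl v | inl None => inr d
            | inr c => inr c end), E.
split=> //; first exact: ren1_predicative.
move=> s Y; rewrite -[sat1 _ _ _]/(forall x, _); apply: (iff_trans (B := forall x,
  sat1 [tuple aval (ocons x s) (a j) | j < m] (tcons Y E) phi)).
  by split=> HP x; apply/(H (ocons x s) Y); exact: HP.
split=> HP x; move: (HP x); apply: iffLR; [|symmetry]; apply: sat1_ren => // j;
  rewrite tnth_mktuple; case aj: (a j) => [[v|]|c] //=;
  by rewrite tnth_tconsS tnth_mktuple aj.
Qed.

Lemma dfn_subst V V' (rho : V -> V' + M) (P : (V -> M) -> set M -> Prop) :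
  dfn P -> dfn (fun s Y => P (fun v => aval s (rho v)) Y).
Proof.
move=> [m [n [phi [a [E [pp cE H]]]]]].
exists m, n, phi, (fun j => match a j with inl v => rho v | inr c => inr c end), E.
split=> // s Y; rewrite H.
suff -> : [tuple aval (fun v => aval s (rho v)) (a j)  | j < m] =
  [tuple aval s match a j with inl v => rho v | inr c => inr c end  | j < m] by [].
by apply: tuple_eq => j; rewrite !tnth_mktuple; case: (a j).
Qed.

Lemma dfn_ren V V' (rho : V -> V') (P : (V -> M) -> set M -> Prop) :
  dfn P -> dfn (fun s Y => P (fun v => s (rho v)) Y).
Proof. exact: (dfn_subst (fun v => inl (rho v))). Qed.

Lemma dfn_fix_class V (P : (V -> M) -> set M -> Prop) X :
  A X -> dfn P -> dfn (fun s _ => P s X).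
Proof.
move=> AX [m [n [phi [a [E [pp cE H]]]]]].
exists m, n.+1, (ren1 phi id (lift ord0)), a, (tcons X E).
split; first exact: ren1_predicative.
  by move=> j; case: (unliftP ord0 j) => [k|] ->; rewrite ?tnth_tconsS.
move=> s Y; rewrite H; apply: sat1_ren => // j.
by rewrite tnth_tconsS.
Qed.

(** A formula has finitely many variables; this is where finite supports come
    from. *)
Lemma dfn_support (V : eqType) (P : (V -> M) -> set M -> Prop) : dfn P ->
  exists l : seq V, forall s s' Y,
    (forall v, v \in l -> s v = s' v) -> P s Y <-> P s' Y.
Proof.
move=> [m [n [phi [a [E [pp cE H]]]]]].
exists (flatten [seq if a j is inl v then [:: v] else [::] | j <- enum 'I_m]).
move=> s s' Y ss'; rewrite !H.
suff -> : [tuple aval s (a j) | j < m] = [tuple aval s' (a j) | j < m] by [].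
apply: tuple_eq => j; rewrite !tnth_mktuple; case aj: (a j) => [v|] //.
apply: ss'; apply/flatten_mapP; exists j; first by rewrite mem_enum.
by rewrite aj inE.
Qed.

Lemma dfn_in_var V (r r' : V + M) :
  dfn (fun s Y => isin (aval s r) (aval s r')).
Proof.
exists 2, 0, (In1 ord0 (inl ord_max)), (fun j => if j == ord0 then r else r'), [tuple].
split=> // [[]//|s Y] /=.
by rewrite /ext /= !tnth_mktuple.
Qed.

Lemma dfn_eq_var V (r r' : V + M) : GBC MA ->
  dfn (fun s Y => aval s r = aval s r').
Proof.
move=> hG.
exists 2, 0, (Eq1 (inl ord0) (inl ord_max)), (fun j => if j == ord0 then r else r'), [tuple].
split=> // [[]//|s Y] /=.
rewrite !tnth_mktuple /=; split=> [->//|]; exact: gbc_extensionality.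
Qed.

Lemma dfn_Y_var V (r : V + M) : dfn (fun s Y => Y (aval s r)).
Proof.
exists 1, 0, (In1 ord0 (inr ord0)), (fun j => r), [tuple].
split=> // [[]//|s Y] /=.
by rewrite tnth_mktuple.
Qed.

Lemma dfn_not V (P : (V -> M) -> set M -> Prop) :
  dfn P -> dfn (fun s Y => ~ P s Y).
Proof. by move=> dP; exact: dfn_imp dP (dfn_bot V). Qed.

Lemma dfn_or V (P Q : (V -> M) -> set M -> Prop) :
  dfn P -> dfn Q -> dfn (fun s Y => P s Y \/ Q s Y).
Proof.
move=> dP dQ; apply: dfn_iff (dfn_imp (dfn_not dP) dQ) => s Y.
split=> [H|[]//]; by have [|/H] := pselect (P s Y); [left|right].
Qed.

Lemma dfn_and V (P Q : (V -> M) -> set M -> Prop) :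
  dfn P -> dfn Q -> dfn (fun s Y => P s Y /\ Q s Y).
Proof.
move=> dP dQ; apply: dfn_iff (dfn_not (dfn_imp dP (dfn_not dQ))) => s Y.
by split=> [H|[p q] H]; [split; apply: contrapT => N; apply: H|exact: H].
Qed.

Lemma dfn_iff2 V (P Q : (V -> M) -> set M -> Prop) :
  dfn P -> dfn Q -> dfn (fun s Y => P s Y <-> Q s Y).
Proof. by move=> dP dQ; apply: dfn_and; exact: dfn_imp. Qed.

Lemma dfn_ex V (P : (V -> M) -> set M -> M -> Prop) :
  dfn (fun (s : option V -> M) Y => P (fun v => s (Some v)) Y (s None)) ->
  dfn (fun s Y => exists x, P s Y x).
Proof.
move=> dP.
apply: (dfn_iff (P := fun s Y => ~ forall x, ~ P s Y x)).
  by move=> s Y; split=> [/existsNP[x /contrapT]|[x Px] /(_ x)//]; exists x.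
by apply: dfn_not; apply: dfn_all; exact: dfn_not.
Qed.

Lemma dfn_prop V (P : Prop) : dfn (fun (_ : V -> M) _ => P).
Proof.
have [p|np] := pselect P; last by apply: dfn_iff (dfn_bot V) => s Y; split=> [|/np].
by apply: dfn_iff (dfn_not (dfn_bot V)) => s Y; split=> // _ [].
Qed.

Lemma dfn_ex2 V (P Q : (V -> M) -> set M -> M -> Prop) :
  dfn (fun (s : option V -> M) Y => P (fun v => s (Some v)) Y (s None)) ->
  dfn (fun (s : option V -> M) Y => Q (fun v => s (Some v)) Y (s None)) ->
  dfn (fun s Y => exists2 x, P s Y x & Q s Y x).
Proof.
move=> dP dQ; apply: (dfn_iff (P := fun s Y => exists x, P s Y x /\ Q s Y x)).
  by move=> s Y; split=> [[x [pP pQ]]|[x pP pQ]]; exists x.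
by apply: dfn_ex; exact: dfn_and.
Qed.

Lemma dfn_and3 V (P Q R : (V -> M) -> set M -> Prop) :
  dfn P -> dfn Q -> dfn R -> dfn (fun s Y => [/\ P s Y, Q s Y & R s Y]).
Proof.
move=> dP dQ dR; apply: dfn_iff (dfn_and dP (dfn_and dQ dR)) => s Y.
by split=> [[? []]|[]].
Qed.

Lemma dfn_and4 V (P Q R T : (V -> M) -> set M -> Prop) :
  dfn P -> dfn Q -> dfn R -> dfn T ->
  dfn (fun s Y => [/\ P s Y, Q s Y, R s Y & T s Y]).
Proof.
move=> dP dQ dR dT; apply: dfn_iff (dfn_and dP (dfn_and3 dQ dR dT)) => s Y.
by split=> [[? []]|[]].
Qed.

Lemma dfn_and5 V (P Q R T T' : (V -> M) -> set M -> Prop) :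
  dfn P -> dfn Q -> dfn R -> dfn T -> dfn T' ->
  dfn (fun s Y => [/\ P s Y, Q s Y, R s Y, T s Y & T' s Y]).
Proof.
move=> dP dQ dR dT dT'; apply: dfn_iff (dfn_and dP (dfn_and4 dQ dR dT dT')) => s Y.
by split=> [[? []]|[]].
Qed.

Lemma dfn_or3 V (P Q R : (V -> M) -> set M -> Prop) :
  dfn P -> dfn Q -> dfn R -> dfn (fun s Y => [\/ P s Y, Q s Y | R s Y]).
Proof.
move=> dP dQ dR; apply: dfn_iff (dfn_or dP (dfn_or dQ dR)) => s Y.
by split=> [[?|[?|?]]|[?|?|?]]; [constructor 1|constructor 2|constructor 3|left|right;left|right;right].
Qed.

(** Functions are treated through their graph; the value is the extra variable
    [None]. *)
Definition dterm V (f : (V -> M) -> M) : Prop :=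
  dfn (fun (s : option V -> M) _ => s None = f (fun v => s (Some v))).

Hypothesis hG : GBC MA.

Lemma dterm_var V (v : V) : dterm (fun s => s v).
Proof. exact: (dfn_eq_var (inl None) (inl (Some v))). Qed.

Lemma dterm_const V (c : M) : dterm (fun s : V -> M => c).
Proof. exact: (dfn_eq_var (inl None) (inr c)). Qed.

(** Composition with a definable function costs one set quantifier: some [y]
    equal to [f s] satisfies [Q]. *)
Lemma dfn_bind V (Q : (option V -> M) -> set M -> Prop) f :
  dfn Q -> dterm f -> dfn (fun (s : V -> M) Y => Q (ocons (f s) s) Y).
Proof.
move=> dQ df.
apply: (dfn_iff (P := fun s Y => exists y, y = f s /\ Q (ocons y s) Y)).
  by move=> s Y; split=> [[y [-> ]]//|]; exists (f s).
apply: dfn_ex; apply: dfn_and => //.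
apply: (dfn_iff (P := fun s Y => Q s Y)) => // s Y.
by have <- : s = ocons (s None) (fun v => s (Some v)) by apply/funext => -[].
Qed.

Lemma dterm_wk V (f : (V -> M) -> M) : dterm f ->
  dterm (fun s : option V -> M => f (fun v => s (Some v))).
Proof.
exact: (dfn_ren (fun o : option V => if o is Some v then Some (Some v) else None)).
Qed.

Definition def1 (P : M -> Prop) := dfn (fun (s : unit -> M) _ => P (s tt)).
Definition def2 (R : M -> M -> Prop) :=
  dfn (fun (s : bool -> M) _ => R (s true) (s false)).
Definition def3 (R : M -> M -> M -> Prop) :=
  dfn (fun (s : option bool -> M) _ => R (s (Some true)) (s (Some false)) (s None)).
Definition dfun1 (F : M -> M) := def2 (fun x y => y = F x).
Definition dfun2 (F : M -> M -> M) := def3 (fun x y z => z = F x y).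

Lemma dfn1 V P (f : (V -> M) -> M) : def1 P -> dterm f ->
  dfn (fun s Y => P (f s)).
Proof.
move=> dP df; apply: (dfn_bind (Q := fun s _ => P (s None))) df.
exact: (dfn_ren (fun=> None) dP).
Qed.

Lemma dfn2 V R (f g : (V -> M) -> M) : def2 R -> dterm f -> dterm g ->
  dfn (fun s Y => R (f s) (g s)).
Proof.
move=> dP df dg.
apply: (dfn_bind (Q := fun s _ => R (s None) (g (fun v => s (Some v))))) df.
apply: (dfn_bind (Q := fun s _ => R (s (Some None)) (s None))) (dterm_wk dg).
exact: (dfn_ren (fun b : bool => if b then Some None else None) dP).
Qed.

Lemma dfn3 V R (f g h : (V -> M) -> M) :
  def3 R -> dterm f -> dterm g -> dterm h ->
  dfn (fun s Y => R (f s) (g s) (h s)).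
Proof.
move=> dP df dg dh.
apply: (dfn_bind (Q := fun s _ => R (s None) (g (fun v => s (Some v))) (h (fun v => s (Some v))))) df.
apply: (dfn_bind (Q := fun s _ => R (s (Some None)) (s None) (h (fun v => s (Some (Some v)))))) (dterm_wk dg).
apply: (dfn_bind (Q := fun s _ => R (s (Some (Some None))) (s (Some None)) (s None))) (dterm_wk (dterm_wk dh)).
exact: (dfn_ren (fun o : option bool => match o with
  Some true => Some (Some None) | Some false => Some None | None => None end) dP).
Qed.

Lemma dterm1 V F (f : (V -> M) -> M) : dfun1 F -> dterm f ->
  dterm (fun s => F (f s)).
Proof.
move=> dF df; apply: (dfn2 (R := fun x y => y = F x)
  (f := fun s => f (fun v => s (Some v))) (g := fun s => s None)) => //.
  exact: dterm_wk.
exact: dterm_var.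
Qed.

Lemma dterm2 V F (f g : (V -> M) -> M) : dfun2 F -> dterm f -> dterm g ->
  dterm (fun s => F (f s) (g s)).
Proof.
move=> dF df dg; apply: (dfn3 (R := fun x y z => z = F x y)
  (f := fun s => f (fun v => s (Some v)))
  (g := fun s => g (fun v => s (Some v))) (h := fun s => s None)) => //;
 by [exact: dterm_wk|exact: dterm_var].
Qed.

Lemma def2_in : def2 (@isin M).
Proof. exact: (dfn_in_var (inl true) (inl false)). Qed.

Lemma def2_eq : def2 (@eq M).
Proof. exact: (dfn_eq_var (inl true) (inl false)). Qed.

Lemma def1_class X : A X -> def1 X.
Proof. by move=> AX; exact: (dfn_fix_class AX (dfn_Y_var (inl tt))). Qed.

Lemma dfn_Y V (f : (V -> M) -> M) : dterm f -> dfn (fun s Y => Y (f s)).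
Proof.
move=> df; apply: (dfn_bind (Q := fun s Y => Y (s None))) df.
exact: (dfn_Y_var (inl None)).
Qed.

(** Comprehension, with the formula hidden: this is how classes are produced
    throughout. *)
Lemma class_of_def1 (P : M -> Prop) : def1 P -> A [set x | P x].
Proof.
move=> [m [n [phi [a [E [pp cE H]]]]]].
pose d := inh_wit (sets_inh M).
have Ad : A (ext d) by exact: gbc_subsort.
have := @gbc_comprehension _ hG m n.+1
  (ren1 phi (fun j => if a j is inl tt then ord0 else lift ord0 j) id)
  [tuple if a j is inr c then c else d | j < m] (tcons (ext d) E).
have -> : [set x | sat1 (tcons x [tuple if a j is inr c then c else d  | j < m])
    (tcons (ext d) E) (ren1 phi (fun j => if a j is inl tt then ord0 else lift ord0 j) id)]
  = [set x | P x].
  rewrite predeqE => x /=.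
  have <- := sat1_ren phi (a := [tuple aval (fun=> x) (a j) | j < m]) (E := tcons (ext d) E).
  - by rewrite -H.
  - move=> j; rewrite tnth_mktuple; case aj: (a j) => [[]|c] //=.
    by rewrite tnth_tconsS tnth_mktuple aj.
  - by [].
apply; first exact: ren1_predicative.
by move=> j; case: (unliftP ord0 j) => [k|] ->; rewrite ?tnth_tconsS.
Qed.

(** The link with the dense sets that a generic filter has to meet. *)
Lemma definable_of_dfn V (s : V -> M) (P : (V -> M) -> set M -> Prop) :
  dfn P -> definable [set Y | A Y /\ P s Y].
Proof.
move=> [m [n [phi [a [E [pp cE H]]]]]].
exists m, n, phi, [tuple aval s (a j) | j < m], E; split=> //.
by rewrite predeqE => Y /=; rewrite H.
Qed.

End Definability.

Create HintDb def.
#[local] Hint Resolve def2_in def2_eq def1_class : def.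

Ltac dfn_atom :=
  match goal with
  | |- dfn (fun s Y => Y (@?f s)) => apply: (dfn_Y (f := f))
  | |- dfn (fun s Y => ?P (@?f s)) =>
      apply: (dfn1 (P := P) (f := f)); [by eauto 3 with def nocore | ]
  | |- dfn (fun s Y => ?R (@?f s) (@?g s)) =>
      apply: (dfn2 (R := R) (f := f) (g := g)); [by eauto 3 with def nocore | | ]
  | |- dfn (fun s Y => ?R (@?f s) (@?g s) (@?h s)) =>
      apply: (dfn3 (R := R) (f := f) (g := g) (h := h)); [by eauto 3 with def nocore | | | ]
  | hG : GBC _ |- dterm (fun s => ?F (@?f s)) =>
      apply: (dterm1 hG (F := F) (f := f)); [by eauto 3 with def nocore | ]
  | hG : GBC _ |- dterm (fun s => ?F (@?f s) (@?g s)) =>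
      apply: (dterm2 hG (F := F) (f := f) (g := g)); [by eauto 3 with def nocore | | ]
  end.

Ltac dfn_step :=
  first [apply: dterm_var; assumption | apply: dterm_const; assumption | apply: dfn_prop |
  lazymatch goal with
  | |- dfn (fun s Y => ~ _) => apply: dfn_not
  | |- dfn (fun s Y => _ /\ _) => apply: dfn_and
  | |- dfn (fun s Y => _ \/ _) => apply: dfn_or
  | |- dfn (fun s Y => _ <-> _) => apply: dfn_iff2
  | |- dfn (fun s Y => and3 _ _ _) => apply: dfn_and3
  | |- dfn (fun s Y => and4 _ _ _ _) => apply: dfn_and4
  | |- dfn (fun s Y => and5 _ _ _ _ _) => apply: dfn_and5
  | |- dfn (fun s Y => or3 _ _ _) => apply: dfn_or3
  | |- dfn (fun s Y => @ex2 _ _ _) => apply: dfn_ex2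
  | |- dfn (fun s Y => @ex _ _) => apply: dfn_ex
  | |- dfn (fun s Y => forall x, _) => first [apply: dfn_imp | apply: dfn_all]
  | |- _ => dfn_atom
  end].

Ltac dfn_tac := repeat (dfn_step; cbv beta).

Ltac def_tac := rewrite /dfun1 /dfun2 /def1 /def2 /def3; cbv beta; dfn_tac.

(** * Sets, ordinals and recursion inside a class structure *)

Section SetTheory.
Variable MA : class_structure.
Local Notation M := (set_part MA).
Local Notation A := (@classes MA).
Hypothesis hG : GBC MA.
Implicit Types (x y z w u v a b f j : M).

(** A default value for functions that are made total. *)
Definition pt : M := inh_wit (sets_inh M).

Lemma set_ext x y : (forall w, isin w x <-> isin w y) -> x = y.
Proof. by move=> xy; apply: gbc_extensionality => //; rewrite predeqE. Qed.

(** A predicate is small when its extension is a set.  Sets are then handled as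
    predicates, and [mkset] is used only when the set itself is needed. *)
Definition small (P : M -> Prop) := exists z, forall w, isin w z <-> P w.
Definition mkset (P : M -> Prop) : M :=
  epsilon (sets_inh M) (fun z => forall w, isin w z <-> P w).

Lemma mksetP P w : small P -> isin w (mkset P) <-> P w.
Proof. by move=> sP; exact: (epsilon_spec (sets_inh M) _ sP). Qed.

Lemma mkset_eq P z : (forall w, isin w z <-> P w) -> z = mkset P.
Proof. by move=> zP; apply: set_ext => w; rewrite mksetP //; exists z. Qed.

Lemma mkset_uniq P z : small P -> z = mkset P <-> (forall w, isin w z <-> P w).
Proof. by move=> sP; split=> [-> w|]; [exact: mksetP|exact: mkset_eq]. Qed.

Lemma small_def1 P : small P -> def1 P.
Proof.
move=> [z zP]; apply: (dfn_iff (P := fun s _ => isin (s tt) z)) => //.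
by dfn_tac.
Qed.

Lemma small_sub P Q : small P -> def1 Q -> (forall w, Q w -> P w) -> small Q.
Proof.
move=> [z zP] dQ QP.
have [y yE] := gbc_separation hG z (class_of_def1 hG dQ).
exists y => w; have : ext y w = (ext z `&` [set x | Q x]) w by rewrite yE.
rewrite /ext /= => ->; split=> [[]//|Qw]; split=> //; exact/zP/QP.
Qed.

Lemma small_ext P Q : small P -> (forall w, Q w <-> P w) -> small Q.
Proof. by move=> [z zP] QP; exists z => w; rewrite QP. Qed.

Lemma small_upair x y : small (fun w => w = x \/ w = y).
Proof. exact: gbc_pair. Qed.

Lemma small_union P : small P -> small (fun w => exists2 y, P y & isin w y).
Proof.
move=> [z zP]; have [y yP] := gbc_union hG z; exists y => w; rewrite yP.
by split=> -[v vz wv]; exists v => //; exact/zP.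
Qed.

Lemma small_power x : small (fun w => subset_in w x).
Proof. exact: gbc_power. Qed.

Definition upair x y := mkset (fun w => w = x \/ w = y).
Definition opair x y := upair (upair x x) (upair x y).

Lemma in_upair x y w : isin w (upair x y) <-> w = x \/ w = y.
Proof. exact: (mksetP _ (small_upair x y)). Qed.

Lemma is_opairE x y z : is_opair x y z <-> z = opair x y.
Proof.
split=> [[s [p [xs xyp spz]]]|->].
  have {}xs : s = upair x x by exact: mkset_eq.
  have {}xyp : p = upair x y by exact: mkset_eq.
  by rewrite /opair -xs -xyp; exact: mkset_eq.
by exists (upair x x), (upair x y); split=> w; exact: in_upair.
Qed.

Lemma def3_upair : def3 (@is_upair M).
Proof. by rewrite /is_upair; def_tac. Qed.
Hint Resolve def3_upair : def.

Lemma def3_opair : def3 (@is_opair M).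
Proof. by rewrite /is_opair; def_tac. Qed.
Hint Resolve def3_opair : def.

Lemma dfun2_opair : dfun2 opair.
Proof.
apply: (dfn_iff (P := fun s _ => is_opair (s (Some true)) (s (Some false)) (s None))).
  by move=> s Y; exact: is_opairE.
by dfn_tac.
Qed.
Hint Resolve dfun2_opair : def.

Lemma upair_inj1 x x' y' : upair x x = upair x' y' -> x' = x /\ y' = x.
Proof.
move=> e; split.
  have : isin x' (upair x x) by rewrite e in_upair; left.
  by rewrite in_upair => -[].
have : isin y' (upair x x) by rewrite e in_upair; right.
by rewrite in_upair => -[].
Qed.

Lemma opair_inj x y x' y' : opair x y = opair x' y' -> x = x' /\ y = y'.
Proof.
move=> e.
have : isin (upair x x) (opair x' y') by rewrite -e /opair in_upair; left.
rewrite in_upair => /= xE.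
have exx : x = x'.
  by case: xE => /upair_inj1[].
split=> //; move: e; rewrite -exx => e {xE x' exx}.
have : isin (upair x y) (opair x y') by rewrite -e /opair in_upair; right.
have : isin (upair x y') (opair x y) by rewrite e /opair in_upair; right.
rewrite !in_upair => -[h1|h1] [h2|h2].
- by have [_ ->] := upair_inj1 (esym h1); have [_ ->] := upair_inj1 (esym h2).
- by have [_ e1] := upair_inj1 (esym h1); move: h2; rewrite e1 => /esym/upair_inj1[].
- by have [_ e1] := upair_inj1 (esym h2); move: h1; rewrite e1 => /esym/upair_inj1[].
have : isin y (upair x y') by rewrite -h2 in_upair; right.
have : isin y' (upair x y) by rewrite -h1 in_upair; right.
by rewrite !in_upair => -[->|->//] [->|->].
Qed.

Lemma crelE (F : set M) x y : crel F x y <-> F (opair x y).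
Proof. by split=> [[p /is_opairE -> //]|Fp]; exists (opair x y) => //; exact/is_opairE. Qed.

Lemma appE f x y : app f x y <-> isin (opair x y) f.
Proof. exact: crelE. Qed.

Lemma small_image (R : M -> M -> Prop) P : def2 R ->
  (forall x y y', R x y -> R x y' -> y = y') -> small P ->
  small (fun w => exists2 y, P y & R y w).
Proof.
move=> dR Rf [z zP].
pose F := [set p : M | exists x y, p = opair x y /\ R x y].
have AF : A F.
  apply: class_of_def1 => //; def_tac.
have Fe x y : crel F x y <-> R x y.
  rewrite crelE; split=> [[x' [y' [/opair_inj[-> ->]]]]//|Rxy].
  by exists x, y.
have [|y yE] := gbc_replacement hG z AF.
  split=> [p [x [y [-> _]]]|x y y']; first by exists x, y; exact/is_opairE.
  by rewrite !Fe; exact: Rf.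
exists y => w; rewrite -[isin w y]/(ext y w) yE /=.
by split=> -[v vz wv]; exists v; first [exact/zP|exact/Fe].
Qed.

Lemma small_imagef (F : M -> M) P : dfun1 F -> small P ->
  small (fun w => exists2 y, P y & w = F y).
Proof.
move=> dF; apply: (small_image (R := fun y w => w = F y)).
  by rewrite /def2; exact: dF.
by move=> x y y' -> ->.
Qed.

(** A functional relation becomes a total definable function, so that it can
    occur inside terms. *)
Lemma dfun_of_rel (H : M -> M -> Prop) d : def2 H ->
  (forall x y y', H x y -> H x y' -> y = y') ->
  exists F, [/\ dfun1 F, forall x y, H x y -> F x = y &
                forall x, (~ exists y, H x y) -> F x = d].
Proof.
move=> dH Hf.
pose F x := epsilon (sets_inh M) (fun y => H x y \/ (~ (exists y, H x y)) /\ y = d).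
have FP x : H x (F x) \/ (~ (exists y, H x y)) /\ F x = d.
  apply: (epsilon_spec (sets_inh M) (fun y => H x y \/ (~ (exists y, H x y)) /\ y = d)).
  by have [[y Hxy]|N] := pselect (exists y, H x y); [exists y; left|exists d; right].
exists F; split.
- apply: (dfn_iff (P := fun s _ => H (s true) (s false) \/
    (~ (exists y, H (s true) y)) /\ s false = d)).
    move=> s Y; split=> [HH|->]; last exact: FP.
    case: (FP (s true)) => [H1|[N ->]].
      by case: HH => [/Hf/(_ H1)//|[]]; case; exists (F (s true)).
    by case: HH => [H2|[_ ->]//]; case: N; exists (s false).
  by dfn_tac.
- move=> x y Hxy; case: (FP x) => [/Hf/(_ Hxy)//|[]]; case; by exists y.
- by move=> x N; case: (FP x) => [H1|[]//]; case: N; exists (F x).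
Qed.

(** ** Foundation *)

Lemma eps_ind (P : M -> Prop) : def1 P ->
  (forall x, (forall y, isin y x -> P y) -> P x) -> forall x, P x.
Proof.
move=> dP IH x; apply: contrapT => nPx.
have AX : A [set x | ~ P x] by apply: class_of_def1 => //; def_tac.
have [|y nPy ymin] := gbc_foundation hG AX; first by exists x.
by apply: nPy; apply: IH => z zy; apply: contrapT => /ymin.
Qed.

Lemma in_irr x : ~ isin x x.
Proof.
move: x; apply: eps_ind; first by def_tac.
by move=> x IH xx; exact: (IH x xx).
Qed.

Lemma in_asym x y : isin x y -> ~ isin y x.
Proof.
move: x y; apply: eps_ind; first by def_tac.
by move=> x IH y xy yx; exact: (IH y yx x).
Qed.

Lemma in_asym3 x y z : isin x y -> isin y z -> ~ isin z x.
Proof.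
move: x y z; apply: eps_ind; first by def_tac.
by move=> x IH y z xy yz zx; exact: (IH z zx x y).
Qed.

(** ** Ordinals *)

Lemma def2_subset : def2 (@subset_in M).
Proof. by rewrite /subset_in; def_tac. Qed.
Lemma def1_empty : def1 (@is_empty M).
Proof. by rewrite /is_empty; def_tac. Qed.
Hint Resolve def2_subset def1_empty : def.
Lemma def1_transitive : def1 (@transitive_in M).
Proof. by rewrite /transitive_in; def_tac. Qed.
Hint Resolve def1_transitive : def.
Lemma def1_is_ord : def1 (@is_ord M).
Proof. by rewrite /is_ord; def_tac. Qed.
Lemma def1_Ord : def1 (Ord M).
Proof. exact: def1_is_ord. Qed.
Hint Resolve def1_is_ord def1_Ord : def.

Lemma is_ordP x : transitive_in x ->
  (forall y z, isin y x -> isin z x -> [\/ isin y z, y = z | isin z y]) -> Ord M x.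
Proof.
move=> xt xl; split=> // s sx sN0.
have [|y sy ymin] := gbc_foundation hG (gbc_subsort hG s).
  by apply: contrapT => N; apply: sN0 => w ws; apply: N; exists w.
by exists y.
Qed.

Lemma ord_trans x y z : Ord M z -> isin x y -> isin y z -> isin x z.
Proof. by move=> [zt _ _] xy yz; exact: zt yz _ xy. Qed.

Lemma ord_in x y : Ord M x -> isin y x -> Ord M y.
Proof.
move=> ox yx; have [xt xl _] := ox; apply: is_ordP.
  move=> z zy w wz.
  have zx := xt _ yx _ zy; have wx := xt _ zx _ wz.
  by case: (xl _ _ wx yx) => // [wy|yw];
    [case: (in_asym wz); rewrite wy|case: (in_asym3 wz zy)].
by move=> z w zy wy; apply: xl; exact: (xt _ yx).
Qed.

Lemma ord_ind (P : M -> Prop) : def1 P ->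
  (forall x, Ord M x -> (forall y, isin y x -> P y) -> P x) ->
  forall x, Ord M x -> P x.
Proof.
move=> dP IH; apply: (eps_ind (P := fun x => Ord M x -> P x)); first by def_tac.
by move=> x IHx ox; apply: IH => // y yx; apply: IHx => //; exact: ord_in yx.
Qed.

Lemma ord_tri x y : Ord M x -> Ord M y -> [\/ isin x y, x = y | isin y x].
Proof.
move=> ox; move: x ox y; apply: (ord_ind (P := fun x => forall y, Ord M y -> [\/ isin x y, x = y | isin y x])).
  by def_tac.
move=> x ox IHx; apply: ord_ind; first by def_tac.
move=> y oy IHy.
have [[x' x'x [x'y|yx']]|N1] := pselect (exists2 x', isin x' x & x' = y \/ isin y x').
- by constructor 3; rewrite -x'y.
- by constructor 3; exact: ord_trans yx' x'x.
have [[y' y'y [y'x|xy']]|N2] := pselect (exists2 y', isin y' y & x = y' \/ isin x y').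
- by constructor 1; rewrite y'x.
- by constructor 1; exact: ord_trans xy' y'y.
constructor 2; apply: set_ext => w; split=> ww.
  case: (IHx w ww y oy) => // h; case: N1; exists w => //; tauto.
case: (IHy w ww) => // h; case: N2; exists w => //; tauto.
Qed.

Lemma ord_least (P : M -> Prop) : def1 P -> (exists2 x, Ord M x & P x) ->
  exists x, [/\ Ord M x, P x & forall y, Ord M y -> P y -> ~ isin y x].
Proof.
move=> dP [x ox Px].
have AX : A [set x | Ord M x /\ P x] by apply: class_of_def1 => //; def_tac.
have [|y [oy Py] ymin] := gbc_foundation hG AX; first by exists x.
by exists y; split=> // z oz Pz; exact: ymin.
Qed.

Lemma ord_of_ords x : transitive_in x -> (forall y, isin y x -> Ord M y) -> Ord M x.
Proof. by move=> xt xo; apply: is_ordP => // y z yx zx; apply: ord_tri; exact: xo. Qed.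

Definition osucc x := mkset (fun w => isin w x \/ w = x).

Lemma small_succ x : small (fun w => isin w x \/ w = x).
Proof.
apply: small_ext (small_union (small_upair x (upair x x))) _ => w.
split=> [[wx|->]|].
- by exists x => //; left.
- by exists (upair x x); [right|apply/in_upair; left].
by move=> [y [->|->]]; [left|rewrite in_upair => -[]; right].
Qed.

Lemma in_osucc x w : isin w (osucc x) <-> isin w x \/ w = x.
Proof. exact: (mksetP _ (small_succ x)). Qed.

Lemma dfun1_osucc : dfun1 osucc.
Proof.
apply: (dfn_iff (P := fun s _ => forall w, isin w (s false) <-> isin w (s true) \/ w = s true)).
  by move=> s Y; rewrite /osucc mkset_uniq //; exact: small_succ.
by dfn_tac.
Qed.
Hint Resolve dfun1_osucc : def.

Lemma ord_succ x : Ord M x -> Ord M (osucc x).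
Proof.
move=> ox; apply: ord_of_ords => [y|y]; rewrite in_osucc.
  move=> [yx|->] z zy; rewrite in_osucc; left => //; exact: ord_trans zy yx.
by case=> [/(ord_in ox)|->].
Qed.

Lemma succ_ord_in x : isin x (osucc x).
Proof. by rewrite in_osucc; right. Qed.

Lemma small_bounded P : small P -> (forall x, P x -> Ord M x) ->
  exists2 b, Ord M b & forall x, P x -> isin x b.
Proof.
move=> sP oP.
have su := small_union sP; pose u := mkset (fun w => exists2 y, P y & isin w y).
have ou : Ord M u.
  apply: ord_of_ords => [y|y]; rewrite /u mksetP // => -[v Pv yv].
    move=> z zy; rewrite mksetP //; exists v => //; exact: ord_trans (oP _ Pv) zy yv.
  exact: ord_in (oP _ Pv) yv.
exists (osucc u); first exact: ord_succ.
move=> x Px; rewrite in_osucc.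
case: (ord_tri (oP _ Px) ou) => [|->|ux]; [by left|by right|].
have : isin u u by rewrite {2}/u mksetP //; exists x.
by move/in_irr.
Qed.

Lemma Ord_not_small : ~ small (Ord M).
Proof.
move=> /small_bounded[] // b ob /(_ b ob); exact: in_irr.
Qed.

(** ** Recursion along a well-founded relation *)

(** The recursion theorem is proved for a well-founded relation with small
    initial segments, given by its induction principle [Rind].  It is applied to
    the ordinals, to the transitive closure of membership and to a well-ordering
    of pairs. *)
Section Recursion.
Variables (D : M -> Prop) (R : M -> M -> Prop) (G : M -> M).
Hypotheses (dD : def1 D) (dR : def2 R) (dG : dfun1 G).
Hypothesis Rtrans : forall x y z, D x -> D y -> D z -> R x y -> R y z -> R x z.
Hypothesis Rsmall : forall x, D x -> small (fun y => D y /\ R y x).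
Hypothesis Rind : forall P, def1 P ->
  (forall x, D x -> (forall y, D y -> R y x -> P y) -> P x) ->
  forall x, D x -> P x.

(** Set-sized attempts at the recursion: [f] is defined on an initial part of
    [D], where it obeys the recursion equation. *)
Definition approx f :=
  forall a b, isin (opair a b) f ->
   [/\ D a, (forall y, D y -> R y a -> exists c, isin (opair y c) f) &
    exists u, (forall w, isin w u <-> exists y, [/\ D y, R y a & isin (opair y w) f]) /\ b = G u].

Definition rec_rel a b := exists f, approx f /\ isin (opair a b) f.

Lemma def1_approx : def1 approx.
Proof. by rewrite /approx; def_tac. Qed.
Hint Resolve def1_approx : def.

Lemma def2_rec_rel : def2 rec_rel.
Proof. by rewrite /rec_rel; def_tac. Qed.
Hint Resolve def2_rec_rel : def.

Lemma Rirr x : D x -> ~ R x x.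
Proof.
move: x; apply: (Rind (P := fun x => ~ R x x)); first by def_tac.
by move=> x Dx IH Rxx; exact: (IH x).
Qed.

Lemma rec_rel_fun a b b' : rec_rel a b -> rec_rel a b' -> b = b'.
Proof.
move=> H H'; have Da : D a by case: H => f [fa /fa[]].
move: a Da b b' H H'.
apply: (Rind (P := fun a => forall b b', rec_rel a b -> rec_rel a b' -> b = b')); first by def_tac.
move=> a Da IH b b' [f [fa fb]] [f' [fa' fb']].
have [_ ft [u [uP ->]]] := fa _ _ fb; have [_ ft' [u' [uP' ->]]] := fa' _ _ fb'.
congr G; apply: set_ext => w; rewrite uP uP'; split=> -[y [Dy Rya yw]]; exists y; split=> //.
  by have [c yc] := ft' y Dy Rya; rewrite (IH y Dy Rya w c) //; [exists f|exists f'].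
by have [c yc] := ft y Dy Rya; rewrite (IH y Dy Rya w c) //; [exists f'|exists f].
Qed.

(** The values below [a] form a set by replacement, and together with the value at
    [a] that the equation prescribes they form an attempt defined at [a]. *)
Lemma rec_rel_ex a : D a -> exists b, rec_rel a b.
Proof.
move: a; apply: (Rind (P := fun a => exists b, rec_rel a b)); first by def_tac.
move=> a Da IH.
have su : small (fun w => exists2 y, D y /\ R y a & rec_rel y w).
  by apply: small_image (Rsmall Da); [exact: def2_rec_rel|exact: rec_rel_fun].
pose u := mkset (fun w => exists2 y, D y /\ R y a & rec_rel y w).
have sS : small (fun p => exists2 y, D y /\ R y a & exists c, rec_rel y c /\ p = opair y c).
  apply: small_image (Rsmall Da); first by def_tac.
  by move=> x p p' [c [cP ->]] [c' [cP' ->]]; rewrite (rec_rel_fun cP cP').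
pose S := mkset (fun p => exists2 y, D y /\ R y a & exists c, rec_rel y c /\ p = opair y c).
have sf := small_union (small_upair S (upair (opair a (G u)) (opair a (G u)))).
pose f := mkset (fun w => exists2 y, y = S \/ y = upair (opair a (G u)) (opair a (G u)) & isin w y).
have fP y c : isin (opair y c) f <-> [/\ D y, R y a & rec_rel y c] \/ y = a /\ c = G u.
  rewrite mksetP //; split.
    move=> [v [->|->]]; last by rewrite in_upair => -[] /opair_inj[-> ->]; right.
    by rewrite mksetP // => -[y' [Dy' Ry'] [c' [H /opair_inj[-> ->]]]]; left.
  move=> [[Dy Ry H]|[-> ->]].
    by exists S; [left|rewrite mksetP //; exists y => //; exists c].
  by exists (upair (opair a (G u)) (opair a (G u))); [right|apply/in_upair; left].
exists (G u), f; split; last by rewrite fP; right.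
move=> y c; rewrite fP => -[[Dy Ry H]|[-> ->]].
  have RR z : D z -> R z y -> R z a by move=> Dz Rz; exact: Rtrans Rz Ry.
  split=> //.
    move=> z Dz Rz; have [c' H'] := IH z Dz (RR z Dz Rz).
    by exists c'; rewrite fP; left; split=> //; exact: RR.
  have [f' [fa' fc']] := H; have [_ ft' [u' [uP' ->]]] := fa' _ _ fc'.
  exists u'; split=> // w; rewrite uP'; split=> -[z [Dz Rz zw]]; exists z; split=> //.
    by rewrite fP; left; split=> //; [exact: RR|exists f'].
  move: zw; rewrite fP => -[[_ _ H']|[za _]].
    by have [c' zc'] := ft' z Dz Rz; rewrite (rec_rel_fun (b' := c') H') //; exists f'.
  by case: (Rirr Dy); rewrite za in Rz; exact: Rtrans Ry Rz.
split=> //.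
  by move=> z Dz Rz; have [c' H'] := IH z Dz Rz; exists c'; rewrite fP; left.
exists u; split=> // w; rewrite mksetP //; split.
  by move=> [z [Dz Rz] zw]; exists z; split=> //; rewrite fP; left.
move=> [z [Dz Rz]]; rewrite fP => -[[_ _ H']|[za _]]; first by exists z.
by case: (Rirr Da); rewrite -{1}za.
Qed.

Lemma recursion : exists F, dfun1 F /\ forall x, D x -> exists u,
  (forall w, isin w u <-> exists y, [/\ D y, R y x & w = F y]) /\ F x = G u.
Proof.
have [F [dF FP _]] := dfun_of_rel pt def2_rec_rel rec_rel_fun.
exists F; split=> // x Dx.
have [b [f [fa fb]]] := rec_rel_ex Dx.
have [_ ft [u [uP bE]]] := fa _ _ fb.
exists u; split=> [w|]; last by rewrite -bE; apply: FP; exists f.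
rewrite uP; split=> -[y [Dy Ry yw]]; exists y; split=> //.
  by rewrite (FP y w) //; exists f.
by have [c yc] := ft y Dy Ry; rewrite yw (FP y c) //; exists f.
Qed.

End Recursion.

Lemma dfun1_id : dfun1 (@id M).
Proof. by rewrite /dfun1; exact: (dfn_eq_var (inl false) (inl true)). Qed.

Section Collapse.
Variables (D : M -> Prop) (R : M -> M -> Prop).
Hypotheses (dD : def1 D) (dR : def2 R).
Hypothesis Rtrans : forall x y z, D x -> D y -> D z -> R x y -> R y z -> R x z.
Hypothesis Rsmall : forall x, D x -> small (fun y => D y /\ R y x).
Hypothesis Rind : forall P, def1 P ->
  (forall x, D x -> (forall y, D y -> R y x -> P y) -> P x) ->
  forall x, D x -> P x.

(** The Mostowski collapse of a transitive relation consists of ordinals; it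
    gives both ranks and the pairing of ordinals. *)
Lemma collapse : exists F, [/\ dfun1 F,
  forall x, D x -> forall w, isin w (F x) <-> exists y, [/\ D y, R y x & w = F y] &
  forall x, D x -> Ord M (F x)].
Proof.
have [F [dF FP]] := recursion dD dR dfun1_id Rtrans Rsmall Rind.
have Fi x : D x -> forall w, isin w (F x) <-> exists y, [/\ D y, R y x & w = F y].
  by move=> /FP[u [uP ->]].
exists F; split=> //.
apply: (Rind (P := fun x => Ord M (F x))); first by def_tac.
move=> x Dx IH; apply: ord_of_ords => [y|y]; rewrite Fi // => -[x' [Dx' Rx' ->]].
  move=> z; rewrite Fi // => -[x'' [Dx'' Rx'' ->]].
  by rewrite Fi //; exists x''; split=> //; exact: Rtrans Rx'' Rx'.
exact: IH.
Qed.

End Collapse.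

End SetTheory.

#[local] Hint Resolve def3_upair def3_opair dfun2_opair def2_subset def1_empty
  def1_transitive def1_is_ord def1_Ord dfun1_osucc : def.

Section Rank.
Variable MA : class_structure.
Local Notation M := (set_part MA).
Local Notation A := (@classes MA).
Hypothesis hG : GBC MA.
Implicit Types (x y z w u v a b f j : M).

Lemma small_bin (P Q : M -> Prop) : small P -> small Q -> small (fun w => P w \/ Q w).
Proof.
move=> [p pP] [q qQ].
apply: small_ext (small_union hG (small_upair hG p q)) _ => w.
split=> [[/pP|/qQ] h|[y [->|->]]]; [by exists p; [left|]|by exists q; [right|]|by move/pP; left|by move/qQ; right].
Qed.

Lemma small_set1 x : small (fun w => w = x).
Proof. by apply: small_ext (small_upair hG x x) _ => w; split=> [->|[]]; first left. Qed.

(** ** Transitive closure and rank *)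

(** The transitive closure of membership, bounded by all transitive supersets so
    that it is definable at once. *)
Definition estar y x := forall t, transitive_in t -> subset_in x t -> isin y t.

Lemma def2_estar : def2 estar.
Proof. by rewrite /estar; def_tac. Qed.
Hint Resolve def2_estar : def.

Lemma estar_in y x : isin y x -> estar y x.
Proof. by move=> yx t _; apply. Qed.

Definition is_tc x t := [/\ transitive_in t, subset_in x t & forall w, isin w t -> estar w x].

Lemma def2_is_tc : def2 is_tc.
Proof. by rewrite /is_tc; def_tac. Qed.
Hint Resolve def2_is_tc : def.

Lemma is_tcP x t : is_tc x t -> forall w, isin w t <-> estar w x.
Proof. by move=> [tt xt tm] w; split=> [/tm//|]; apply. Qed.

Lemma tc_ex x : exists t, is_tc x t.
Proof.
move: x; apply: (eps_ind hG (P := fun x => exists t, is_tc x t)); first by def_tac.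
move=> x IH.
have s1 : small (fun t => exists2 y, isin y x & is_tc y t).
  apply: (small_image hG (R := is_tc)); [exact: def2_is_tc| |by exists x].
  by move=> y t t' /is_tcP tP /is_tcP tP'; apply: set_ext => // w; rewrite tP tP'.
have [t tP] := small_bin (small_union hG s1) (ex_intro _ x (fun=> iff_refl _)).
have inv w : isin w t <-> (exists2 y, isin y x & estar w y) \/ isin w x.
  rewrite tP; split=> -[]; [|by right| |by right].
    by move=> [t' [y yx] /is_tcP tP' /tP' wy]; left; exists y.
  move=> [y yx wy]; have [t' tt'] := IH y yx.
  by left; exists t'; [exists y|apply/(is_tcP tt')].
exists t; split.
- move=> y /inv[[z zx yz]|yx] w wy; apply/inv; left.
    exists z => // t' t't zt'; exact: t't (yz t' t't zt') _ wy.
  by exists y => //; exact: estar_in.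
- by move=> y yx; apply/inv; right.
- move=> w /inv[[y yx wy]|wx] t' t't xt'; last exact: xt'.
  by apply: wy => // z zy; exact: t't (xt' _ yx) _ zy.
Qed.

Lemma estar_small x : small (fun y => estar y x).
Proof. by have [t /is_tcP tP] := tc_ex x; exists t. Qed.

Lemma estar_trans x y z : estar x y -> estar y z -> estar x z.
Proof.
move=> xy yz t tt zt; have yt := yz t tt zt.
by apply: xy => //; exact: tt.
Qed.

Lemma estar_inv y x : estar y x -> exists2 z, isin z x & y = z \/ estar y z.
Proof.
move=> yx.
have s1 : small (fun t => exists2 z, isin z x & is_tc z t).
  apply: (small_image hG (R := is_tc)); [exact: def2_is_tc| |by exists x].
  by move=> z t t' /is_tcP tP /is_tcP tP'; apply: set_ext => // w; rewrite tP tP'.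
have [t tP] := small_bin (small_union hG s1) (ex_intro _ x (fun=> iff_refl _)).
have : isin y t.
  apply: yx => [w /tP[[t' [z zx] tz wt']|wx] v vw|w wx]; apply/tP.
  - left; exists t'; first by exists z.
    by have [t't _ _] := tz; exact: t't wt' _ vw.
  - by have [t' tt'] := tc_ex w; left; exists t'; [exists w|have [_ h _] := tt'; exact: h].
  - by right.
rewrite tP => -[[t' [z zx] /is_tcP tz /tz yz]|yx']; first by exists z => //; right.
by exists y => //; left.
Qed.

Lemma estar_ind (P : M -> Prop) : def1 P ->
  (forall x, (forall y, estar y x -> P y) -> P x) -> forall x, P x.
Proof.
move=> dP IH x; apply: (IH) => y yx.
move: x y yx; apply: (eps_ind hG (P := fun x => forall y, estar y x -> P y)); first by def_tac.
move=> x IHx y /estar_inv[z zx [->|]]; last exact: IHx.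
by apply: IH => w; exact: IHx.
Qed.

(** Collapsing the transitive closure of membership, rather than membership,
    makes all values ordinals. *)
Lemma rank_exists : exists F : M -> M, [/\ dfun1 F,
  forall x w, isin w (F x) <-> exists2 y, estar y x & w = F y &
  forall x, Ord M (F x)].
Proof.
have [||||F [dF FP FO]] := collapse hG (D := fun=> True) (R := estar) _ def2_estar _ _ _.
- exact: dfn_prop.
- by move=> x y z _ _ _; exact: estar_trans.
- by move=> x _; apply: small_ext (estar_small x) _ => w; split=> [[]|].
- by move=> P dP IH x _; apply: estar_ind dP _ x => x Hx; apply: IH => // y _; exact: Hx.
exists F; split=> // x; last exact: FO.
by move=> w; rewrite FP //; split=> [[y [_ ? ?]]|[y ? ?]]; exists y.
Qed.

Definition rank : M -> M := projT1 (cid rank_exists).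

Lemma dfun1_rank : dfun1 rank.
Proof. by rewrite /rank; case: cid => F []. Qed.
Hint Resolve dfun1_rank : def.

Lemma in_rank x w : isin w (rank x) <-> exists2 y, estar y x & w = rank y.
Proof. by rewrite /rank; case: cid => F [] /=. Qed.

Lemma ord_rank x : Ord M (rank x).
Proof. by rewrite /rank; case: cid => F [] /=. Qed.

Lemma rank_in y x : isin y x -> isin (rank y) (rank x).
Proof. by move=> yx; apply/in_rank; exists y => //; exact: estar_in. Qed.

Lemma in_rank_le w x : isin w (rank x) <-> exists2 z, isin z x & ord_le w (rank z).
Proof.
rewrite in_rank; split=> [[y /estar_inv[z zx [->|yz]] ->]|[z zx [|->]]].
- by exists z => //; right.
- by exists z => //; left; apply/in_rank; exists y.
- rewrite in_rank => -[y yz ->]; exists y => //; apply: estar_trans yz _; exact: estar_in.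
- by exists z => //; exact: estar_in.
Qed.

Lemma rank_ord x : Ord M x -> rank x = x.
Proof.
move: x; apply: (ord_ind hG (P := fun x => rank x = x)); first by def_tac.
move=> x ox IH; apply: set_ext => // w; rewrite in_rank_le; split.
  by move=> [z zx]; rewrite IH // => -[wz|->//]; exact: ord_trans wz zx.
by move=> wx; exists w => //; right; rewrite IH.
Qed.

(** The cumulative hierarchy: sets of rank below [a] lie in an iterated power set,
    by induction on [a]. *)
Lemma rank_lt_small a : Ord M a -> small (fun x => isin (rank x) a).
Proof.
move: a; apply: (ord_ind hG (P := fun a => exists v, forall x, isin x v <-> isin (rank x) a)).
  by def_tac.
move=> a oa IH.
pose R b p := exists2 v, (forall x, isin x v <-> isin (rank x) b) & forall w, isin w p <-> subset_in w v.
have s1 : small (fun p => exists2 b, isin b a & R b p).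
  apply: (small_image hG); [by rewrite /R; def_tac| |by exists a].
  move=> b p p' [v vP pP] [v' vP' pP']; apply: set_ext => // w; rewrite pP pP'.
  suff -> : v = v' by [].
  by apply: set_ext => // z; rewrite vP vP'.
apply: (small_sub hG (small_union hG s1)); first by def_tac.
move=> x xa; have [v vP] := IH _ xa.
have [p pP] := small_power hG v.
exists p; first by exists (rank x) => //; exists v.
by apply/pP => y yx; apply/vP; exact: rank_in.
Qed.

(** The rank function of the statement, computed by a set function on
    a transitive set, agrees with [rank] by induction along membership. *)
Lemma rank_unique f d : is_fun f -> is_dom f d -> transitive_in d ->
  (forall y v, app f y v -> forall w,
     isin w v <-> exists z u, [/\ isin z y, app f z u & ord_le w u]) ->
  forall y v, app f y v -> v = rank y.
Proof.
move=> [_ ff] fd dt fP.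
have FE y v : app f y v <-> isin (opair y v) f by exact: appE.
apply: (eps_ind hG (P := fun y => forall v, app f y v -> v = rank y)).
  apply: (dfn_iff (P := fun s _ => forall v, isin (opair (s tt) v) f -> v = rank (s tt))).
    by move=> s Y; split=> H v /FE/H.
  by dfn_tac.
move=> y IH v yv; apply: set_ext => // w; rewrite (fP _ _ yv) in_rank_le.
split=> [[z [u [zy zu wu]]]|[z zy wz]].
  by exists z => //; rewrite -(IH z zy u zu).
have yd : isin y d by apply/fd; exists v.
have /fd[u zu] := dt _ yd _ zy.
by exists z, u; split=> //; rewrite (IH z zy u zu).
Qed.

Lemma is_rankP x a : is_rank x a <-> a = rank x.
Proof.
split=> [[f [d [ff fd dt fP xa]]]|->]; first exact: (rank_unique ff fd dt fP xa).
have [d dP] := small_bin (estar_small x) (small_set1 x).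
have dt : transitive_in d.
  move=> y /dP[yx|->] z zy; apply/dP; left; last exact: estar_in.
  by apply: estar_trans yx; exact: estar_in.
have [f fP] : small (fun p => exists2 y, isin y d & p = opair y (rank y)).
  apply: (small_image hG (R := fun y p => p = opair y (rank y))).
  - by def_tac.
  - by move=> y p p' -> ->.
  - by exists d.
have fE y v : app f y v <-> isin y d /\ v = rank y.
  rewrite appE // fP; split=> [[y' yd /(opair_inj hG)[-> ->]//]|[yd ->]].
  by exists y.
exists f, d; split=> //.
- split=> [p /fP[y yd ->]|y v v']; first by exists y, (rank y); exact/is_opairE.
  by rewrite -!/(app f _ _) !fE => -[_ ->] [_ ->].
- by move=> y; split=> [yd|[v /fE[]//]]; exists (rank y); apply/fE.
- move=> y v /fE[yd ->] w; rewrite in_rank_le; split=> [[z zy wz]|[z [u [zy /fE[_ ->] wu]]]].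
    by exists z, (rank z); split=> //; apply/fE; split=> //; exact: dt zy.
  by exists z.
- by apply/fE; split=> //; apply/dP; right.
Qed.

Lemma rank_leP x y : rank_le x y <-> ord_le (rank x) (rank y).
Proof.
split=> [[a [b [/is_rankP -> /is_rankP -> //]]]|xy].
by exists (rank x), (rank y); split=> //; exact/is_rankP.
Qed.

(** ** Pairing of ordinals *)

Definition ord_pair p := exists a b, [/\ Ord M a, Ord M b & p = opair a b].

(** Pairs are compared by rank first, so that initial segments are small, and then
    lexicographically. *)
Definition pair_lt p q := isin (rank p) (rank q) \/ (rank p = rank q /\
  exists a b c d, [/\ p = opair a b, q = opair c d, Ord M c, Ord M d &
    isin a c \/ (a = c /\ isin b d)]).

Lemma def1_ord_pair : def1 ord_pair.
Proof. by rewrite /ord_pair; def_tac. Qed.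
Hint Resolve def1_ord_pair : def.

Lemma def2_pair_lt : def2 pair_lt.
Proof. by rewrite /pair_lt; def_tac. Qed.
Hint Resolve def2_pair_lt : def.

Lemma pair_lt_ind P : def1 P ->
  (forall x, ord_pair x -> (forall y, ord_pair y -> pair_lt y x -> P y) -> P x) ->
  forall x, ord_pair x -> P x.
Proof.
move=> dP IH.
suff H r : Ord M r -> forall a, Ord M a -> forall b, Ord M b -> rank (opair a b) = r -> P (opair a b).
  by move=> x [a [b [oa ob ->]]]; apply: (H (rank (opair a b))) => //; exact: ord_rank.
move: r; apply: (ord_ind hG (P := fun r => forall a, Ord M a -> forall b, Ord M b -> rank (opair a b) = r -> P (opair a b))).
  by def_tac.
move=> r or IHr; apply: (ord_ind hG (P := fun a => forall b, Ord M b -> rank (opair a b) = r -> P (opair a b))).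
  by def_tac.
move=> a oa IHa; apply: (ord_ind hG (P := fun b => rank (opair a b) = r -> P (opair a b))).
  by def_tac.
move=> b ob IHb rab; apply: IH; first by exists a, b.
move=> _ [a' [b' [oa' ob' ->]]] [|[e [a1 [b1 [c [d [/(opair_inj hG)[<- <-] /(opair_inj hG)[<- <-] _ _]]]]]]].
  by rewrite rab => /IHr; exact.
move=> [a'a|[a'a b'b]]; first by apply: (IHa a') => //; rewrite e.
by rewrite a'a in e *; apply: IHb => //; rewrite e.
Qed.

Lemma pairing_exists : exists F : M -> M -> M, [/\ dfun2 F,
  forall a b, Ord M a -> Ord M b -> Ord M (F a b) &
  forall a b c d, Ord M a -> Ord M b -> Ord M c -> Ord M d ->
    F a b = F c d -> a = c /\ b = d].
Proof.
have [||F [dF FP FO]] := collapse hG def1_ord_pair def2_pair_lt _ _ pair_lt_ind.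
- move=> p q r [a [b [oa ob ->]]] [c [d [oc od ->]]] [e [f [oe of_ ->]]].
  have H1 := ord_rank (opair e f).
  move=> [pq|[pq [? [? [? [? [/(opair_inj hG)[<- <-] /(opair_inj hG)[<- <-] _ _ h1]]]]]]].
    by move=> [qr|[qr _]]; left; [exact: ord_trans pq qr|rewrite -qr].
  move=> [qr|[qr [? [? [? [? [/(opair_inj hG)[<- <-] /(opair_inj hG)[<- <-] _ _ h2]]]]]]].
    by left; rewrite pq.
  right; split; first by rewrite pq.
  exists a, b, e, f; split=> //.
  case: h1 => [ac|[-> bd]]; case: h2 => [ce|[<- df]].
  + by left; exact: ord_trans ac ce.
  + by left.
  + by left.
  + by right; split=> //; exact: ord_trans bd df.
- move=> p _; apply: (small_sub hG (rank_lt_small (ord_succ hG (ord_rank p)))); first by def_tac.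
  by move=> w [_ [h|[h _]]]; rewrite in_osucc //; [left|right].
exists (fun a b => F (opair a b)); split.
- by rewrite /dfun2; def_tac.
- by move=> a b oa ob; apply: FO; exists a, b.
move=> a b c d oa ob oc od e.
have tot p q : ord_pair p -> ord_pair q -> F p = F q -> pair_lt p q -> False.
  move=> pp qq pq pltq; apply: (in_irr hG (x := F p)).
  by rewrite {2}pq; apply/FP => //; exists p.
have p1 : ord_pair (opair a b) by exists a, b.
have p2 : ord_pair (opair c d) by exists c, d.
have {}tot1 := tot _ _ p1 p2 e; have {}tot2 := tot _ _ p2 p1 (esym e).
have re : rank (opair a b) = rank (opair c d).
  case: (ord_tri hG (ord_rank (opair a b)) (ord_rank (opair c d))) => // h.
    by case: tot1; left.
  by case: tot2; left.
have ac : a = c.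
  case: (ord_tri hG oa oc) => // h.
    by case: tot1; right; split=> //; exists a, b, c, d; split=> //; left.
  by case: tot2; right; split=> //; exists c, d, a, b; split=> //; left.
split=> //; case: (ord_tri hG ob od) => // h.
  by case: tot1; right; split=> //; exists a, b, c, d; split=> //; right.
by case: tot2; right; split=> //; exists c, d, a, b; split=> //; right.
Qed.

(** ** Every set injects into an ordinal *)

Definition ord_inj x j :=
  [/\ forall p, isin p j -> exists a b, [/\ p = opair a b, isin a x & Ord M b],
      forall a, isin a x -> exists b, isin (opair a b) j,
      forall a b b', isin (opair a b) j -> isin (opair a b') j -> b = b' &
      forall a a' b, isin (opair a b) j -> isin (opair a' b) j -> a = a'].

Lemma def2_ord_inj : def2 ord_inj.
Proof. by rewrite /ord_inj; def_tac. Qed.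
Hint Resolve def2_ord_inj : def.

(** Iterate a choice function on the non-empty subsets of [x], always choosing
    outside of what has been chosen before.  If this never exhausted
    [x], the ordinals would inject into [x] and form a set. *)
Lemma Zermelo x : exists j, ord_inj x j.
Proof.
have [X XP] : small (fun s => subset_in s x /\ ~ is_empty s).
  by apply: (small_sub hG (small_power hG x)); [def_tac|move=> w []].
have [|f [[_ ff] fd fP]] := gbc_choice hG (x := X) _; first by move=> y /XP[].
(* [G u] is an element of [x] outside [u], or the default [x] when [u] covers [x]. *)
pose H u y := (exists s, (forall w, isin w s <-> isin w x /\ ~ isin w u) /\
                 isin (opair s y) f) \/ (subset_in x u /\ y = x).
have fP' s y : isin (opair s y) f -> isin y s by move=> sy; apply: fP; exact/appE.
have fX s y : isin (opair s y) f -> isin s X by move=> sy; apply/fd; exists y; exact/appE.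
have nsub u y s : (forall w, isin w s <-> isin w x /\ ~ isin w u) ->
    isin (opair s y) f -> isin y x /\ ~ isin y u.
  by move=> sP /fP'/sP.
have [G [dG GP _]] : exists G, [/\ dfun1 G, forall x y, H x y -> G x = y &
                forall x, (~ exists y, H x y) -> G x = pt MA].
  apply: dfun_of_rel => //; first by rewrite /H; def_tac.
  move=> u y y' [[s [sP sy]]|[xu ->]] [[s' [sP' sy']]|[xu' ->]] //.
  - have ss' : s = s' by apply: set_ext => // w; rewrite sP sP'.
    by apply: (ff s); apply/appE => //; rewrite ss'.
  - by have [yx] := nsub _ _ _ sP sy; case; exact: xu'.
  - by have [yx] := nsub _ _ _ sP' sy'; case; exact: xu.
have GP1 u : ~ subset_in x u -> isin (G u) x /\ ~ isin (G u) u.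
  move=> xu; have [s sP] : small (fun w => isin w x /\ ~ isin w u).
    by apply: (small_sub hG (P := fun w => isin w x)); [exists x|def_tac|move=> w []].
  have sX : isin s X.
    apply/XP; split=> [w /sP[]//|s0]; apply: xu => w wx.
    by apply: contrapT => wu; apply: (s0 w); apply/sP.
  have /fd[y /(appE hG) sy] := sX.
  by rewrite (GP u y); [exact: nsub sy|left; exists s].
have [||||F [dF FP]] := recursion hG (D := Ord M) (R := @isin M) _ (@def2_in MA) dG _ _ _.
- exact: def1_Ord.
- by move=> a b c _ _ oc; exact: ord_trans.
- by move=> a oa; exists a => w; split=> [wa|[]//]; split=> //; exact: ord_in wa.
- by move=> P dP IH a; apply: (ord_ind hG) a => // a oa IHa; apply: IH => // b _; exact: IHa.
pose full a := exists2 u, (forall w, isin w u <-> exists2 b, isin b a & w = F b) & subset_in x u.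
have FP' a : Ord M a -> ~ full a -> isin (F a) x /\ forall b, isin b a -> F a <> F b.
  move=> oa na; have [u [uP ->]] := FP a oa.
  have uP' w : isin w u <-> exists2 b, isin b a & w = F b.
    by rewrite uP; split=> [[b [_ ? ?]]|[b ba ->]]; exists b => //; split=> //; exact: ord_in ba.
  have [|h1 h2] := GP1 u; first by move=> xu; apply: na; exists u.
  by split=> // b ba e; apply: h2; apply/uP'; exists b.
have finj a b : Ord M a -> Ord M b -> ~ full a -> ~ full b -> F a = F b -> a = b.
  move=> oa ob na nb e; case: (ord_tri hG oa ob) => // h.
    by have [_ /(_ a h)] := FP' b ob nb; rewrite e.
  by have [_ /(_ b h)] := FP' a oa na; rewrite e.
have dfull : def1 full by rewrite /full; def_tac.
have exfull : exists2 a, Ord M a & full a.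
  apply: contrapT => N; have nf a : Ord M a -> ~ full a by move=> oa fa; apply: N; exists a.
  apply: (@Ord_not_small MA hG).
  have s1 : small (fun a => exists2 y, isin y x & Ord M a /\ y = F a).
    apply: (small_image hG (R := fun y a => Ord M a /\ y = F a)); [by def_tac| |by exists x].
    by move=> y a a' [oa ->] [oa'] /finj; apply=> //; exact: nf.
  apply: (small_sub hG s1); first by def_tac.
  by move=> a oa; exists (F a) => //; have [] := FP' a oa (nf a oa).
have [a [oa [u uP xu] amin]] := ord_least hG dfull exfull.
have ab b : isin b a -> Ord M b by exact: ord_in.
have nfb b : isin b a -> ~ full b by move=> ba fb; apply: (amin b) => //; exact: ab.
have [j jP] : small (fun p => exists2 b, isin b a & p = opair (F b) b).
  apply: (small_image hG (R := fun b p => p = opair (F b) b)); [by def_tac|by move=> ? ? ? -> ->|by exists a].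
have jE y b : isin (opair y b) j <-> isin b a /\ y = F b.
  by rewrite jP; split=> [[b' ba /(opair_inj hG)[-> ->]//]|[ba ->]]; exists b.
exists j; split.
- move=> p /jP[b ba ->]; exists (F b), b; split=> //; last exact: ab.
  by have [] := FP' b (ab b ba) (nfb b ba).
- by move=> y /xu/uP[b ba ->]; exists b; apply/jE.
- move=> y b b' /jE[ba ->] /jE[ba'] /finj; apply; by [exact: ab|exact: nfb].
- by move=> y y' b /jE[_ ->] /jE[_ ->].
Qed.

End Rank.

#[local] Hint Resolve def2_estar dfun1_rank def2_ord_inj : def.

Section WeaklyCompact.
Variable MA : class_structure.
Local Notation M := (set_part MA).
Local Notation A := (@classes MA).
Hypothesis hG : GBC MA.
Hypothesis hwc : Ord_weakly_compact MA.
Implicit Types (x y z w u v a b f j : M).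

(** ** The tree property for trees of subsets *)

Lemma empty_small : small (fun w : M => False).
Proof.
apply: (small_sub hG (small_set1 hG (pt MA))) => //.
by apply: (@dfn_bot MA unit).
Qed.

Definition zero : M := mkset (fun w : M => False).
Definition one : M := upair zero zero.

Lemma in_zero w : ~ isin w zero.
Proof. by rewrite mksetP //; exact: empty_small. Qed.

Lemma one_neq_zero : one <> zero.
Proof. by move=> e; apply: (@in_zero zero); rewrite -{2}e in_upair //; left. Qed.

Lemma zero_ord : Ord M zero.
Proof. by apply: is_ordP => // [y /in_zero|y z /in_zero]. Qed.

(** Nodes of a binary tree are functions into two; subsets of ordinals, which are
    easier to reason about, are turned into nodes by their characteristic
    functions. *)
Definition is_chi d w f := forall p, isin p f <-> exists v i,
  [/\ p = opair v i, isin v d & (isin v w /\ i = one) \/ (~ isin v w /\ i = zero)].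

Lemma def3_is_chi : def3 is_chi.
Proof. by rewrite /is_chi; def_tac. Qed.
Hint Resolve def3_is_chi : def.

Lemma chi_ex d w : exists f, is_chi d w f.
Proof.
have [f fP] : small (fun p => exists2 v, isin v d & exists i, p = opair v i /\
   ((isin v w /\ i = one) \/ (~ isin v w /\ i = zero))).
  apply: (small_image hG); [by def_tac| |by exists d].
  by move=> v p p' [i [-> [[vw ->]|[vw ->]]]] [i' [-> [[vw' ->]|[vw' ->]]]].
exists f => p; rewrite fP; split=> [[v vd [i [-> h]]]|[v [i [-> vd h]]]].
  by exists v, i.
by exists v => //; exists i.
Qed.

Lemma chiE d w f v i : is_chi d w f -> isin (opair v i) f <->
  isin v d /\ ((isin v w /\ i = one) \/ (~ isin v w /\ i = zero)).
Proof.
move=> fP; rewrite fP; split=> [[v' [i' [/(opair_inj hG)[-> ->]]]]//|[vd h]].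
by exists v, i.
Qed.

Lemma chi_dom d w f : is_chi d w f -> is_dom f d.
Proof.
move=> fP x; split=> [xd|[y /(appE hG)]]; last by rewrite (chiE _ _ fP) => -[].
have [xw|xw] := pselect (isin x w).
  by exists one; apply/(appE hG); rewrite (chiE _ _ fP); split=> //; left.
by exists zero; apply/(appE hG); rewrite (chiE _ _ fP); split=> //; right.
Qed.

Lemma dom_uniq f d d' : is_dom f d -> is_dom f d' -> d = d'.
Proof. by move=> h h'; apply: set_ext => // w; rewrite h h'. Qed.

Lemma chi_fun d w f : is_chi d w f -> is_fun f.
Proof.
move=> fP; split=> [p /fP[v [i [-> _ _]]]|x y y'].
  by exists v, i; exact/is_opairE.
rewrite -!/(app f _ _) !(appE hG) !(chiE _ _ fP).
by move=> [_ [[? ->]|[? ->]]] [_ [[? ->]|[? ->]]].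
Qed.

(** Weak compactness for trees whose nodes at level [d] are subsets of [d], ordered
    by end extension.  The union of a branch is a class [B] all of whose initial
    segments are nodes. *)
Lemma tree_property (T : M -> M -> Prop) : def2 T ->
  (forall d w v, T d w -> isin v w -> isin v d) ->
  (forall d d' w w', Ord M d -> isin d' d -> T d w ->
     (forall v, isin v w' <-> isin v w /\ isin v d') -> T d' w') ->
  (forall d, Ord M d -> exists w, T d w) ->
  exists B, A B /\ forall d, Ord M d -> exists2 w, T d w &
    forall v, isin v w <-> isin v d /\ B v.
Proof.
move=> dT Tsub Tres Tex.
pose TT := [set f : M | exists d w, [/\ Ord M d, T d w & is_chi d w f]].
have ATT : A TT by apply: class_of_def1 => //; def_tac.
have [||F [AF [F1 F2] FO FT Flt]] := hwc (T := TT).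
- split=> //.
    move=> f [d [w [od Tdw fP]]]; exists d; split=> //.
    + exact: chi_fun fP.
    + exact: chi_dom fP.
    + move=> x y /(appE hG); rewrite (chiE _ _ fP).
      move=> [_ [[_ ->]|[_ ->]]] z; last by move/in_zero.
      by rewrite in_upair // => -[] -> v /in_zero.
  move=> f d b g [d' [w [od' Tdw fP]]] fd bd gP.
  have {}fd : d' = d by apply: dom_uniq fd; exact: chi_dom fP.
  rewrite -{d}fd in bd.
  have [w' w'P] : small (fun v => isin v w /\ isin v b).
    by apply: (small_sub hG (P := fun v => isin v w)); [exists w|def_tac|move=> v []].
  exists b, w'; split; [exact: ord_in bd|exact: (Tres d' b w)|].
  move=> p; rewrite gP fP; split.
    move=> [[v [i [-> vd h]]] [x [y [/(is_opairE hG)/(opair_inj hG)[ev _] xb]]]].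
    rewrite -{}ev in xb; exists v, i; split=> //; case: h => [[vw ->]|[vw ->]]; [left|right]; split=> //.
      by apply/w'P.
    by move/w'P => [].
  move=> [v [i [-> vb h]]]; split; last by exists v, i; split=> //; exact/is_opairE.
  exists v, i; split=> //; first exact: ord_trans vb bd.
  case: h => [[/w'P[vw _] ->]|[vw ->]]; [by left|right; split=> // vw1].
  by apply: vw; apply/w'P.
- rewrite predeqE => d; split.
    move=> [f [d' [w [od' Tdw fP]]] fd].
    by rewrite -(dom_uniq (chi_dom fP) fd).
  move=> od; have [w Tdw] := Tex d od; have [f fP] := chi_ex d w.
  by exists f; [exists d, w|exact: chi_dom fP].
pose B := [set v : M | exists d f, F (opair d f) /\ isin (opair v one) f].
exists B; split; first by apply: class_of_def1 => //; def_tac.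
move=> d od.
have node d' : Ord M d' -> exists f w, [/\ crel F d' f, T d' w & is_chi d' w f].
  rewrite -FO => -[f Fd]; have [[d'' [w [od'' Tdw fP]]] fd] := FT _ _ Fd.
  exists f, w; have e := dom_uniq (chi_dom fP) fd; rewrite e in Tdw fP; by split.
have Ford d' f : crel F d' f -> Ord M d' by move=> h; rewrite -FO; exists f.
have [f [w [Fd Tdw fP]]] := node d od.
exists w => // v; split=> [vw|[vd [d' [f' [/(crelE hG) Fd' vf']]]]].
  have vd := Tsub _ _ _ Tdw vw; split=> //; exists d, f; split; first exact/crelE.
  by rewrite (chiE _ _ fP); split=> //; left.
have od' := Ford _ _ Fd'.
have vf : isin (opair v one) f.
  case: (ord_tri hG od od') => h.
  - have [_ ff'] := Flt _ _ _ _ h Fd Fd'.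
    have /chi_dom/(_ v)[/(_ vd)[i /(appE hG) vi] _] := fP.
    have [f1 [w1 [Fd1 _ /chi_fun[_ f1f]]]] := node d' od'.
    rewrite -(F2 _ _ _ Fd' Fd1) in f1f.
    suff <- : i = one by [].
    by apply: (f1f v); rewrite -/(app f' _ _) (appE hG) //; exact: ff'.
  - by rewrite -h in Fd'; rewrite (F2 _ _ _ Fd Fd').
  - have [_ f'f] := Flt _ _ _ _ h Fd' Fd; exact: f'f.
by move: vf; rewrite (chiE _ _ fP) => -[_ [[]|[_ /one_neq_zero]]].
Qed.

(** Otherwise each of the set-many fibres is bounded, by a least bound; these bounds
    form a set, hence have a common bound, which bounds [X]. *)
Lemma pigeonhole (X : set M) (g : M -> M) P : A X -> unbounded X -> dfun1 g ->
  X `<=` Ord M -> small P -> (forall a, X a -> P (g a)) ->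
  exists2 w, P w & unbounded [set a | X a /\ g a = w].
Proof.
move=> AX uX dg XO sP gP; apply: contrapT => N.
have dP := small_def1 hG sP.
pose bd w b := Ord M b /\ forall a, X a -> g a = w -> ~ isin b a.
have dbd : def2 bd by rewrite /bd; def_tac.
have bex w : P w -> exists2 b, Ord M b & bd w b.
  move=> Pw; apply: contrapT => Nb; apply: N; exists w => // b ob.
  apply: contrapT => Na; apply: Nb; exists b => //; split=> // a Xa ga ba.
  by apply: Na; exists a.
pose H w b := bd w b /\ forall b', Ord M b' -> bd w b' -> ~ isin b' b.
have dH : def2 H by rewrite /H; def_tac.
have s1 : small (fun b => exists2 w, P w & H w b).
  apply: (small_image hG) => // w b b' [[ob wb] bm] [[ob' wb'] bm'].
  by case: (ord_tri hG ob ob') => // h; [case: (bm' b)|case: (bm b')].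
have [|c oc cP] := small_bounded hG s1; first by move=> b [w _ [[]]].
have [a Xa ca] := uX c oc.
have dbd1 : def1 (bd (g a)) by def_tac.
have [b [ob bb bm]] := ord_least hG dbd1 (bex _ (gP a Xa)).
have bc : isin b c by apply: cP; exists (g a); [exact: gP|split].
by case: bb => _ /(_ a Xa erefl); apply; apply: ord_trans bc ca; exact: XO.
Qed.

Lemma small_prod (F : M -> M -> M) P Q : dfun2 F -> small P -> small Q ->
  small (fun w => exists a b, [/\ P a, Q b & w = F a b]).
Proof.
move=> dF sP sQ; have dQ := small_def1 hG sQ; have dP := small_def1 hG sP.
pose R a s := forall w, isin w s <-> exists2 b, Q b & w = F a b.
have s1 : small (fun s => exists2 a, P a & R a s).
  apply: (small_image hG); [by rewrite /R; def_tac| |by []].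
  by move=> a s s' sE sE'; apply: set_ext => // w; rewrite sE sE'.
apply: small_ext (small_union hG s1) _ => w; split.
  move=> [a [b [Pa Qb ->]]].
  have [s sE] : small (fun w => exists2 b, Q b & w = F a b).
    by apply: (small_imagef hG) => //; def_tac.
  by exists s; [exists a|apply/sE; exists b].
by move=> [s [a Pa sE] /sE[b Qb ->]]; exists a, b.
Qed.

(** ** A class injection of the universe into the ordinals *)

(** By choice for sets, every rank segment injects into [Ord], but selecting one
    injection for every rank takes a choice function on a proper class.  A tree
    of height [Ord] replaces it: its nodes are bit patterns written down by
    choosing injections for set-many ranks. *)
Section GlobalChoice.
Variable pc : M -> M -> M.
Hypotheses (dpc : dfun2 pc)
  (opc : forall a b, Ord M a -> Ord M b -> Ord M (pc a b))
  (pc_inj : forall a b c d, Ord M a -> Ord M b -> Ord M c -> Ord M d ->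
    pc a b = pc c d -> a = c /\ b = d).

(** Injections of the segment of rank [a] of least possible rank: the minimality
    makes the candidates for one [a] a set, from which choice for sets can pick. *)
Definition least_inj a j := exists V, [/\ forall x, isin x V <-> isin (rank hG x) a, ord_inj V j &
  forall j', ord_inj V j' -> ~ isin (rank hG j') (rank hG j)].

Lemma def2_least_inj : def2 least_inj.
Proof. by rewrite /least_inj; def_tac. Qed.
Hint Resolve def2_least_inj : def.

Lemma least_inj_ex a : Ord M a -> exists j, least_inj a j.
Proof.
move=> oa; have [V VP] := rank_lt_small hG oa.
have [j jP] := Zermelo hG V.
have [||r [or1 [j0 j0P rE] rm]] := ord_least hG (P := fun r => exists2 j, ord_inj V j & rank hG j = r) _.
- by def_tac.
- by exists (rank hG j); [exact: ord_rank|exists j].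
exists j0, V; split=> // j' j'P; rewrite rE; apply: rm; first exact: ord_rank.
by exists j'.
Qed.

Lemma least_inj_small a : Ord M a -> small (least_inj a).
Proof.
move=> oa; have [j jP] := least_inj_ex oa.
apply: (small_sub hG (rank_lt_small hG (ord_succ hG (ord_rank hG j)))); first by def_tac.
move=> j' [V [VP j'V j'm]]; rewrite in_osucc //.
have [V' [VP' jV jm]] := jP.
have VV : V' = V by apply: set_ext => // x; rewrite VP VP'.
rewrite VV in jV; case: (ord_tri hG (ord_rank hG j') (ord_rank hG j)) => // h; [by left|by right|].
by case: (j'm j).
Qed.

Definition triple a b c := pc a (pc b c).

Lemma triple_inj a b c a' b' c' : Ord M a -> Ord M b -> Ord M c ->
  Ord M a' -> Ord M b' -> Ord M c' -> triple a b c = triple a' b' c' ->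
  [/\ a = a', b = b' & c = c'].
Proof.
move=> oa ob oc oa' ob' oc' /pc_inj[] //; [exact: opc|exact: opc|].
by move=> -> /pc_inj[].
Qed.

(** A partial choice of injections. *)
Definition coherent h := (forall a j, isin (opair a j) h -> Ord M a /\ least_inj a j) /\
  (forall a j j', isin (opair a j) h -> isin (opair a j') h -> j = j').

(** The bits contributed by the choice of [j] for [a]: a triple codes [a] together
    with the numbers of a pair related by membership or equality. The equality
    bits record which ordinals are values of [j]. *)
Definition bit a j v := exists x y b c, [/\ isin (opair x b) j, isin (opair y c) j,
  v = triple a b c & isin x y \/ x = y].

Lemma def3_bit : def3 bit.
Proof. by rewrite /bit /triple; def_tac. Qed.
Hint Resolve def3_bit : def.

Lemma def1_coherent : def1 coherent.
Proof. by rewrite /coherent; def_tac. Qed.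
Hint Resolve def1_coherent : def.

(** A node at level [d] is what a partial choice writes below [d], the choice being
    defined wherever a code below [d] asks for it. *)
Definition code_tree d w := exists2 h, coherent h &
  (forall a b c, Ord M a -> Ord M b -> Ord M c -> isin (triple a b c) d ->
     exists j, isin (opair a j) h) /\
  forall v, isin v w <-> isin v d /\ exists a j, isin (opair a j) h /\ bit a j v.

Lemma def2_code_tree : def2 code_tree.
Proof. by rewrite /code_tree /triple; def_tac. Qed.

Lemma least_inj_ord a j x b : least_inj a j -> isin (opair x b) j -> isin (rank hG x) a /\ Ord M b.
Proof.
move=> [V [VP [jV _ _ _] _]] /jV[x' [b' [/(opair_inj hG)[-> ->]]]].
by rewrite VP.
Qed.

Lemma code_tree_ex d : Ord M d -> exists w, code_tree d w.
Proof.
move=> od.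
pose K a := exists2 v, isin v d & exists b c, [/\ Ord M a, Ord M b, Ord M c & v = triple a b c].
have sK : small K.
  apply: (small_image hG (R := fun v a => exists b c, [/\ Ord M a, Ord M b, Ord M c & v = triple a b c])).
  - by rewrite /triple; def_tac.
  - by move=> v a a' [b [c [oa ob oc ->]]] [b' [c' [oa' ob' oc' /triple_inj[]]]].
  - by exists d.
have oK a : K a -> Ord M a by move=> [v _ [b [c []]]].
pose R a s := forall j, isin j s <-> least_inj a j.
have dR : def2 R by rewrite /R; def_tac.
have [S SP] : small (fun s => exists2 a, K a & R a s).
  apply: (small_image hG) => // a s s' sE sE'.
  by apply: set_ext => // w; rewrite sE sE'.
have [|f [[_ ff] fd fP]] := gbc_choice hG (x := S) _.
  move=> s /SP[a Ka sE] s0; have [j jP] := least_inj_ex (oK a Ka).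
  by apply: (s0 j); apply/sE.
have dK := small_def1 hG sK.
have [h hP] : small (fun p => exists2 a, K a & exists s j, [/\ R a s, isin (opair s j) f & p = opair a j]).
  apply: (small_image hG) => //; first by def_tac.
  move=> a p p' [s [j [sE sj ->]]] [s' [j' [sE' sj' ->]]]; congr opair.
  have ss' : s = s' by apply: set_ext => // w; rewrite sE sE'.
  by apply: (ff s); rewrite -/(app f _ _) (appE hG) // ss'.
have hE a j : isin (opair a j) h <-> K a /\ exists2 s, R a s & isin (opair s j) f.
  rewrite hP; split=> [[a' Ka [s [j' [sE sj /(opair_inj hG)[-> ->]]]]]|[Ka [s sE sj]]].
    by split=> //; exists s.
  by exists a => //; exists s, j.
have coh : coherent h.
  split=> [a j /hE[Ka [s sE sj]]|a j j' /hE[Ka [s sE sj]] /hE[_ [s' sE' sj']]].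
    by split; [exact: oK|apply/sE; apply: fP; apply/(appE hG)].
  have ss' : s = s' by apply: set_ext => // w; rewrite sE sE'.
  by apply: (ff s); rewrite -/(app f _ _) (appE hG) // ss'.
have [w wP] : small (fun v => isin v d /\ exists a j, isin (opair a j) h /\ bit a j v).
  by apply: (small_sub hG (P := fun v => isin v d)); [exists d|def_tac|move=> v []].
exists w, h => //; split=> // a b c oa ob oc cd.
have Ka : K a by exists (triple a b c) => //; exists b, c.
have [s sE] := least_inj_small oa.
have /fd[j /(appE hG) sj] : isin s S by apply/SP; exists a.
by exists j; apply/hE; split=> //; exists s.
Qed.

(** The branch mixes the bits for all ranks; [j] accounts for those tagged
    with [a]. *)
Definition coded (B : set M) a j := least_inj a j /\ forall b c, Ord M b -> Ord M c ->
  (B (triple a b c) <-> bit a j (triple a b c)).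

(** All codes that can occur for the rank [a] lie below one ordinal [d], as the
    candidate injections form a set.  The node of the branch at level [d] comes
    from a partial choice; the injection chosen there for [a] is the one.  Nodes at
    higher levels agree with it below [d]. *)
Lemma coded_branch : exists B, A B /\ forall a, Ord M a -> exists j, coded B a j.
Proof.
have [|||B [AB BP]] := tree_property def2_code_tree.
- by move=> d w v [h _ [_ wP]] /wP[].
- move=> d d' w w' od d'd [h ch [hd hw]] ww'; exists h => //; split.
    move=> a b c oa ob oc cd'; apply: (hd a b c) => //; exact: ord_trans cd' d'd.
  move=> v; rewrite ww' hw; split=> [[[vd h1] vd']//|[vd' h1]]; split=> //; split=> //.
  exact: ord_trans vd' d'd.
- exact: code_tree_ex.
exists B; split=> // a oa.
pose Q b := exists2 j, least_inj a j & exists x, isin (opair x b) j.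
have sJ := least_inj_small oa.
have sQ : small Q.
  apply: small_ext (small_image hG (R := fun p b => exists x, p = opair x b) _ _ (small_union hG sJ)) _.
  - by def_tac.
  - by move=> p b b' [x ->] [x' /(opair_inj hG)[]].
  move=> b; split=> [[j Jj [x xb]]|[p [j Jj pj] [x pE]]].
    by exists (opair x b); [exists j|exists x].
  by exists j => //; exists x; rewrite -pE.
have s3 : small (fun w => exists b c, [/\ Q b, Q c & w = triple a b c]).
  by apply: (small_prod (F := triple a)) => //; rewrite /triple; def_tac.
have oQ b : Q b -> Ord M b by move=> [j Jj [x /(least_inj_ord Jj)[]]].
have oz := zero_ord.
have otriple b c : Ord M b -> Ord M c -> Ord M (triple a b c).
  by move=> ob oc; apply: opc => //; exact: opc.
have [|d od dP] := small_bounded hG (small_bin hG s3 (small_set1 hG (triple a zero zero))).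
  by move=> x [[b [c [/oQ ob /oQ oc ->]]]|->]; exact: otriple.
have [w [h ch [hd hw]] wP] := BP d od.
have [|j aj] := hd a zero zero oa oz oz; first by apply: dP; right.
have [ch1 ch2] := ch; have [_ Jj] := ch1 _ _ aj.
exists j; split=> // b c ob oc; split.
  move=> Bc.
  have [|d' od' d'P] := small_bounded hG (small_bin hG s3 (small_set1 hG (triple a b c))).
    by move=> x [[b' [c' [/oQ ob' /oQ oc' ->]]]|->]; exact: otriple.
  have [w' [h' [ch1' ch2'] [hd' hw']] wP'] := BP d' od'.
  have : isin (triple a b c) w' by apply/wP'; split=> //; apply: d'P; right.
  rewrite hw' => -[_ [a' [j' [aj' [x [y [b' [c' [xb yc e xy]]]]]]]]].
  have [oa' Jj'] := ch1' _ _ aj'.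
  have [_ ob'] := least_inj_ord Jj' xb; have [_ oc'] := least_inj_ord Jj' yc.
  have [ea eb ec] := triple_inj oa ob oc oa' ob' oc' e; subst a' b' c'.
  have cd : isin (triple a b c) d.
    by apply: dP; left; exists b, c; split=> //; exists j' => //; [exists x|exists y].
  have : isin (triple a b c) w by apply/wP.
  rewrite hw => -[_ [a1 [j1 [aj1 B1]]]]; have [oa1 J1] := ch1 _ _ aj1.
  have [x1 [y1 [b1 [c1 [xb1 yc1 e1 xy1]]]]] := B1.
  have [_ ob1] := least_inj_ord J1 xb1; have [_ oc1] := least_inj_ord J1 yc1.
  have [ea _ _] := triple_inj oa ob oc oa1 ob1 oc1 e1; subst a1.
  by rewrite (ch2 _ _ _ aj aj1).
move=> Bj; have [x [y [b' [c' [xb yc e xy]]]]] := Bj.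
have [_ ob'] := least_inj_ord Jj xb; have [_ oc'] := least_inj_ord Jj yc.
have [_ eb ec] := triple_inj oa ob oc oa ob' oc' e; subst b' c'.
have : isin (triple a b c) w.
  rewrite hw; split; last by exists a, j.
  by apply: dP; left; exists b, c; split=> //; exists j => //; [exists x|exists y].
by move/wP => [].
Qed.

(** Two injections with the same bits carry membership to the same relation on
    ordinals.  An isomorphism between transitive parts of the
    universe is the identity, by induction on membership, so the
    injections agree. *)
Lemma coded_uniq B a j j' : Ord M a -> coded B a j -> coded B a j' ->
  forall x b b', isin (opair x b) j -> isin (opair x b') j' -> b = b'.
Proof.
move=> oa [Jj Bj] [Jj' Bj'].
apply: (eps_ind hG (P := fun x => forall b b', isin (opair x b) j -> isin (opair x b') j' -> b = b')).
  by def_tac.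
move=> x IH b b' xb xb'.
have [V [VP [j1 j2 j3 j4] _]] := Jj; have [V' [VP' [j1' j2' j3' j4'] _]] := Jj'.
have dom u c : isin (opair u c) j -> isin u V /\ Ord M c.
  by move=> /j1[u' [c' [/(opair_inj hG)[-> ->]]]].
have dom' u c : isin (opair u c) j' -> isin u V' /\ Ord M c.
  by move=> /j1'[u' [c' [/(opair_inj hG)[-> ->]]]].
have VV u : isin u V <-> isin u V' by rewrite VP VP'.
have down u v : isin u v -> isin v V -> isin u V.
  by move=> uv; rewrite !VP => h; apply: ord_trans h => //; exact: rank_in.
have [_ ob'] := dom' _ _ xb'.
have B_j c d u v : isin (opair u c) j -> isin (opair v d) j -> (isin u v \/ u = v) -> B (triple a c d).
  move=> uc vd uv; have [_ oc] := dom _ _ uc; have [_ od] := dom _ _ vd.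
  by apply/Bj => //; exists u, v, c, d.
have B_j' c d u v : isin (opair u c) j' -> isin (opair v d) j' -> (isin u v \/ u = v) -> B (triple a c d).
  move=> uc vd uv; have [_ oc] := dom' _ _ uc; have [_ od] := dom' _ _ vd.
  by apply/Bj' => //; exists u, v, c, d.
have jB c d : Ord M c -> Ord M d -> B (triple a c d) ->
    exists u v, [/\ isin (opair u c) j, isin (opair v d) j & isin u v \/ u = v].
  move=> oc od /Bj[] // u [v [c' [d' [uc vd e uv]]]].
  have [_ oc'] := dom _ _ uc; have [_ od'] := dom _ _ vd.
  have [_ ec ed] := triple_inj oa oc od oa oc' od' e; subst c' d'.
  by exists u, v.
have jB' c d : Ord M c -> Ord M d -> B (triple a c d) ->
    exists u v, [/\ isin (opair u c) j', isin (opair v d) j' & isin u v \/ u = v].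
  move=> oc od /Bj'[] // u [v [c' [d' [uc vd e uv]]]].
  have [_ oc'] := dom' _ _ uc; have [_ od'] := dom' _ _ vd.
  have [_ ec ed] := triple_inj oa oc od oa oc' od' e; subst c' d'.
  by exists u, v.
(* The equality bit of [b'] shows that [b'] is also a value [j z]; the rest of the
   proof shows that [z] and [x] have the same elements. *)
have [z [_ [zb' _ _]]] : exists z z', [/\ isin (opair z b') j, isin (opair z' b') j & isin z z' \/ z = z'].
  by apply: jB => //; exact: (B_j' _ _ _ _ xb' xb' (or_intror erefl)).
have [xV _] := dom _ _ xb; have [zV _] := dom _ _ zb'.
suff zx : z = x by apply: (j3 x) => //; rewrite -zx.
apply: set_ext => // w; split=> [wz|wx].
  have [c wc] := j2 _ (down _ _ wz zV); have [_ oc] := dom _ _ wc.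
  have [] := jB' c b' oc ob'; first by apply: B_j wc zb' _; left.
  move=> x1 [y1 [x1c y1b xy1]].
  have ey : y1 = x by exact: j4' y1b xb'.
  subst y1; case: xy1 => [x1x|ex].
    have [c' x1c'] := j2 _ (down _ _ x1x xV).
    have e := IH _ x1x _ _ x1c' x1c; subst c'.
    by rewrite (j4 _ _ _ wc x1c').
  subst x1; have e := j3' _ _ _ x1c xb'; subst c.
  by have e := j4 _ _ _ wc zb'; subst w; case: (in_irr hG wz).
have wV := down _ _ wx xV.
have [c wc] := j2 _ wV; have [c' wc'] := j2' _ (proj1 (VV w) wV).
have e := IH _ wx _ _ wc wc'; subst c'.
have [_ oc] := dom _ _ wc.
have [] := jB c b' oc ob'; first by apply: B_j' wc' xb' _; left.
move=> x1 [y1 [x1c y1b xy1]].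
have e1 := j4 _ _ _ x1c wc; have e2 := j4 _ _ _ y1b zb'; subst x1 y1.
case: xy1 => // e; subst z; have e := j3 _ _ _ x1c y1b; subst c.
by have e := j4' _ _ _ wc' xb'; subst w; case: (in_irr hG wx).
Qed.

(** Several injections may be coded at a rank, but [coded_uniq] makes the value at
    [x] independent of the one used, so no choice is left to be made. *)
Lemma global_code : exists num : M -> M,
  [/\ dfun1 num, forall x, Ord M (num x) & injective num].
Proof.
have [B [AB BP]] := coded_branch.
have dco : def2 (coded B) by rewrite /coded /triple; def_tac.
(* The number of [x] consists of its rank and its place in the injection coded there. *)
pose H x n := exists j b, [/\ coded B (osucc (rank hG x)) j, isin (opair x b) j & n = pc (osucc (rank hG x)) b].
have oo x : Ord M (osucc (rank hG x)) by apply: ord_succ => //; exact: ord_rank.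
have [||F [dF FP _]] := dfun_of_rel hG (H := H) (pt MA) _ _.
- by rewrite /H; def_tac.
- move=> x n n' [j [b [cj xb ->]]] [j' [b' [cj' xb' ->]]]; congr pc.
  exact: coded_uniq (oo x) cj cj' _ _ _ xb xb'.
have FE x : H x (F x).
  have [j cj] := BP _ (oo x).
  have [[V [VP [_ jV _ _] _]] _] := cj.
  have [b xb] : exists b, isin (opair x b) j by apply: jV; apply/VP; exact: succ_ord_in.
  have Hx : H x (pc (osucc (rank hG x)) b) by exists j, b.
  by rewrite (FP _ _ Hx).
exists F; split=> // [x|x y].
  by have [j [b [[Jj _] xb ->]]] := FE x; apply: opc => //; have [] := least_inj_ord Jj xb.
have [j [b [cj xb ->]]] := FE x; have [j' [b' [cj' yb' ->]]] := FE y.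
have [_ ob] := least_inj_ord (proj1 cj) xb; have [_ ob'] := least_inj_ord (proj1 cj') yb'.
move=> /pc_inj[] // e eb; subst b'.
rewrite -e in cj'.
have [[V [VP [_ jV _ j4] _]] _] := cj.
have [b1 yb1] : exists b1, isin (opair y b1) j.
  by apply: jV; apply/VP; rewrite e; exact: succ_ord_in.
have e1 := coded_uniq (oo x) cj cj' yb1 yb'; subst b1.
exact: j4 xb yb1.
Qed.

End GlobalChoice.

Lemma global_numbering : exists num : M -> M,
  [/\ dfun1 num, forall x, Ord M (num x) & injective num].
Proof. by have [pc [dpc opc pc_inj]] := pairing_exists hG; apply: (global_code (pc := pc)). Qed.

Definition num : M -> M := projT1 (cid global_numbering).

Lemma dfun1_num : dfun1 num.
Proof. by rewrite /num; case: cid => F []. Qed.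
Hint Resolve dfun1_num : def.

Lemma ord_num x : Ord M (num x).
Proof. by rewrite /num; case: cid => F []. Qed.

Lemma num_inj : injective num.
Proof. by rewrite /num; case: cid => F []. Qed.

(** Least numbers turn any definable predicate into a witness that depends
    definably on parameters; the default value is taken when there is no
    witness. *)
Definition select (P : M -> Prop) : M := epsilon (sets_inh M) (fun x =>
  (P x /\ forall y, P y -> ~ isin (num y) (num x)) \/ (~ (exists y, P y) /\ x = pt MA)).

Lemma least_num (P : M -> Prop) : def1 P -> (exists x, P x) ->
  exists2 x, P x & forall y, P y -> ~ isin (num y) (num x).
Proof.
move=> dP [x Px].
have [||n [on [y Py <-] nm]] := ord_least hG (P := fun n => exists2 y, P y & num y = n) _.
- by def_tac.
- by exists (num x); [exact: ord_num|exists x].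
by exists y => // z Pz; apply: nm; [exact: ord_num|exists z].
Qed.

Lemma selectP P : def1 P ->
  (P (select P) /\ forall y, P y -> ~ isin (num y) (num (select P))) \/
  (~ (exists y, P y) /\ select P = pt MA).
Proof.
move=> dP; apply: (epsilon_spec (sets_inh M) (fun x =>
  (P x /\ forall y, P y -> ~ isin (num y) (num x)) \/ (~ (exists y, P y) /\ x = pt MA))).
have [exP|N] := pselect (exists y, P y); last by exists (pt MA); right.
by have [x Px xm] := least_num dP exP; exists x; left.
Qed.

Lemma select_spec P : def1 P -> (exists x, P x) -> P (select P).
Proof. by move=> dP exP; case: (selectP dP) => [[]|[]]. Qed.

Lemma dfn_def1 V (P : (V -> M) -> set M -> M -> Prop) s Y : A Y ->
  dfn (fun (s : option V -> M) Y => P (fun t => s (Some t)) Y (s None)) ->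
  def1 (P s Y).
Proof.
move=> AY dP; have := dfn_subst (fun o : option V => match o with
  None => inl tt | Some t => inr (s t) end) dP.
by move/(dfn_fix_class AY).
Qed.

Lemma dterm_select V (P : (V -> M) -> M -> Prop) :
  dfn (fun (s : option V -> M) _ => P (fun t => s (Some t)) (s None)) ->
  dterm (fun s => select (P s)).
Proof.
move=> dP; rewrite /dterm.
have d1 s : def1 (P s).
  exact: (dfn_def1 (P := fun s _ => P s) s (gbc_subsort hG (pt MA)) dP).
have dP1 : dfn (fun (s : option (option V) -> M) _ => P (fun t => s (Some (Some t))) (s None)).
  exact: (dfn_ren (fun o => match o with None => None | Some t => Some (Some t) end) dP).
have dP2 : dfn (fun (s : option V -> M) _ => P (fun t => s (Some t)) (s None)) by [].
have dP3 : dfn (fun (s : option (option V) -> M) _ => P (fun t => s (Some (Some t))) (s (Some None))).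
  exact: (dfn_ren Some dP).
apply: (dfn_iff (P := fun s _ =>
  (P (fun t => s (Some t)) (s None) /\
    forall y, P (fun t => s (Some t)) y -> ~ isin (num y) (num (s None))) \/
  (~ (exists y, P (fun t => s (Some t)) y) /\ s None = pt MA))).
  move=> s Y; have := selectP (d1 (fun t => s (Some t))).
  set x := select _ => xP; split=> [xE|->//].
  case: xP => [[Px xm]|[N xE']]; case: xE => [[Py ym]|[N' yE]].
  - apply: num_inj; case: (ord_tri hG (ord_num (s None)) (ord_num x)) => // h.
      by case: (xm _ Py).
    by case: (ym _ Px).
  - by case: N'; exists x.
  - by case: N; exists (s None).
  - by rewrite yE xE'.
apply: dfn_or; first by apply: dfn_and => //; apply: dfn_all; apply: dfn_imp => //; dfn_tac.
by apply: dfn_and; [apply: dfn_not; apply: dfn_ex|dfn_tac].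
Qed.

End WeaklyCompact.

#[local] Hint Resolve dfun1_num : def.

(** * Coded relations and functions of several variables *)

Lemma mktuple_tnth T n (t : n.-tuple T) : [tuple tnth t j | j < n] = t.
Proof. by apply: tuple_eq => j; rewrite tnth_mktuple. Qed.

Section Tuples.
Variable MA : class_structure.
Local Notation M := (set_part MA).
Local Notation A := (@classes MA).
Hypothesis hG : GBC MA.

(** The only solution of [tuple_code], as a function. *)
Fixpoint tcode (s : seq M) : M :=
  match s with
  | [::] => zero MA
  | [:: x] => x
  | x :: s' => opair x (tcode s')
  end.

Lemma tuple_codeE s z : tuple_code s z <-> z = tcode s.
Proof.
elim: s z => [|x s IH] z /=.
  split=> [z0|->]; last by move=> w /(in_zero hG).
  by apply: (set_ext hG) => w; split=> [/z0|/(in_zero hG)].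
case: s IH => [//|y s] IH; split=> [[w /IH -> /(is_opairE hG)]//|->].
by exists (tcode (y :: s)); [apply/IH|apply/is_opairE].
Qed.

Lemma tcode_inj s s' : size s = size s' -> tcode s = tcode s' -> s = s'.
Proof.
elim: s s' => [|x s IH] [|x' s'] //= [ss'].
case: s IH ss' => [|y s] IH; case: s' => [|y' s'] //= ss'; first by move=> ->.
by move=> /(opair_inj hG)[-> e]; rewrite (IH (y' :: s')).
Qed.

Fixpoint dterms V (fs : seq ((V -> M) -> M)) : Prop :=
  if fs is f :: fs' then dterm f /\ dterms fs' else True.

Lemma dterm_tcode V (fs : seq ((V -> M) -> M)) : dterms fs ->
  dterm (fun s => tcode [seq f s | f <- fs]).
Proof.
elim: fs => [|f [|g fs] IH] /= => [_|[]//|[df dfs]]; first exact: dterm_const.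
apply: (dterm2 hG (F := @opair MA) (f := f)) => //; last exact: IH.
exact: dfun2_opair.
Qed.

Lemma dterm_tcode_tuple V n (F : 'I_n -> (V -> M) -> M) :
  (forall j, dterm (F j)) -> dterm (fun s => tcode [tuple F j s | j < n]).
Proof.
move=> dF.
have := @dterm_tcode V [seq F j | j <- enum 'I_n].
have -> : (fun s => tcode [seq f s | f <- [seq F j | j <- enum 'I_n]]) =
    (fun s => tcode [tuple F j s | j < n]).
  by apply/funext => s; rewrite -map_comp.
by apply; elim: (enum _) => //= j js IH; split.
Qed.

Definition joinv V n (s : V -> M) (t : n.-tuple M) (r : V + 'I_n) : M :=
  match r with inl v => s v | inr j => tnth t j end.

Lemma dfn_ex_tuple n V (Q : (V + 'I_n -> M) -> set M -> Prop) : dfn Q ->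
  dfn (fun s Y => exists t : n.-tuple M, Q (joinv s t) Y).
Proof.
elim: n V Q => [|n IH] V Q dQ.
  have d1 := dfn_ren (fun r : V + 'I_0 => match r with inl v => v
    | inr j => match notF (ltn_ord j) with end end) dQ.
  apply: dfn_iff d1 => s Y; have e (t : 0.-tuple M) : joinv s t = (fun v : V + 'I_0 => s
      match v with inl v0 => v0 | inr j => match notF (ltn_ord j) with end end).
    by apply/funext => -[v|[]].
  split=> [h|[t]]; last by rewrite e.
  by exists [tuple]; rewrite e.
pose rho (r : V + 'I_n.+1) : option V + 'I_n := match r with inl v => inl (Some v)
  | inr j => if unlift ord0 j is Some k then inr k else inl None end.
have e s x (t : n.-tuple M) : (fun v => joinv (ocons x s) t (rho v)) = joinv s (tcons x t).
  by apply/funext => -[v|j] //=; case: unliftP => [k|] -> //=; rewrite tnth_tconsS.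
apply: (dfn_iff (P := fun s Y => exists x, exists t : n.-tuple M,
    Q (fun v => joinv (ocons x s) t (rho v)) Y)) => [s Y|].
  split=> [[x [t]]|[t]]; first by rewrite e => h; exists (tcons x t).
  by case/tupleP: t => x t h; exists x, t; rewrite e.
apply: dfn_ex; apply: dfn_iff (IH (option V) _ (dfn_ren rho dQ)) => s Y.
by have <- : s = ocons (s None) (fun v => s (Some v)) by apply/funext => -[].
Qed.

Lemma mktuple_joinv V n (s : V -> M) (t : n.-tuple M) :
  [tuple joinv s t (inr j) | j < n] = t.
Proof. exact: mktuple_tnth. Qed.

(** Relations coded by a class are the definable relations, because classes may
    serve as parameters. *)
Lemma coded_relP n (R : set (n.-tuple M)) :
  coded_rel R <-> dfn (fun (s : 'I_n -> M) _ => R [tuple s j | j < n]).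
Proof.
split=> [AR|dR].
  pose C := [set z | exists2 t : n.-tuple M, R t & tuple_code t z].
  apply: (dfn_iff (P := fun s _ => C (tcode [tuple s j | j < n]))).
    move=> s Y; split=> [[t Rt /tuple_codeE e]|Rs]; last first.
      by exists [tuple s j | j < n] => //; apply/tuple_codeE.
    rewrite (_ : [tuple s j | j < n] = t) //; apply/val_inj/tcode_inj => //.
    by rewrite !size_tuple.
  apply: dfn1; first exact: def1_class.
  apply: dterm_tcode_tuple => j; exact: dterm_var.
apply: class_of_def1 => //; rewrite /def1.
apply: (dfn_iff (P := fun s Y => exists t : n.-tuple M,
    R [tuple joinv s t (inr j) | j < n] /\
    joinv s t (inl tt) = tcode [tuple joinv s t (inr j) | j < n])).
  move=> s Y; split=> [[t]|[t Rt /tuple_codeE e]].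
    by rewrite mktuple_joinv => -[Rt e]; exists t => //; apply/tuple_codeE.
  by exists t; rewrite mktuple_joinv.
apply: (dfn_ex_tuple (Q := fun s Y => R [tuple s (inr j) | j < n] /\
  s (inl tt) = tcode [tuple s (inr j) | j < n])).
apply: dfn_and; first exact: (dfn_ren inr dR).
apply: (dfn2 (R := eq)); [exact: def2_eq|exact: dterm_var|].
apply: dterm_tcode_tuple => j; exact: dterm_var.
Qed.

Lemma coded_funP n (f : n.-tuple M -> M) :
  coded_fun f <-> dterm (fun s : 'I_n -> M => f [tuple s j | j < n]).
Proof.
have key (s : 'I_n.+1 -> M) : (exists s' : n.-tuple M,
    [tuple s j | j < n.+1] = [tuple of rcons s' (f s')]) <->
    s ord_max = f [tuple s (widen_ord (leqnSn n) j) | j < n].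
  have nthl (s' : n.-tuple M) x (j : 'I_n) : tnth [tuple of rcons s' x] (widen_ord (leqnSn n) j) = tnth s' j.
    by rewrite !(tnth_nth x) /= nth_rcons size_tuple ltn_ord.
  have nthm (s' : n.-tuple M) x : tnth [tuple of rcons s' x] ord_max = x.
    by rewrite (tnth_nth x) /= nth_rcons size_tuple ltnn eqxx.
  split=> [[s' e]|e].
    have es j : s j = tnth [tuple of rcons s' (f s')] j by rewrite -e tnth_mktuple.
    rewrite es nthm; congr f; apply: tuple_eq => j.
    by rewrite tnth_mktuple es nthl.
  exists [tuple s (widen_ord (leqnSn n) j) | j < n].
  apply: tuple_eq => j; rewrite tnth_mktuple; have [jn|jn] := ltnP j n.
    have -> : j = widen_ord (leqnSn n) (Ordinal jn) by exact: val_inj.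
    by rewrite nthl tnth_mktuple.
  have -> : j = ord_max by apply/val_inj/eqP; rewrite eqn_leq /= jn -ltnS ltn_ord.
  by rewrite nthm e.
rewrite /coded_fun coded_relP /= /dterm; split=> H.
  have := dfn_ren (fun j : 'I_n.+1 => if insub (val j) is Some k then Some k else None : option 'I_n) H.
  apply: dfn_iff => s Y; rewrite key insubF /= ?ltnn //.
  rewrite (_ : [tuple _ | j < n] = [tuple s (Some j) | j < n]) //.
  by apply: tuple_eq => j; rewrite !tnth_mktuple /= valK.
have := dfn_ren (fun o : option 'I_n => if o is Some k then widen_ord (leqnSn n) k else ord_max) H.
by apply: dfn_iff => s Y; rewrite key.
Qed.

Lemma dfn_finvars V (P : (V -> M) -> set M -> Prop) : dfn P ->
  exists m (a : 'I_m -> V + M) (P' : ('I_m -> M) -> set M -> Prop),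
    dfn P' /\ forall s Y, P s Y <-> P' (fun j => aval s (a j)) Y.
Proof.
move=> [m [n [phi [a [E [pp cE H]]]]]].
exists m, a, (fun s Y => sat1 [tuple s j | j < m] (tcons Y E) phi); split=> //.
by exists m, n, phi, inl, E; split.
Qed.

End Tuples.

(** * Generic ultrafilters *)

Section Ultrafilter.
Variable MA : class_structure.
Local Notation M := (set_part MA).
Local Notation A := (@classes MA).
Variable U : set (set MA).
Hypotheses (hG : GBC MA) (hwc : Ord_weakly_compact MA)
  (hU : generic_ultrafilter MA U).

(** The quantifier for [U]-many ordinals.  It makes sense for arbitrary
    predicates, hence is monotone without side conditions. *)
Definition Uq (P : M -> Prop) := exists2 X, U X & forall a, X a -> P a.

Lemma UqS (P Q : M -> Prop) : (forall a, P a -> Q a) -> Uq P -> Uq Q.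
Proof. by move=> PQ [X UX XP]; exists X => // a /XP/PQ. Qed.

Lemma U_PP X : U X -> PP X.
Proof. by have [[UP _ _ _] _] := hU; exact: UP. Qed.

Lemma Uq_and P Q : Uq P -> Uq Q -> Uq (fun a => P a /\ Q a).
Proof.
move=> [X UX XP] [Y UY YQ]; have [[_ _ _ UI] _] := hU.
by have [Z UZ [ZX ZY]] := UI _ _ UX UY; exists Z => // a Za; split; [apply/XP/ZX|apply/YQ/ZY].
Qed.

Lemma Uq_ord : Uq (Ord M).
Proof.
have [[_ [X UX] _ _] _] := hU; exists X => //.
by have [[XO _] _] := U_PP UX.
Qed.

Lemma Uq_all (P : M -> Prop) : (forall a, Ord M a -> P a) -> Uq P.
Proof. by move=> H; apply: UqS Uq_ord. Qed.

Lemma Uq_unbounded P b : Uq P -> Ord M b -> exists a, [/\ Ord M a, P a & isin b a].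
Proof.
move=> [X UX XP] ob; have [[XO _] uX] := U_PP UX.
by have [a Xa ba] := uX b ob; exists a; split=> //; [exact: XO|exact: XP].
Qed.

Lemma Uq_ex P : Uq P -> exists2 a, Ord M a & P a.
Proof. by move=> /Uq_unbounded/(_ (zero_ord hG))[a [oa Pa _]]; exists a. Qed.

Lemma Uq_const (P : Prop) : Uq (fun=> P) <-> P.
Proof. by split=> [/Uq_ex[]//|p]; apply: Uq_all. Qed.

Lemma Uq_BB X : BB X -> U X <-> Uq X.
Proof.
move=> BX; split=> [UX|[Y UY YX]]; first by exists X.
have [[_ _ Uup _] _] := hU; apply: (Uup Y) => //; split=> //.
have [_ uY] := U_PP UY.
by move=> b /uY[a /YX Xa ba]; exists a.
Qed.

(** Genericity in the form in which it is used: a definable property that holds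
    for some unbounded subclass of every unbounded class holds for a member
    of [U]. *)
Lemma generic_meet (Q : set M -> Prop) : dfn (fun (s : unit -> M) Y => Q Y) ->
  (forall X, PP X -> exists Y, [/\ PP Y, Y `<=` X & Q Y]) ->
  exists2 Y, U Y & Q Y.
Proof.
move=> dQ Qd.
pose Q' (Y : set M) := [/\ forall a, Y a -> Ord M a,
  forall a, Ord M a -> exists2 b, Y b & isin a b & Q Y].
have dD : dfn (fun (s : unit -> M) Y => Q' Y).
  rewrite /Q'; apply: dfn_and3 => //; dfn_tac.
have [_ /(_ [set Y | A Y /\ Q' Y])] := hU.
have PPQ Y : (A Y /\ Q' Y) <-> PP Y /\ Q Y.
  by split=> [[AY [YO uY QY]]|[[[YO AY] uY] QY]].
case.
- split=> [Y /PPQ[]//|X /Qd[Y [PY YX QY]]].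
  by exists Y => //; apply/PPQ.
- exact: (definable_of_dfn (fun=> pt MA) dD).
by move=> Y [UY /PPQ[_ QY]]; exists Y.
Qed.

(** An unbounded class meets [P] in an unbounded class or else agrees with the
    complement of [P] from some point on. *)
Lemma Uq_ultra P : def1 P -> Uq P \/ Uq (fun a => ~ P a).
Proof.
move=> dP.
have [|X PX|Y UY [YP|YP]] := generic_meet (Q := fun Y => (forall a, Y a -> P a) \/ (forall a, Y a -> ~ P a)).
- by dfn_tac.
- have [[XO AX] uX] := PX.
  have [u1|u1] := pselect (unbounded [set a | X a /\ P a]).
    exists [set a | X a /\ P a]; split.
    + split=> //; split=> [a [/XO]//|]; by apply: class_of_def1 => //; def_tac.
    + by move=> a [].
    + by left=> a [].
  exists [set a | X a /\ ~ P a]; split.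
  + split; first by split=> [a [/XO]//|]; apply: class_of_def1 => //; def_tac.
    have [b Nb] : exists b, ~ (Ord M b -> exists2 a, (X a /\ P a) & isin b a).
      by apply/existsNP.
    have [ob {}Nb] := imply_to_and _ _ Nb.
    have Pb a : X a -> isin b a -> ~ P a by move=> Xa ba Pa; apply: Nb; exists a.
    move=> c oc; case: (ord_tri hG ob oc) => h.
    * have [a Xa ca] := uX c oc; exists a => //; split=> //; apply: Pb => //.
      apply: ord_trans h ca; exact: XO.
    * have [a Xa ca] := uX c oc; exists a => //; split=> //; apply: Pb => //.
      by rewrite h.
    * have [a Xa ba] := uX b ob; exists a; last first.
        by apply: ord_trans h ba; exact: XO.
      by split=> //; exact: Pb.
  + by move=> a [].
  + by right=> a [].
- by left; exists Y.
- by right; exists Y.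
Qed.

Lemma Uq_tail b : Ord M b -> Uq (fun a => Ord M a /\ isin b a).
Proof.
move=> ob; apply: Uq_and Uq_ord _.
case: (@Uq_ultra (fun a => isin b a)) => //; first by def_tac.
move=> H; have [a [_ nba ba]] := Uq_unbounded H ob.
by case: nba.
Qed.

(** By [pigeonhole], every unbounded class on which the values of [g] fall in a set
    has an unbounded subclass on which [g] is constant. *)
Lemma Uq_complete (g : M -> M) P : dfun1 g -> small P -> Uq (fun a => P (g a)) ->
  exists2 w, P w & Uq (fun a => g a = w).
Proof.
move=> dg sP UP; have dP := small_def1 hG sP.
have [|X PX|Y UY [YP|[w Pw Yw]]] := generic_meet (Q := fun Y =>
   (forall a, Y a -> ~ P (g a)) \/ exists2 w, P w & forall a, Y a -> g a = w).
- by dfn_tac.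
- have [[XO AX] uX] := PX.
  have [u1|u1] := pselect (unbounded [set a | X a /\ ~ P (g a)]).
    exists [set a | X a /\ ~ P (g a)]; split.
    + split=> //; split=> [a [/XO]//|]; by apply: class_of_def1 => //; def_tac.
    + by move=> a [].
    + by left=> a [].
  have [b Nb] : exists b, ~ (Ord M b -> exists2 a, (X a /\ ~ P (g a)) & isin b a).
    by apply/existsNP.
  have [ob {}Nb] := imply_to_and _ _ Nb.
  pose X' := [set a | X a /\ isin b a].
  have AX' : A X' by apply: class_of_def1 => //; def_tac.
  have uX' : unbounded X'.
    move=> c oc; case: (ord_tri hG ob oc) => h.
    + have [a Xa ca] := uX c oc; exists a => //; split=> //.
      apply: ord_trans h ca; exact: XO.
    + by have [a Xa ca] := uX c oc; exists a => //; split=> //; rewrite h.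
    + have [a Xa ba] := uX b ob; exists a; first by split.
      by apply: ord_trans h ba; exact: XO.
  have [|a [Xa ba]|w Pw uw] := pigeonhole hG AX' uX' dg _ sP.
  + by move=> a [/XO].
  + by apply: contrapT => nP; apply: Nb; exists a.
  exists [set a | X' a /\ g a = w]; split.
  + split=> //; split=> [a [[/XO]]//|]; by apply: class_of_def1 => //; def_tac.
  + by move=> a [[]].
  + by right; exists w => // a [].
- have [a [_ Pa] _] := Uq_unbounded (Uq_and UP (ex_intro2 _ _ Y UY YP)) (zero_ord hG).
  by case: Pa.
- by exists w => //; exists Y.
Qed.

(** It suffices that some class [Y] in [U] decides all [R x] up to bounded sets:
    then [Uq (R x)] says that [R x a] holds from some point on in [Y], which is
    definable from [Y].  To find such a [Y] inside a given unbounded [X], consider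
    the tree of patterns of truth values (indexed by the numbers of the [x]) that
    occur for unboundedly many [a] in [X].  It has height [Ord] by [pigeonhole];
    take a branch, and for every level put into [Y] the least large element
    realizing the pattern of the branch at that level. *)
Lemma Uq_iterable (R : M -> M -> Prop) : def2 R -> def1 (fun x => Uq (R x)).
Proof.
move=> dR; pose num := num hG hwc.
have dnum : dfun1 num by exact: dfun1_num.
have [|X PX|Y UY YQ] := generic_meet (Q := fun Y => forall x,
   (exists2 b, Ord M b & forall a, Y a -> isin b a -> R x a) \/
   (exists2 b, Ord M b & forall a, Y a -> isin b a -> ~ R x a)); last first.
- have [[_ AY] _] := U_PP UY.
  apply: (dfn_iff (P := fun s _ => exists2 b, Ord M b & forall a, Y a -> isin b a -> R (s tt) a)).
    have yes x : (exists2 b, Ord M b & forall a, Y a -> isin b a -> R x a) -> Uq (R x).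
      move=> [b ob bP]; apply: UqS (Uq_and (Uq_tail ob) (ex_intro2 _ _ Y UY (fun a Ya => Ya))).
      by move=> a [[_ ba] Ya]; exact: bP.
    move=> s _; split=> [|Us]; first exact: yes.
    case: (YQ (s tt)) => // -[b ob bP]; have [a] := Uq_ex (Uq_and Us (Uq_and (Uq_tail ob) (ex_intro2 _ _ Y UY (fun a Ya => Ya)))).
    by move=> _ [Ra [[_ ba] /bP]]; case.
  by dfn_tac.
- have [[XO AX] uX] := PX.
  pose T d w := (forall v, isin v w -> isin v d) /\ forall b, Ord M b ->
    exists2 a, X a & isin b a /\ forall x, isin (num x) d -> (isin (num x) w <-> R x a).
  have [||||B [AB BP]] := tree_property hG hwc (T := T).
  + by rewrite /T; def_tac.
  + by move=> d w v [Tw _]; exact: Tw.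
  + move=> d d' w w' od d'd [Tw Tb] ww'; split=> [v /ww'[]//|b ob].
    have [a Xa [ba aP]] := Tb b ob; exists a => //; split=> // x xd'.
    rewrite ww' -aP; [tauto|exact: ord_trans xd' d'd].
  + move=> d od.
    pose pat a v := isin v d /\ exists2 x, num x = v & R x a.
    have spat a : small (pat a).
      by apply: (small_sub hG (P := fun v => isin v d)); [exists d|rewrite /pat; def_tac|move=> v []].
    pose g a := mkset (pat a).
    have dg : dfun1 g.
      apply: (dfn_iff (P := fun s _ => forall v, isin v (s false) <-> pat (s true) v)).
        by move=> s Y; rewrite /g mkset_uniq.
      by rewrite /pat; dfn_tac.
    have [|w wd uw] := pigeonhole hG AX uX dg XO (small_power hG d).
      by move=> a Xa v; rewrite /g mksetP // => -[].
    exists w; split=> [v /wd//|b ob]; have [a [Xa ga] ba] := uw b ob.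
    exists a => //; split=> // x xd; rewrite -ga /g mksetP //; split.
      by move=> [_ [y /(@num_inj _ hG hwc) ->]].
    by split=> //; exists x.
  pose rz d a := [/\ X a, isin d a & forall x, isin (num x) d -> (B (num x) <-> R x a)].
  have drz : def2 rz by rewrite /rz; def_tac.
  pose lz d a := rz d a /\ forall a', rz d a' -> ~ isin a' a.
  have dlz : def2 lz by rewrite /lz; def_tac.
  have lz_ex d : Ord M d -> exists a, lz d a.
    move=> od; have drz1 : def1 (rz d) by def_tac.
    have [|a [_ ra am]] := ord_least hG drz1.
      have [w [_ Tb] wB] := BP d od; have [a Xa [da aP]] := Tb d od.
      exists a; first exact: XO; split=> // x xd; rewrite -aP // wB; tauto.
    by exists a; split=> // a' ra'; apply: am => //; apply: XO; have [] := ra'.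
  have lz_fun d a a' : lz d a -> lz d a' -> a = a'.
    move=> [ra am] [ra' am']; have [Xa _ _] := ra; have [Xa' _ _] := ra'.
    case: (ord_tri hG (XO _ Xa) (XO _ Xa')) => // h; first by case: (am' a).
    by case: (am a').
  pose Y := [set a | exists2 d, Ord M d & lz d a].
  have AY : A Y by apply: class_of_def1 => //; rewrite /Y /=; def_tac.
  have YX : Y `<=` X by move=> a [d _ [[]]].
  exists Y; split=> //.
    split; first by split=> // a /YX/XO.
    by move=> b ob; have [a la] := lz_ex b ob; exists a; [exists b|case: la => -[]].
  move=> x.
  (* Elements of [Y] chosen for levels up to the number of [x] are bounded. *)
  have s1 : small (fun a => exists2 d, isin d (osucc (num x)) & lz d a).
    by apply: (small_image hG) => //; exists (osucc (num x)).
  have [|b ob bP] := small_bounded hG s1.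
    by move=> a [d _ [[/XO]]].
  have big a : Y a -> isin b a -> exists2 d, isin (num x) d & rz d a.
    move=> [d od la] ba; exists d; last by case: la.
    case: (ord_tri hG (ord_num hG hwc x) od) => // h.
      case: (in_asym hG ba); apply: bP; exists d => //; rewrite in_osucc //; right; exact: esym h.
    by case: (in_asym hG ba); apply: bP; exists d => //; rewrite in_osucc //; left.
  have [Bx|Bx] := pselect (B (num x)); [left|right]; exists b => // a Ya ba.
    by have [d xd [_ _ rP]] := big a Ya ba; apply/rP.
  by have [d xd [_ _ rP]] := big a Ya ba; move/rP => /(_ xd).
- by dfn_tac.
Qed.

(** Reduces to [Uq_iterable] by packing the finitely many parameters of the
    predicate into one set. *)
Lemma dfn_Uq V (P : (V -> M) -> M -> Prop) :
  dfn (fun (s : option V -> M) _ => P (fun v => s (Some v)) (s None)) ->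
  dfn (fun s _ => Uq (P s)).
Proof.
move=> dP; have [m [a [P' [dP' PP']]]] := dfn_finvars dP.
pose l j : V + M := match a j with inl (Some v) => inl v | inl None => inr (pt MA) | inr c => inr c end.
pose R z b := exists t : m.-tuple M, z = tcode t /\
  P' (fun j => if a j is inl None then b else tnth t j) (ext (pt MA)).
have dR : def2 R.
  have dQ : dfn (fun (s : bool + 'I_m -> M) (Y : set M) => s (inl true) = tcode [tuple s (inr j) | j < m] /\
     P' (fun j => s (if a j is inl None then inl false else inr j)) (ext (pt MA))).
    apply: dfn_and.
      apply: (dfn2 (R := eq)); [exact: def2_eq|exact: dterm_var|].
      by apply: dterm_tcode_tuple => // j; exact: dterm_var.
    exact: (dfn_fix_class (gbc_subsort hG _) (dfn_ren (fun j => if a j is inl None then inl false else inr j) dP')).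
  apply: dfn_iff (dfn_ex_tuple dQ) => s Y.
  have e (t : m.-tuple M) : (fun j => joinv s t (if a j is inl None then inl false else inr j)) =
      (fun j => if a j is inl None then s false else tnth t j).
    by apply/funext => j; case: (a j) => [[]|].
  by split=> -[t [tE Pt]]; exists t; move: tE Pt; rewrite e mktuple_joinv.
apply: (dfn_iff (P := fun s _ => Uq (R (tcode [tuple aval s (l j) | j < m])))).
  have RP s b : R (tcode [tuple aval s (l j) | j < m]) b <-> P s b.
    rewrite (PP' (ocons b s) (ext (pt MA))).
    have e : (fun j => aval (ocons b s) (a j)) = (fun j => if a j is inl None then b else
       tnth [tuple aval s (l j) | j < m] j).
      by apply/funext => j; rewrite tnth_mktuple /l; case: (a j) => [[]|].
    rewrite e; split=> [[t [tE]]|H]; last by exists [tuple aval s (l j) | j < m].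
    rewrite (_ : t = [tuple aval s (l j) | j < m]) //.
    by apply/val_inj/(tcode_inj hG) => //; rewrite !size_tuple.
  by move=> s Y; split; apply: UqS => b /RP.
apply: (dfn1 (P := fun x => Uq (R x)) (f := fun s => tcode [tuple aval s (l j) | j < m])).
  exact: Uq_iterable.
apply: dterm_tcode_tuple => // j; case: (l j) => v; [exact: dterm_var|exact: dterm_const].
Qed.

End Ultrafilter.

(** * Definability of satisfaction *)

Section Satisfaction.
Variable MA : class_structure.
Local Notation M := (set_part MA).
Local Notation A := (@classes MA).
Hypothesis hG : GBC MA.

Lemma dfn_all_ord V n (P : 'I_n -> (V -> M) -> set M -> Prop) :
  (forall j, dfn (P j)) -> dfn (fun s Y => forall j, P j s Y).
Proof.
elim: n P => [|n IH] P dP.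
  by apply: (dfn_iff _ (dfn_prop _ V True)) => s Y; split=> // _ [].
have dI := IH (fun j => P (lift ord0 j)) (fun j => dP _).
apply: dfn_iff (dfn_and (dP ord0) dI) => s Y.
split=> [[h0 h] j|h]; last by split.
by case: (unliftP ord0 j) => [k|] ->.
Qed.

Lemma dfn_comp V n (P : ('I_n -> M) -> set M -> Prop) (F : 'I_n -> (V -> M) -> M) :
  dfn P -> (forall j, dterm (F j)) -> dfn (fun s Y => P (fun j => F j s) Y).
Proof.
move=> dP dF.
have dQ : dfn (fun (s : V + 'I_n -> M) Y => (forall j, s (inr j) = F j (fun v => s (inl v))) /\
    P (fun j => s (inr j)) Y).
  apply: dfn_and; last exact: (dfn_ren inr dP).
  apply: dfn_all_ord => j.
  exact: (dfn_ren (fun o : option V => if o is Some v then inl v else inr j) (dF j)).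
apply: dfn_iff (dfn_ex_tuple dQ) => s Y; split=> [[t [tF Pt]]|h].
  by rewrite (_ : (fun j => F j s) = (fun j => tnth t j)) //; apply/funext => j; rewrite -tF.
exists [tuple F j s | j < n]; split=> [j|]; first by rewrite /= tnth_mktuple.
by rewrite (_ : (fun j => _ ) = (fun j => F j s)) //; apply/funext => j; rewrite /= tnth_mktuple.
Qed.

Lemma dterm_comp V n (f : ('I_n -> M) -> M) (F : 'I_n -> (V -> M) -> M) :
  dterm f -> (forall j, dterm (F j)) -> dterm (fun s => f (fun j => F j s)).
Proof.
move=> df dF.
have d1 := dfn_ren (fun o : option 'I_n => if o is Some j then lift ord0 j else ord0) df.
have := dfn_comp (F := fun j => if unlift ord0 j is Some k then fun s => F k (fun v => s (Some v))
  else fun s : option V -> M => s None) d1.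
rewrite /dterm => H; apply: dfn_iff (H _) => [s Y|j].
  rewrite unlift_none; suff -> : (fun j => (if unlift ord0 (lift ord0 j) is Some k
    then fun s => F k (fun v => s (Some v)) else fun s : option V -> M => s None) s) =
    (fun j => F j (fun v => s (Some v))) by [].
  by apply/funext => j; rewrite liftK.
case: (unlift ord0 j) => [k|]; [exact: dterm_wk|exact: dterm_var].
Qed.

Lemma dterm_coded V n (f : n.-tuple M -> M) (F : 'I_n -> (V -> M) -> M) :
  coded_fun f -> (forall j, dterm (F j)) -> dterm (fun s => f [tuple F j s | j < n]).
Proof. by move=> /(coded_funP hG) df dF; exact: dterm_comp df dF. Qed.

Lemma dfn_coded V n (R : set (n.-tuple M)) (F : 'I_n -> (V -> M) -> M) :
  coded_rel R -> (forall j, dterm (F j)) -> dfn (fun s Y => R [tuple F j s | j < n]).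
Proof. by move=> /(coded_relP hG) dR dF; exact: dfn_comp dR dF. Qed.

Lemma dterm_eval n (t : term (L0A MA) n) :
  dterm (fun s : 'I_n -> M => @eval _ (expansion MA) n [tuple s j | j < n] t).
Proof.
elim: t => [j|k f ts IH] /=.
  rewrite (_ : (fun s => _) = (fun s : 'I_n -> M => s j)); first exact: dterm_var.
  by apply/funext => s; rewrite tnth_mktuple.
case: f ts IH => [x|k' f cf] ts IH /=; first exact: dterm_const.
exact: dterm_coded.
Qed.

Lemma dterm_eval_comp V n (t : term (L0A MA) n) (F : 'I_n -> (V -> M) -> M) :
  (forall j, dterm (F j)) ->
  dterm (fun s : V -> M => @eval _ (expansion MA) n [tuple F j s | j < n] t).
Proof. by move=> dF; exact: (dterm_comp (dterm_eval t) dF). Qed.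

Lemma dfn_sat n (phi : formula (L0A MA) n) :
  dfn (fun (s : 'I_n -> M) _ => @sat _ (expansion MA) n [tuple s j | j < n] phi).
Proof.
elim: phi => {n} [n|n t u|n k r ts|n phi IH1 psi IH2|n phi IH] /=.
- exact: dfn_bot.
- by apply: (dfn2 (R := eq)); [exact: def2_eq|exact: dterm_eval|exact: dterm_eval].
- case: r ts => [|k' R cR] ts /=; last by apply: dfn_coded => // j; exact: dterm_eval.
  apply: (dfn_iff (P := fun s _ => isin (@eval _ (expansion MA) n [tuple s j | j < n] (ts ord0))
    (@eval _ (expansion MA) n [tuple s j | j < n] (ts ord_max)))).
    by move=> s Y; rewrite /= !tnth_mktuple.
  by apply: dfn2; [exact: def2_in|exact: dterm_eval|exact: dterm_eval].
- exact: dfn_imp.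
apply: (dfn_all (P := fun s _ x => @sat _ (expansion MA) n.+1 (tcons x [tuple s j | j < n]) phi)).
apply: dfn_iff (dfn_ren (fun j : 'I_n.+1 => unlift ord0 j) IH) => s Y.
rewrite (_ : [tuple _ | j < n.+1] = tcons (s None) [tuple s (Some j) | j < n]) //.
apply: tuple_eq => j; rewrite tnth_mktuple; case: unliftP => [k|] -> //.
by rewrite tnth_tconsS tnth_mktuple.
Qed.

Lemma dfn_sat_comp V n (phi : formula (L0A MA) n) (F : 'I_n -> (V -> M) -> M) :
  (forall j, dterm (F j)) ->
  dfn (fun (s : V -> M) _ => @sat _ (expansion MA) n [tuple F j s | j < n] phi).
Proof. by move=> dF; exact: dfn_comp (dfn_sat phi) dF. Qed.

End Satisfaction.

(** * Iterated ultrafilter quantifiers *)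

Section Quantifier.
Variable MA : class_structure.
Local Notation M := (set_part MA).
Local Notation A := (@classes MA).
Variable U : set (set MA).
Hypotheses (hG : GBC MA) (hwc : Ord_weakly_compact MA)
  (hU : generic_ultrafilter MA U).

(** The predicate depends only on the variables in [l]; one implication is enough
    because the assignments can be exchanged. *)
Definition supp V (l : {pred V}) (P : (V -> M) -> Prop) :=
  forall s s', (forall v, v \in l -> s v = s' v) -> P s -> P s'.

Definition fsupp V (l : {pred V}) (f : (V -> M) -> M) :=
  forall s s', (forall v, v \in l -> s v = s' v) -> f s = f s'.

Section Lists.
Variable V : eqType.
Implicit Types (l : seq V) (P Q : (V -> M) -> Prop) (s : V -> M).

Definition upd s x a : V -> M := fun v => if v == x then a else s v.

(** The iterated quantifier: the first variable of the list is outermost, in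
    agreement with the iterated ultrafilter on tuples.  Variables outside
    the list keep the values given by [s]. *)
Fixpoint WL l P s : Prop :=
  if l is x :: l' then Uq U (fun a => WL l' P (upd s x a)) else P s.

Lemma WLS l P Q s : (forall s', P s' -> Q s') -> WL l P s -> WL l Q s.
Proof. by move=> PQ; elim: l s => [|x l IH] s /=; [exact: PQ|apply: UqS => a; exact: IH]. Qed.

Lemma WL_and l P Q s : WL l P s -> WL l Q s -> WL l (fun s' => P s' /\ Q s') s.
Proof.
elim: l s => [|x l IH] s //= h1 h2; apply: UqS (Uq_and hU h1 h2) => a [] .
exact: IH.
Qed.

Lemma WL_const l (P : Prop) s : WL l (fun=> P) s <-> P.
Proof.
elim: l s => [|x l IH] s //=; rewrite -{2}(Uq_const hG hU P).
by split; apply: UqS => a; rewrite IH.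
Qed.

Lemma WL_cat l l' P s : WL (l ++ l') P s = WL l (WL l' P) s.
Proof.
elim: l s => [//|x l IH] s /=; congr Uq; apply/funext => a; exact: IH.
Qed.

Lemma WL_all l P s : (forall s', (forall v, v \in l -> Ord M (s' v)) ->
   (forall v, v \notin l -> s' v = s v) -> P s') -> uniq l -> WL l P s.
Proof.
elim: l s P => [|x l IH] s P /= H; first by move=> _; apply: H.
move=> /andP[xl ul]; apply: (Uq_all hU) => a oa; apply: IH => // s' so ss.
apply: H => v.
  rewrite in_cons => /orP[/eqP ->|]; last exact: so.
  by rewrite ss // /upd eqxx.
rewrite in_cons negb_or => /andP[vx vl]; rewrite ss // /upd (negPf vx) //.
Qed.

Lemma WLS_at l P Q s : uniq l ->
  (forall s', (forall v, v \in l -> Ord M (s' v)) ->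
    (forall v, v \notin l -> s' v = s v) -> P s' -> Q s') -> WL l P s -> WL l Q s.
Proof.
move=> ul PQ WP; have WI : WL l (fun s' => P s' -> Q s') s.
  by apply: WL_all => // s' so ss; exact: PQ.
by apply: WLS (WL_and WP WI) => s' [] Ps; apply.
Qed.

Lemma supp_sub (l l' : seq V) P : {subset l <= l'} -> supp [in l] P -> supp [in l'] P.
Proof. by move=> ll' sP s s' ss; apply: sP => v /ll'; exact: ss. Qed.

Lemma WL_supp (S : {pred V}) l P : supp S P -> supp [pred v | (v \in S) && (v \notin l)] (WL l P).
Proof.
move=> sP; elim: l => [|x l IH] s s' ss /=.
  by apply: sP => v vS; apply: ss; rewrite inE vS.
apply: UqS => a; apply: IH => v; rewrite inE /upd => /andP[vS vl].
case: eqP => // /eqP vx; apply: ss; by rewrite !inE vS negb_or vx.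
Qed.

(** Quantifiers over variables that do not occur can be dropped: this is the
    coherence that lets the iterated ultrafilters be glued along [L]. *)
Lemma WL_filter (S : {pred V}) l P s : supp S P ->
  WL l P s <-> WL (filter S l) P s.
Proof.
move=> sP; elim: l s => [//|x l IH] s /=.
case: ifP => xS /=; first by split; apply: UqS => a; rewrite IH.
rewrite -IH -(Uq_const hG hU (WL l P s)); split; apply: UqS => a.
  apply: (WL_supp (l := l) sP) => v; rewrite inE /upd => /andP[vS _].
  by case: eqP vS => // ->; rewrite unfold_in xS.
apply: (WL_supp (l := l) sP) => v; rewrite inE /upd => /andP[vS _].
by case: eqP vS => // ->; rewrite unfold_in xS.
Qed.

Lemma dfn_upd P x (d : dfn (fun s (_ : set M) => P s)) :
  dfn (fun (s : option V -> M) _ => P (upd (fun v => s (Some v)) x (s None))).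
Proof.
apply: dfn_iff (dfn_ren (fun v => if v == x then None else Some v) d) => s Y.
suff -> : (fun v => s (if v == x then None else Some v)) = upd (fun v => s (Some v)) x (s None) by [].
by apply/funext => v; rewrite /upd; case: eqP.
Qed.

Lemma dfn_WL l P : dfn (fun s (_ : set M) => P s) -> dfn (fun s (_ : set M) => WL l P s).
Proof.
move=> dP; elim: l => [//|x l IH] /=.
by apply: (dfn_Uq hG hwc hU (P := fun s a => WL l P (upd s x a))); exact: dfn_upd.
Qed.

Lemma WL_ultra l P s : dfn (fun s (_ : set M) => P s) ->
  WL l P s \/ WL l (fun s' => ~ P s') s.
Proof.
move=> dP; elim: l s => [|x l IH] s /=; first exact: EM.
case: (@Uq_ultra _ U hG hU (fun a => WL l P (upd s x a))) => [|h|h].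
- apply: (dfn_def1 (P := fun s Y a => WL l P (upd s x a)) s (gbc_subsort hG (pt MA))).
  by apply: dfn_upd; exact: dfn_WL.
- by left.
by right; apply: UqS h => a h; case: (IH (upd s x a)).
Qed.

(** The two iterations agree. The work lies in checking that slices are coded
    and that the sets of first coordinates are classes, as the
    definition of the powers of [U] demands. *)
Lemma WL_Upow n (l : n.-tuple V) (X : set (n.-tuple M)) s : uniq l ->
  @BBn MA n X -> WL l (fun s' => X (map_tuple s' l)) s <-> Upow MA U n X.
Proof.
elim: n l X s => [|n IH] l X s.
  rewrite (tuple0 l) /= => _ _; split=> [Xs|->]; last exact/val_inj.
  rewrite predeqE => t; rewrite (tuple0 t); split=> // _.
  by rewrite (_ : [tuple] = map_tuple s [tuple]) //; exact/val_inj.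
case/tupleP: l => x l /= /andP[xl ul] BX; have [XO cX] := BX.
have BXa a : Ord M a -> BBn (slice X a).
  move=> oa; split=> [t /XO tO j|].
    by have := tO (lift ord0 j); rewrite tnth_tconsS.
  apply/(coded_relP hG).
  have := dfn_coded hG (F := fun j => if unlift ord0 j is Some k then fun s : 'I_n -> M => s k else fun=> a) cX.
  move=> H; apply: dfn_iff (H _) => [s' Y|j]; last by case: (unlift ord0 j) => [k|]; [exact: dterm_var|exact: dterm_const].
  rewrite /slice /= (_ : [tuple _ | j < n.+1] = tcons a [tuple s' j | j < n]) //.
  apply: tuple_eq => j; rewrite tnth_mktuple; case: unliftP => [k|] -> //.
  by rewrite tnth_tconsS tnth_mktuple.
have mapE s' : map_tuple s' [tuple of x :: l] = tcons (s' x) (map_tuple s' l) by exact/val_inj.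
have key a : Ord M a -> WL l (fun s' => X (map_tuple s' [tuple of x :: l])) (upd s x a) <->
    Upow MA U n (slice X a).
  move=> oa; rewrite -(IH l _ (upd s x a) ul (BXa a oa)).
  have xa : upd s x a x = a by rewrite /upd eqxx.
  split; apply: WLS_at => // s' _ ss'; by rewrite mapE ss' // xa.
have dW : def1 (fun a => WL l (fun s' => X (map_tuple s' [tuple of x :: l])) (upd s x a)).
  apply: (dfn_def1 (P := fun s Y a => WL l _ (upd s x a)) s (gbc_subsort hG (pt MA))).
  apply: dfn_upd; apply: dfn_WL.
  have := dfn_coded hG (F := fun j s => s (tnth [tuple of x :: l] j)) cX (fun j => dterm_var hG _).
  apply: dfn_iff => s' Y; suff -> : [tuple s' (tnth [tuple of x :: l] j) | j < n.+1] = map_tuple s' [tuple of x :: l] by [].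
  by apply: tuple_eq => j; rewrite tnth_mktuple tnth_map.
have setE : [set a | Ord M a /\ Upow MA U n (slice X a)] =
    [set a | Ord M a /\ WL l (fun s' => X (map_tuple s' [tuple of x :: l])) (upd s x a)].
  by rewrite predeqE => a; split=> -[oa h]; split=> //; apply/key.
have BS : BB [set a | Ord M a /\ Upow MA U n (slice X a)].
  by rewrite setE; split=> [a []//|]; apply: class_of_def1 => //; def_tac.
split=> [h|[_]].
  split=> //; apply/(Uq_BB hU BS); apply: UqS (Uq_and hU (Uq_ord hU) h) => a [oa h'].
  by split=> //; apply/key.
by move/(Uq_BB hU BS); apply: UqS => a [oa h]; apply/key.
Qed.

Lemma dfn_supp P : dfn (fun s (_ : set M) => P s) -> exists l, supp [in l] P.
Proof.
by move=> /dfn_support[l lP]; exists l => s s' ss; rewrite (lP s s' set0).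
Qed.

Lemma dterm_fsupp (f : (V -> M) -> M) : dterm f -> exists l, fsupp [in l] f.
Proof.
move=> /dfn_support[l lP]; exists (pmap id l) => s s' ss.
have := lP (ocons (f s) s) (ocons (f s) s') set0.
case=> [[v|] vl //=|h _]; last exact: h.
by apply: ss; rewrite mem_pmap; apply/mapP; exists (Some v).
Qed.

End Lists.

Section Order.
Context {d : Order.disp_t} {L : orderType d}.
Implicit Types (l : seq L) (P Q : (L -> M) -> Prop) (s : L -> M).

Definition sortl l := sort <=%O (undup l).

Lemma sortl_sorted l : sorted <%O (sortl l).
Proof.
by rewrite lt_sorted_uniq_le sort_uniq undup_uniq /=; apply: sort_sorted; exact: le_total.
Qed.

Lemma mem_sortl l : sortl l =i l.
Proof. by move=> x; rewrite mem_sort mem_undup. Qed.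

Lemma filter_sortl l l' : sorted <%O l -> {subset l <= l'} ->
  filter [in l] (sortl l') = l.
Proof.
move=> sl ll'; apply: lt_sorted_eq => //.
  by apply: sorted_filter; [exact: lt_trans|exact: sortl_sorted].
move=> x; rewrite mem_filter mem_sortl; apply/andP/idP => [[]//|xl].
by split=> //; exact: ll'.
Qed.

(** The ultrafilter along [L].  By [QUE] the list may be replaced by any other
    increasing list on which the predicate depends. *)
Definition QU P := exists l, [/\ sorted <%O l, supp [in l] P & forall s, WL l P s].

Lemma WL_closed l P s s' : supp [in l] P -> WL l P s -> WL l P s'.
Proof. by move=> sP; apply: (WL_supp (l := l) sP) => v; rewrite inE => /andP[-> ]. Qed.

(** Independence of the list chosen, through the union of two lists and
    [WL_filter]. *)
Lemma QUE l P s : sorted <%O l -> supp [in l] P -> QU P <-> WL l P s.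
Proof.
move=> sl sP; split=> [[l' [sl' sP' W']]|W]; last first.
  by exists l; split=> // s'; exact: WL_closed W.
have e1 := WL_filter (sortl (l ++ l')) s sP; have e2 := WL_filter (sortl (l ++ l')) s sP'.
rewrite filter_sortl // in e1; last by move=> x; rewrite mem_cat => ->.
rewrite filter_sortl // in e2; last by move=> x; rewrite mem_cat orbC => ->.
by apply/e1/e2.
Qed.

Lemma sorted_uniq_lt l : sorted <%O l -> uniq l.
Proof. by rewrite lt_sorted_uniq_le => /andP[]. Qed.

Lemma QU_ext P Q : dfn (fun s (_ : set M) => Q s) -> QU P ->
  exists l, [/\ sorted <%O l, supp [in l] P, supp [in l] Q & forall s, WL l P s].
Proof.
move=> /dfn_supp[lq sQ] qP; have [lp [slp sP W]] := qP.
have sP' : supp [in sortl (lp ++ lq)] P.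
  by apply: supp_sub sP => v vl; rewrite mem_sortl mem_cat vl.
exists (sortl (lp ++ lq)); split=> //; first exact: sortl_sorted.
  by apply: supp_sub sQ => v vl; rewrite mem_sortl mem_cat vl orbT.
by move=> s; apply/QUE => //; exact: sortl_sorted.
Qed.

Lemma QUS P Q : dfn (fun s (_ : set M) => Q s) -> (forall s, P s -> Q s) -> QU P -> QU Q.
Proof.
move=> dQ PQ /(QU_ext dQ)[l [sl sP sQ W]]; exists l; split=> // s.
exact: WLS (W s).
Qed.

Lemma QU_and P Q : QU P -> QU Q -> QU (fun s => P s /\ Q s).
Proof.
move=> qP qQ; have [lp [slp sP W]] := qP; have [lq [slq sQ W']] := qQ.
have sP' : supp [in sortl (lp ++ lq)] P.
  by apply: supp_sub sP => v vl; rewrite mem_sortl mem_cat vl.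
have sQ' : supp [in sortl (lp ++ lq)] Q.
  by apply: supp_sub sQ => v vl; rewrite mem_sortl mem_cat vl orbT.
have sl := sortl_sorted (lp ++ lq).
exists (sortl (lp ++ lq)); split=> // [s s' ss [Ps Qs]|s].
  by split; [exact: sP' Ps|exact: sQ' Qs].
by apply: WL_and; apply/QUE.
Qed.

Lemma QU_const (P : Prop) : QU (fun=> P) <-> P.
Proof. by rewrite (@QUE [::] _ (fun=> pt MA)). Qed.

Lemma QU_ultra P : dfn (fun s (_ : set M) => P s) -> QU P \/ QU (fun s => ~ P s).
Proof.
move=> dP; have [l0 sP0] := dfn_supp dP.
have sl := sortl_sorted l0; have sP : supp [in sortl l0] P.
  by apply: supp_sub sP0 => v; rewrite mem_sortl.
have sN : supp [in sortl l0] (fun s => ~ P s).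
  by move=> s s' ss nP Ps'; apply: nP; apply: sP Ps' => v /ss.
by case: (WL_ultra (sortl l0) (fun=> pt MA) dP) => h; [left|right]; apply/(QUE (fun=> pt MA) sl).
Qed.

Lemma QU_not P : dfn (fun s (_ : set M) => P s) -> QU (fun s => ~ P s) <-> ~ QU P.
Proof.
move=> dP; split=> [h h'|h]; last by case: (QU_ultra dP).
by apply/QU_const; apply: QUS (QU_and h h') => [|s []//]; exact: dfn_bot.
Qed.

Lemma QU_ex P : QU P -> exists s, P s.
Proof.
move=> qP; apply: contrapT => N; apply/QU_const.
by apply: QUS qP => [|s Ps]; [exact: dfn_bot|apply: N; exists s].
Qed.

Lemma QU_all P : dfn (fun s (_ : set M) => P s) ->
  (forall s, P s) -> QU P.
Proof.
move=> dP H; apply: (QUS (P := fun=> True)) => //; exact/QU_const.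
Qed.

Lemma QU_var_ord x : QU (fun s => Ord M (s x)).
Proof.
apply/(@QUE [:: x] _ (fun=> pt MA)) => //.
  by move=> s s' ss; rewrite ss // inE.
apply: WL_all => // s' so _; apply: so; exact: mem_head.
Qed.

Lemma QU_var_lt x y : (x < y)%O -> QU (fun s => isin (s x) (s y)).
Proof.
move=> xy; apply/(@QUE [:: x; y] _ (fun=> pt MA)); first by rewrite /= xy.
  by move=> s s' ss; rewrite !ss // !inE eqxx ?orbT.
apply: (Uq_all hU) => a oa; apply: UqS (Uq_tail hG hU oa) => b [ob ab] /=.
by rewrite /upd eqxx (lt_eqF xy) eqxx.
Qed.

Lemma QU_Upow n (l : n.-tuple L) (X : set (n.-tuple M)) : sorted <%O l ->
  @BBn MA n X -> QU (fun s => X (map_tuple s l)) <-> Upow MA U n X.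
Proof.
move=> sl BX; rewrite -(WL_Upow (fun=> pt MA) (sorted_uniq_lt sl) BX); apply: QUE => //.
move=> s s' ss; suff -> : map_tuple s l = map_tuple s' l by [].
by apply: val_inj; apply/eq_in_map => v vl; exact: ss.
Qed.

End Order.

(** Renaming the variables along an embedding keeps their order, so the same
    quantifiers are taken.  All functoriality rests on this. *)
Lemma QU_embed d (K : orderType d) d' (L : orderType d') (i : K -> L)
    (P : (K -> M) -> Prop) : order_embedding i -> dfn (fun s (_ : set M) => P s) ->
  QU (fun s : L -> M => P (fun k => s (i k))) <-> QU P.
Proof.
move=> hi dP; have [l0 sP0] := dfn_supp dP.
have sl := sortl_sorted l0; have sP : supp [in sortl l0] P.
  by apply: supp_sub sP0 => v; rewrite mem_sortl.
have ii : injective i by exact: inc_inj.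
have iE (l : seq K) s : WL [seq i k | k <- l] (fun s : L -> M => P (fun k => s (i k))) s <->
    WL l P (fun k => s (i k)).
  elim: l s => [//|x l IH] s /=; split; apply: UqS => a; rewrite IH.
    by congr WL; apply/funext => k; rewrite /upd (inj_eq ii).
  by congr WL; apply/funext => k; rewrite /upd (inj_eq ii).
rewrite (QUE (fun=> pt MA) sl sP) -(iE _ (fun=> pt MA)); apply: QUE.
  rewrite sorted_map; apply: sub_sorted sl => x y /=.
  by rewrite (leW_mono hi).
move=> s s' ss; apply: sP => v vl; apply: ss; exact: map_f.
Qed.

End Quantifier.

(** * Substitution in first-order formulas *)

Section Substitution.
Variable S : signature.

Fixpoint tsubst n m (sg : 'I_n -> term S m) (t : term S n) : term S m :=
  match t with
  | Var i => sg i
  | App k f ts => App f (fun i => tsubst sg (ts i))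
  end.

Definition sg_lift n m (sg : 'I_n -> term S m) (j : 'I_n.+1) : term S m.+1 :=
  if unlift ord0 j is Some k then tsubst (fun i => Var S (lift ord0 i)) (sg k)
  else Var S ord0.

Fixpoint fsubst n m (sg : 'I_n -> term S m) (phi : formula S n) : formula S m :=
  match phi with
  | Bot => Bot S m
  | Eq t u => Eq (tsubst sg t) (tsubst sg u)
  | Rel k r ts => Rel r (fun i => tsubst sg (ts i))
  | Imp phi psi => Imp (fsubst sg phi) (fsubst sg psi)
  | All phi => All (fsubst (sg_lift sg) phi)
  end.

Variable N : structure S.

Lemma eval_subst n m (sg : 'I_n -> term S m) (t : term S n) (e : m.-tuple N) :
  eval e (tsubst sg t) = eval [tuple eval e (sg j) | j < n] t.
Proof.
elim: t => [i|k f ts IH] /=; first by rewrite tnth_mktuple.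
by congr fint; apply: tuple_eq => j; rewrite !tnth_mktuple.
Qed.

Lemma sat_subst n m (sg : 'I_n -> term S m) (phi : formula S n) (e : m.-tuple N) :
  sat e (fsubst sg phi) <-> sat [tuple eval e (sg j) | j < n] phi.
Proof.
elim: phi m sg e => {n} [n|n t u|n k r ts|n phi IH1 psi IH2|n phi IH] m sg e /=.
- by [].
- by rewrite !eval_subst.
- rewrite (_ : [tuple _ | i < k] = [tuple eval [tuple eval e (sg j) | j < n] (ts i) | i < k]) //.
  by apply: tuple_eq => j; rewrite !tnth_mktuple eval_subst.
- by have e1 := IH1 _ sg e; have e2 := IH2 _ sg e; tauto.
- suff H x : sat (tcons x e) (fsubst (sg_lift sg) phi) <-> sat (tcons x [tuple eval e (sg j) | j < n]) phi.
    by split=> h x; apply/H.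
  rewrite IH (_ : [tuple _ | j < n.+1] = tcons x [tuple eval e (sg j) | j < n]) //.
  apply: tuple_eq => j; rewrite tnth_mktuple /sg_lift; case: unliftP => [k|] -> //=.
  rewrite tnth_tconsS tnth_mktuple eval_subst; congr eval.
  by apply: tuple_eq => i; rewrite tnth_mktuple /= tnth_tconsS.
Qed.

End Substitution.

(** * Eliminating new constants from formulas *)

Section Constants.
Variables (S : signature) (C : eqType).
Local Notation SC := (with_consts S C).

(** A formula with new constants is evaluated as a formula over the old signature
    whose last variables take the values of the constants. *)
Definition extend n m (l : m.-tuple C) (N : structure SC) (e : n.-tuple N) :
    (n + m).-tuple (reduct N) := [tuple of e ++ map_tuple (@new_const S C N) l].

Lemma extend_tcons n m (l : m.-tuple C) (N : structure SC) (x : N) (e : n.-tuple N) :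
  extend l (tcons x e) = tcons (x : reduct N) (extend l e).
Proof. exact/val_inj. Qed.

Lemma uninst_term n (t : term SC n) : exists l0 : seq C,
  forall m (l : m.-tuple C), {subset l0 <= l} -> exists t' : term S (n + m),
  forall (N : structure SC) (e : n.-tuple N), eval e t = eval (extend l e) t'.
Proof.
elim: t => [i|k f ts /choice[l0 IH]].
  exists [::] => m l _; exists (Var S (lshift m i)) => N e /=.
  by rewrite tnth_lshift.
exists ((if f is NewC c then [:: c] else [::]) ++ flatten [seq l0 i | i <- enum 'I_k]) => m l sl.
have /choice[ts' tsE] (i : 'I_k) : exists t' : term S (n + m),
    forall (N : structure SC) (e : n.-tuple N), eval e (ts i) = eval (extend l e) t'.
  apply: IH => c ci; apply: sl; rewrite mem_cat; apply/orP; right.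
  by apply/flatten_mapP; exists i => //; rewrite mem_enum.
have {}sl : {subset (if f is NewC c then [:: c] else [::]) <= l}.
  by move=> c cf; apply: sl; rewrite mem_cat cf.
case: f ts ts' tsE sl {l0 IH} => [k' f|c] ts ts' tsE sl.
  exists (App f ts') => N e /=; congr fint.
  by apply: tuple_eq => j; rewrite !tnth_mktuple tsE.
have cl : c \in l by apply: sl; rewrite mem_head.
have/tnthP[j cE] := cl.
exists (Var S (rshift n j)) => N e /=.
rewrite tnth_rshift tnth_map -cE /new_const; congr fint.
by apply: tuple_eq => -[].
Qed.

(** Every sufficiently large list of constants works, so that the lists
    of the two sides of an implication can be merged. *)
Lemma uninst_formula n (phi : formula SC n) : exists l0 : seq C,
  forall m (l : m.-tuple C), {subset l0 <= l} -> exists phi' : formula S (n + m),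
  forall (N : structure SC) (e : n.-tuple N), sat e phi <-> sat (extend l e) phi'.
Proof.
elim: phi => {n} [n|n t u|n k r ts|n phi [l1 IH1] psi [l2 IH2]|n phi [l0 IH]].
- by exists [::] => m l _; exists (Bot S _).
- have [l1 H1] := uninst_term t; have [l2 H2] := uninst_term u.
  exists (l1 ++ l2) => m l sl.
  have [|t' tE] := H1 m l; first by move=> c cl; apply: sl; rewrite mem_cat cl.
  have [|u' uE] := H2 m l; first by move=> c cl; apply: sl; rewrite mem_cat cl orbT.
  by exists (Eq t' u') => N e /=; rewrite tE uE.
- have /choice[l0 IH] i := uninst_term (ts i).
  exists (flatten [seq l0 i | i <- enum 'I_k]) => m l sl.
  have /choice[ts' tsE] (i : 'I_k) : exists t' : term S (n + m),
      forall (N : structure SC) (e : n.-tuple N), eval e (ts i) = eval (extend l e) t'.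
    apply: IH => c ci; apply: sl.
    by apply/flatten_mapP; exists i => //; rewrite mem_enum.
  exists (Rel (r : rsym S k) ts') => N e /=.
  rewrite (_ : [tuple eval e (ts i) | i < k] = [tuple eval (extend l e) (ts' i) | i < k]) //.
  by apply: tuple_eq => j; rewrite !tnth_mktuple tsE.
- exists (l1 ++ l2) => m l sl.
  have [|p1 E1] := IH1 m l; first by move=> c cl; apply: sl; rewrite mem_cat cl.
  have [|p2 E2] := IH2 m l; first by move=> c cl; apply: sl; rewrite mem_cat cl orbT.
  by exists (Imp p1 p2) => N e /=; rewrite E1 E2.
- exists l0 => m l sl; have [p E] := IH m l sl.
  exists (All (p : formula S (n + m).+1)) => N e /=.
  have E' x : sat (tcons x e) phi <-> @sat S (reduct N) _ (tcons (x : reduct N) (extend l e)) p.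
    by rewrite E extend_tcons.
  by split=> h x; apply/E'.
Qed.

Lemma sat_inst_under n (l : n.-tuple C) (N : structure SC) :
  forall m (phi : formula S (m + n)) (e : m.-tuple N),
  sat e (inst_formula_under l phi) <-> sat (extend l e) phi.
Proof.
have tE m (t : term S (m + n)) (e : m.-tuple N) : eval e (inst_term l t) = eval (extend l e) t.
  elim: t => [i|k f ts IH] /=.
    rewrite -{2}(splitK i); case: (fintype.split i) => j /=.
      by rewrite tnth_lshift.
    rewrite tnth_rshift tnth_map /new_const; congr fint.
    by apply: tuple_eq => -[].
  by congr fint; apply: tuple_eq => j; rewrite !tnth_mktuple IH.
fix IH 2 => m [|t u|k r ts|phi psi|phi] e /=.
- by [].
- by rewrite !tE.
- rewrite (_ : [tuple _ | i < k] = [tuple eval (extend l e) (ts i) | i < k]) //.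
  by apply: tuple_eq => j; rewrite !tnth_mktuple tE.
- by have e1 := IH m phi e; have e2 := IH m psi e; tauto.
- have E' x : sat (tcons x e) (@inst_formula_under _ _ _ l m.+1 phi) <-> @sat S (reduct N) _ (tcons (x : reduct N) (extend l e)) phi.
    by rewrite -extend_tcons; exact: (IH m.+1 phi (tcons x e)).
  by split=> h x; apply/E'; exact: h.
Qed.

Lemma sat_inst n (l : n.-tuple C) (N : structure SC) (phi : formula S n) :
  @sat _ N 0 [tuple] (inst_formula l phi) <-> @sat S (reduct N) n (map_tuple (@new_const S C N) l) phi.
Proof.
rewrite /inst_formula (@sat_inst_under n l N 0 phi [tuple]).
by rewrite (_ : @extend 0 n l N [tuple] = map_tuple (@new_const S C N) l) //; exact/val_inj.
Qed.

End Constants.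

(** * The limit ultrapower along a linear order *)

Section Model.
Variable MA : class_structure.
Local Notation M := (set_part MA).
Local Notation A := (@classes MA).
Variable U : set (set MA).
Hypotheses (hG : GBC MA) (hwc : Ord_weakly_compact MA)
  (hU : generic_ultrafilter MA U).
Local Notation exp := (expansion MA).

Section OneOrder.
Context {d : Order.disp_t} {L : orderType d}.
Local Notation QU := (@QU MA U d L).
Local Notation fn := ((L -> M) -> M).

Lemma dfn_eqf (f g : fn) : dterm f -> dterm g -> dfn (fun s (_ : set M) => f s = g s).
Proof. by move=> df dg; apply: (dfn2 (R := eq)) => //; exact: def2_eq. Qed.

Definition eqv (f g : fn) := QU (fun s => f s = g s).

Lemma eqv_sym f g : eqv f g -> eqv g f.
Proof.
by move=> [l [sl sP W]]; exists l; split=> // [s s' ss /esym/(sP _ _ ss)//|s]; exact: WLS (W s).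
Qed.

Lemma eqv_trans f g h : dterm f -> dterm h -> eqv f g -> eqv g h -> eqv f h.
Proof.
move=> df dh fg gh; apply: QUS (QU_and hG hU fg gh) => //; first exact: dfn_eqf.
by move=> s [-> ->].
Qed.

Lemma eqv_refl f : dterm f -> eqv f f.
Proof. by move=> df; apply: QU_all => //; exact: dfn_eqf. Qed.

(** Elements are classes of definable functions.  Arbitrary functions
    are normalized to a definable one, and a class is represented by
    a member chosen by [epsilon], which makes equality of elements Leibniz equality
    without a quotient construction. *)
Definition norm (f : fn) : fn := if pselect (dterm f) then f else fun=> pt MA.

Lemma dterm_norm f : dterm (norm f).
Proof. by rewrite /norm; case: pselect => [df|nf]; [exact: df|exact: dterm_const]. Qed.

Lemma norm_id f : dterm f -> norm f = f.
Proof. by move=> df; rewrite /norm; case: pselect. Qed.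

Definition cl (f : fn) : fn :=
  epsilon (inhabits f) (fun g => dterm g /\ eqv (norm f) g).

Lemma clP f : dterm (cl f) /\ eqv (norm f) (cl f).
Proof.
apply: (epsilon_spec (inhabits f) (fun g => dterm g /\ eqv (norm f) g)).
by exists (norm f); split; [|apply: eqv_refl]; exact: dterm_norm.
Qed.

Lemma cl_eq f g : dterm f -> dterm g -> eqv f g -> cl f = cl g.
Proof.
move=> df dg fg; rewrite /cl !norm_id //.
have -> : inhabits f = inhabits g by exact: Prop_irrelevance.
congr epsilon; apply/funext => h; apply/propext; split=> -[dh ?]; split=> //.
  by apply: eqv_trans (eqv_sym fg) _.
exact: eqv_trans fg _.
Qed.

Definition carrier := {f : fn | exists g, f = cl g}.
Definition q (f : fn) : carrier := exist _ (cl f) (ex_intro _ f erefl).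
Definition rep (x : carrier) : fn := sval x.

Lemma dterm_rep x : dterm (rep x).
Proof. by case: x => f [g fg]; rewrite /rep /= fg; case: (clP g). Qed.

Lemma q_eq f g : dterm f -> dterm g -> q f = q g <-> eqv f g.
Proof.
move=> df dg; split=> [/(congr1 rep) /= e|fg].
  have [d1 e1] := clP f; have [d2 e2] := clP g; rewrite !norm_id // in e1 e2.
  by apply: eqv_trans e1 _ => //; rewrite e; exact: eqv_sym.
have e := cl_eq df dg fg; rewrite /q.
by apply: eq_exist => //.
Qed.

Lemma eqv_rep f : dterm f -> eqv (rep (q f)) f.
Proof. by move=> df; apply: eqv_sym; have [_] := clP f; rewrite norm_id. Qed.

Lemma q_rep x : q (rep x) = x.
Proof.
case: x => f [g fg]; apply: eq_exist; rewrite /rep /= {f}fg.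
have [dg eg] := clP g.
rewrite -[LHS](cl_eq (f := norm g)) //; last exact: dterm_norm.
  rewrite /cl; have -> : inhabits (norm g) = inhabits g by exact: Prop_irrelevance.
  by rewrite (norm_id (dterm_norm g)).
Qed.

Definition lim_fint k (f : const_fsym (L0A MA) L k) : k.-tuple carrier -> carrier :=
  match f in const_fsym _ _ k return k.-tuple carrier -> carrier with
  | OldF k f => fun t => q (fun s => fintA f [tuple rep (tnth t j) s | j < k])
  | NewC l => fun _ => q (fun s => s l)
  end.

Definition lim_rint k (r : rsymA MA k) : set (k.-tuple carrier) :=
  [set t | QU (fun s => rintA r [tuple rep (tnth t j) s | j < k])].

Definition limit_power : structure (with_consts (L0A MA) L) :=
  @Structure (with_consts (L0A MA) L) carrier (inhabits (q (fun=> pt MA))) lim_fint lim_rint.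

Lemma QU_all_ord k (P : 'I_k -> (L -> M) -> Prop) :
  (forall j, QU (P j)) -> QU (fun s => forall j, P j s).
Proof.
elim: k P => [|k IH] P qP.
  have [l [sl sP W]] : QU (fun=> True) by apply/QU_const.
  by exists l; split=> [//|s s' _ _ []//|s]; apply: WLS (W s) => s' _ [].
have [l [sl sP W]] := QU_and hG hU (qP ord0) (IH (fun j => P (lift ord0 j)) (fun j => qP _)).
have E s : (P ord0 s /\ forall j, P (lift ord0 j) s) <-> forall j, P j s.
  split=> [[h0 h] j|h]; last by split.
  by case: (unliftP ord0 j) => [m|] ->.
exists l; split=> // [s s' ss /E h|s]; first by apply/E; exact: sP ss h.
by apply: WLS (W s) => s' /E.
Qed.

Lemma rep_q_tuple k (F : 'I_k -> fn) : (forall j, dterm (F j)) ->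
  QU (fun s => [tuple rep (tnth [tuple q (F j) | j < k] j) s | j < k] = [tuple F j s | j < k]).
Proof.
move=> dF; have : QU (fun s => forall j, rep (q (F j)) s = F j s).
  by apply: QU_all_ord => j; exact: eqv_rep.
have E s : (forall j, rep (q (F j)) s = F j s) <->
    [tuple rep (tnth [tuple q (F j) | j < k] j) s | j < k] = [tuple F j s | j < k].
  split=> [h|/(congr1 (fun t => tnth t _)) h j].
    by apply: tuple_eq => j; rewrite !tnth_mktuple h.
  by have := h j; rewrite !tnth_mktuple.
move=> [l [sl sP W]]; exists l; split=> // [s s' ss /E h|s]; first by apply/E; exact: sP ss h.
by apply: WLS (W s) => s' /E.
Qed.

Lemma coded_fintA k (f : fsymA MA k) (F : 'I_k -> fn) : (forall j, dterm (F j)) ->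
  dterm (fun s => fintA f [tuple F j s | j < k]).
Proof.
case: f F => [x|k' f cf] F dF /=; first exact: dterm_const.
exact: dterm_coded.
Qed.

Lemma coded_rintA k (r : rsymA MA k) (F : 'I_k -> fn) : (forall j, dterm (F j)) ->
  dfn (fun s (_ : set M) => rintA r [tuple F j s | j < k]).
Proof.
case: r F => [|k' R cR] F dF /=; last exact: dfn_coded.
apply: (dfn_iff (P := fun s _ => isin (F ord0 s) (F ord_max s))) => [s Y|].
  by rewrite /= !tnth_mktuple.
by apply: dfn2 => //; exact: def2_in.
Qed.

Lemma lim_fintE k (f : fsymA MA k) (F : 'I_k -> fn) : (forall j, dterm (F j)) ->
  @fint _ (reduct limit_power) k f [tuple q (F j) | j < k] =
  q (fun s => fintA f [tuple F j s | j < k]).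
Proof.
move=> dF; apply/q_eq.
- by apply: coded_fintA => j; exact: dterm_rep.
- exact: coded_fintA.
apply: QUS (rep_q_tuple dF) => //; last by move=> s ->.
by apply: dfn_eqf; apply: coded_fintA => // j; exact: dterm_rep.
Qed.

Lemma lim_eval n (t : term (L0A MA) n) (F : 'I_n -> fn) : (forall j, dterm (F j)) ->
  @eval _ (reduct limit_power) n [tuple q (F j) | j < n] t =
  q (fun s => @eval _ exp n [tuple F j s | j < n] t).
Proof.
move=> dF; elim: t => [i|k f ts IH].
  by rewrite /= tnth_mktuple; congr q; apply/funext => s; rewrite tnth_mktuple.
rewrite -[RHS](lim_fintE f (F := fun j s => @eval _ exp n [tuple F j s | j < n] (ts j))); last first.
  by move=> j; exact: dterm_eval_comp.
rewrite -(_ : [tuple @eval _ (reduct limit_power) n [tuple q (F j) | j < n] (ts j) | j < k] =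
  [tuple q (fun s => @eval _ exp n [tuple F j s | j < n] (ts j0)) | j0 < k]) //.
by apply: tuple_eq => j; rewrite !tnth_mktuple IH.
Qed.

Lemma tcons_mktuple T n (x : T) (F : 'I_n -> T) :
  tcons x [tuple F j | j < n] = [tuple if unlift ord0 j is Some k then F k else x | j < n.+1].
Proof.
apply: tuple_eq => j; rewrite tnth_mktuple; case: unliftP => [k|] -> //.
by rewrite tnth_tconsS tnth_mktuple.
Qed.

Lemma QU_iff P Q : dfn (fun s (_ : set M) => P s) -> dfn (fun s (_ : set M) => Q s) ->
  QU (fun s => P s <-> Q s) -> QU P <-> QU Q.
Proof.
by move=> dP dQ PQ; split=> h; apply: QUS (QU_and hG hU PQ h) => // s [] [].
Qed.

(** By induction on formulas.  Negation works since [QU] is an ultrafilter on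
    definable predicates.  For a quantifier, if almost every instance had a
    counterexample, [select] would choose one definably, and this function would be
    an element of the limit power. *)
Theorem Los n (phi : formula (L0A MA) n) (F : 'I_n -> fn) : (forall j, dterm (F j)) ->
  @sat _ (reduct limit_power) n [tuple q (F j) | j < n] phi <->
  QU (fun s => @sat _ exp n [tuple F j s | j < n] phi).
Proof.
have deval m (t : term (L0A MA) m) (F' : 'I_m -> fn) : (forall j, dterm (F' j)) ->
    dterm (fun s => @eval _ exp m [tuple F' j s | j < m] t).
  exact: dterm_eval_comp.
elim: phi F => {n} [n|n t u|n k r ts|n phi IH1 psi IH2|n phi IH] F dF.
- by rewrite /= QU_const.
- by rewrite /= !lim_eval // q_eq //; exact: deval.
- rewrite /= -/(reduct limit_power).
  set F' := fun j s => @eval _ exp n [tuple F j s | j < n] (ts j).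
  have dF' j : dterm (F' j) by exact: deval.
  rewrite (_ : [tuple _ | i < k] = [tuple q (F' j) | j < k]); last first.
    by apply: tuple_eq => j; rewrite !tnth_mktuple lim_eval.
  have dr (G : 'I_k -> fn) : (forall j, dterm (G j)) -> dfn (fun s (_ : set M) => rintA r [tuple G j s | j < k]).
    exact: coded_rintA.
  apply: QU_iff; [by apply: dr => j; exact: dterm_rep|exact: dr|].
  apply: QUS (rep_q_tuple dF') => //; last by move=> s ->.
  by apply: dfn_iff2; apply: dr => // j; exact: dterm_rep.
- have d1 := dfn_sat_comp hG phi dF; have d2 := dfn_sat_comp hG psi dF.
  rewrite /= IH1 // IH2 //; split=> [h|h h1].
    case: (QU_ultra hG hwc hU d1) => h1.
      by apply: QUS (h h1) => //; exact: dfn_imp.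
    by apply: QUS h1 => //; exact: dfn_imp.
  by apply: QUS (QU_and hG hU h h1) => // s [] h2; exact: h2.
- have dA := dfn_sat_comp hG (All phi) dF.
  have E (g : fn) s : tcons (g s) [tuple F j s | j < n] =
      [tuple (if unlift ord0 j is Some k then F k else g) s | j < n.+1].
    rewrite tcons_mktuple; apply: tuple_eq => j; rewrite !tnth_mktuple.
    by case: unlift.
  have dF1 g : dterm g -> forall j : 'I_n.+1, dterm (if unlift ord0 j is Some k then F k else g).
    by move=> dg j; case: unlift.
  have E' (g : fn) : dterm g -> @sat _ (reduct limit_power) n.+1 (tcons (q g : reduct limit_power) [tuple q (F j) | j < n]) phi <->
      QU (fun s => @sat _ exp n.+1 (tcons (g s) [tuple F j s | j < n]) phi).
    move=> dg; rewrite tcons_mktuple.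
    have := IH _ (dF1 g dg).
    rewrite (_ : [tuple _ | j < n.+1] = [tuple if unlift ord0 j is Some k then q (F k) else q g | j < n.+1]); last first.
      by apply: tuple_eq => j; rewrite !tnth_mktuple; case: unlift.
    move=> ->; rewrite (_ : (fun s => sat _ phi) = (fun s => @sat _ exp n.+1 (tcons (g s) [tuple F j s | j < n]) phi)) //.
    by apply/funext => s; rewrite E.
  have dP g : dterm g -> dfn (fun s (_ : set M) => @sat _ exp n.+1 (tcons (g s) [tuple F j s | j < n]) phi).
    move=> dg; apply: dfn_iff (dfn_sat_comp hG phi (dF1 g dg)) => s Y; by rewrite E.
  split=> [h|h x]; last first.
    rewrite -(q_rep x); apply/E'; first exact: dterm_rep.
    by apply: QUS h => //; exact: (dP _ (dterm_rep _)).
  apply: contrapT => /(QU_not hG hwc hU dA) nh.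
  pose Q s x := ~ @sat _ exp n.+1 (tcons x [tuple F j s | j < n]) phi.
  pose g s := select hG hwc (Q s).
  have dQ : dfn (fun (s : option L -> M) (_ : set M) => Q (fun v => s (Some v)) (s None)).
    apply: dfn_not.
    have dF2 (j : 'I_n.+1) : dterm (if unlift ord0 j is Some k then fun s : option L -> M => F k (fun v => s (Some v)) else fun s => s None).
      by case: unlift => [k|]; [exact: dterm_wk|exact: dterm_var].
    apply: dfn_iff (dfn_sat_comp hG phi dF2) => s Y.
    rewrite tcons_mktuple (_ : [tuple _ | j < n.+1] = [tuple if unlift ord0 j is Some k then F k (fun v => s (Some v)) else s None | j < n.+1]) //.
    by apply: tuple_eq => j; rewrite !tnth_mktuple; case: unlift.
  have dg : dterm g by exact: dterm_select.
  have /(E' g dg) hg := h (q g).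
  have [s [ns Ps]] := QU_ex hG hU (QU_and hG hU nh hg).
  apply: ns => x; apply: contrapT => nx.
  suff : Q s (g s) by [].
  apply: select_spec; last by exists x.
  exact: (dfn_def1 (P := fun s _ x => Q s x) s (gbc_subsort hG (pt MA)) dQ).
Qed.

End OneOrder.
End Model.

(** * The prime model *)

Section Prime.
Variable MA : class_structure.
Local Notation M := (set_part MA).
Local Notation A := (@classes MA).
Variable U : set (set MA).
Hypotheses (hG : GBC MA) (hwc : Ord_weakly_compact MA)
  (hU : generic_ultrafilter MA U).
Local Notation exp := (expansion MA).
Local Notation S := (L0A MA).

Lemma map_tupleE T T' n (s : T -> T') (l : n.-tuple T) :
  map_tuple s l = [tuple s (tnth l j) | j < n].
Proof. by apply: tuple_eq => j; rewrite tnth_mktuple tnth_map. Qed.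

Lemma BBn_truth n (phi : formula S n) : BBn (@truth_set MA n phi).
Proof.
split=> [t []//|]; apply/(coded_relP hG).
apply: (dfn_iff (P := fun s _ => (forall j, Ord M (s j)) /\ @sat _ exp n [tuple s j | j < n] phi)).
  move=> s Y; rewrite /truth_set /= /Ord_tuples /=.
  by split=> -[so h]; split=> // j; have := so j; rewrite tnth_mktuple.
apply: dfn_and; last exact: dfn_sat.
apply: dfn_all_ord => j; apply: dfn1; [exact: def1_Ord|exact: dterm_var].
Qed.

Lemma dfn_sat_map V n (l : n.-tuple V) (phi : formula S n) :
  dfn (fun (s : V -> M) (_ : set M) => @sat _ exp n (map_tuple s l) phi).
Proof.
apply: dfn_iff (dfn_sat_comp hG phi (F := fun j s => s (tnth l j)) (fun j => dterm_var hG _)) => s Y.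
by rewrite map_tupleE.
Qed.

Section OneOrder.
Context {d : Order.disp_t} {L : orderType d}.
Local Notation QU := (@QU MA U d L).
Local Notation fn := ((L -> M) -> M).

Lemma QU_truth n (l : n.-tuple L) (phi : formula S n) : sorted <%O l ->
  QU (fun s => @sat _ exp n (map_tuple s l) phi) <-> Upow MA U n (truth_set phi).
Proof.
move=> sl; rewrite -(QU_Upow hG hwc hU sl (BBn_truth phi)).
have dT : dfn (fun s (_ : set M) => truth_set phi (map_tuple s l)).
  have [_ cT] := BBn_truth phi.
  apply: dfn_iff (dfn_coded hG (F := fun j s => s (tnth l j)) cT (fun j => dterm_var hG _)) => s Y.
  by rewrite map_tupleE.
split=> h; last by apply: QUS h => // [|s []//]; exact: dfn_sat_map.
have ho : QU (fun s => forall j, Ord M (s (tnth l j))).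
  by apply: QU_all_ord => // j; exact: QU_var_ord.
apply: QUS (QU_and hG hU ho h) => // s [so h']; split=> // j.
by rewrite tnth_map.
Qed.

(** The element [y] of [N] is f(c_l), where [f] is written as a coded
    function of finitely many increasing variables.  The relation is independent
    of the way of writing by [denotes_eq]. *)
Definition denotes (N : structure (with_consts S L)) (f : fn) (y : reduct N) : Prop :=
  exists n (l : n.-tuple L) (f0 : n.-tuple M -> M) (cf : coded_fun f0),
  [/\ sorted <%O l, forall s, f s = f0 (map_tuple s l) &
      y = @fint _ (reduct N) n (FunA cf) (map_tuple (@new_const S L N) l)].

Lemma rep_coded (f : fn) n (l : n.-tuple L) : dterm f -> fsupp [in l] f ->
  exists2 f0 : n.-tuple M -> M, coded_fun f0 & forall s, f s = f0 (map_tuple s l).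
Proof.
move=> df sf.
exists (fun t => f (fun x => nth (pt MA) t (index x l))).
  apply/(coded_funP hG).
  pose rho (x : option L) : option 'I_n + M := if x is Some x then
    (if insub (index x l) is Some j then inl (Some j) else inr (pt MA)) else inl None.
  apply: dfn_iff (dfn_subst rho df) => s Y /=.
  suff -> : (fun x => aval s (rho (Some x))) =
    (fun x => nth (pt MA) [tuple s (Some j) | j < n] (index x l)) by [].
  apply/funext => x; rewrite /rho /aval; case: insubP => [j jn jE|jn].
    have -> : index x l = nat_of_ord j by rewrite -jE.
    by rewrite -tnth_nth tnth_mktuple.
  by rewrite nth_default // size_tuple leqNgt.
move=> s; apply: sf => v vl.
by rewrite (nth_map v) ?index_mem // nth_index.
Qed.

Lemma dterm_of_rep (f : fn) n (l : n.-tuple L) (f0 : n.-tuple M -> M) : coded_fun f0 ->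
  (forall s, f s = f0 (map_tuple s l)) -> dterm f.
Proof.
move=> cf fE; rewrite (_ : f = fun s => f0 [tuple s (tnth l j) | j < n]).
  by apply: dterm_coded => // j; exact: dterm_var.
by apply/funext => s; rewrite fE map_tupleE.
Qed.

Section OneModel.
Variable N : structure (with_consts S L).
Hypothesis NT : models N (T_U U L).
Local Notation c := (@new_const S L N).

(** The theory decides all sentences about the constants, as the powers of [U] are
    ultrafilters. *)
Lemma model_complete n (l : n.-tuple L) (phi : formula S n) : sorted <%O l ->
  @sat _ (reduct N) n (map_tuple c l) phi <-> QU (fun s => @sat _ exp n (map_tuple s l) phi).
Proof.
move=> sl.
have mod psi : QU (fun s => @sat _ exp n (map_tuple s l) psi) -> @sat _ (reduct N) n (map_tuple c l) psi.
  move=> /(QU_truth _ sl) h; rewrite -sat_inst; apply: NT.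
  by exists n, l, psi.
split=> [h|]; last exact: mod.
have [//|h'] := QU_ultra hG hwc hU (dfn_sat_map l phi).
by have := mod (Imp phi (Bot _ _)) h' h.
Qed.

Lemma denotes_ex f : dterm f -> exists y, denotes (N := N) f y.
Proof.
move=> df; have [l0 sf] := dterm_fsupp df.
have sf' : fsupp [in in_tuple (sortl l0)] f.
  by move=> s s' ss; apply: sf => v vl; apply: ss; rewrite mem_sortl.
have [f0 cf fE] := rep_coded df sf'.
eexists; exists _, (in_tuple (sortl l0)), f0, cf; split=> //.
exact: sortl_sorted.
Qed.

(** Any larger list of variables can be used, since the theory contains
    the equation between the two ways of writing the element. *)
Lemma denotes_wide f y : denotes (N := N) f y -> exists l0 : seq L,
  forall m (l : m.-tuple L), sorted <%O l -> {subset l0 <= l} ->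
  exists (f0 : m.-tuple M -> M) (cf : coded_fun f0),
   (forall s, f s = f0 (map_tuple s l)) /\
   y = @fint _ (reduct N) m (FunA cf) (map_tuple c l).
Proof.
move=> [n [l1 [f1 [cf1 [sl1 fE yE]]]]]; exists l1 => m l sl l1l.
have /choice[ix ixE] (j : 'I_n) : exists k : 'I_m, tnth l1 j = tnth l k.
  have /tnthP[k kE] : tnth l1 j \in l by apply: l1l; exact: mem_tnth.
  by exists k.
pose f0 (t : m.-tuple M) := f1 [tuple tnth t (ix j) | j < n].
have cf : coded_fun f0.
  apply/(coded_funP hG).
  rewrite (_ : (fun s => _) = (fun s : 'I_m -> M => f1 [tuple s (ix j) | j < n])).
    by apply: dterm_coded => // j; exact: dterm_var.
  by apply/funext => s; congr f1; apply: tuple_eq => j; rewrite !tnth_mktuple.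
have mapE T (s : L -> T) : [tuple tnth (map_tuple s l) (ix j) | j < n] = map_tuple s l1.
  by apply: tuple_eq => j; rewrite tnth_mktuple !tnth_map ixE.
exists f0, cf; split=> [s|].
  by rewrite fE /f0 mapE.
pose psi : formula S m := Eq (@App S m n (FunA cf1) (fun j => Var S (ix j)))
  (@App S m m (FunA cf) (fun j => Var S j)).
have : @sat _ (reduct N) m (map_tuple c l) psi.
  apply/model_complete => //; apply: QU_all => //; first exact: dfn_sat_map.
  move=> s; change (f1 [tuple tnth (map_tuple s l) (ix j) | j < n] =
    f0 [tuple tnth (map_tuple s l) j | j < m]).
  by rewrite mktuple_tnth.
change (@fint _ (reduct N) n (FunA cf1) [tuple tnth (map_tuple c l) (ix j) | j < n] =
  @fint _ (reduct N) m (FunA cf) [tuple tnth (map_tuple c l) j | j < m] ->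
  y = @fint _ (reduct N) m (FunA cf) (map_tuple c l)).
by rewrite mktuple_tnth mapE -yE.
Qed.

(** Write all the elements with one list of variables, then substitute. *)
Lemma denotes_sat k (F : 'I_k -> fn) (y : 'I_k -> reduct N) (phi : formula S k) :
  (forall j, denotes (F j) (y j)) ->
  @sat _ (reduct N) k [tuple y j | j < k] phi <->
  QU (fun s => @sat _ exp k [tuple F j s | j < k] phi).
Proof.
move=> Fy; have /choice[l0 l0P] j := denotes_wide (Fy j).
pose l := sortl (flatten [seq l0 j | j <- enum 'I_k]).
have sl : sorted <%O (in_tuple l) by exact: sortl_sorted.
have /choice[f0 f0P] (j : 'I_k) : exists f0 : (size l).-tuple M -> M, exists (cf : coded_fun f0),
   (forall s, F j s = f0 (map_tuple s (in_tuple l))) /\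
   y j = @fint _ (reduct N) (size l) (FunA cf) (map_tuple c (in_tuple l)).
  apply: l0P => // x xl; rewrite mem_sortl; apply/flatten_mapP; exists j => //.
  by rewrite mem_enum.
have cf j : coded_fun (f0 j) by have [] := f0P j.
have fE j s : F j s = f0 j (map_tuple s (in_tuple l)) by have [? []] := f0P j.
have yE j : y j = @fint _ (reduct N) (size l) (FunA (cf j)) (map_tuple c (in_tuple l)).
  by have [cf' [_ ->]] := f0P j; rewrite (Prop_irrelevance cf' (cf j)).
pose psi := fsubst (fun j => @App S (size l) (size l) (FunA (cf j)) (fun i => Var S i)) phi.
have := model_complete psi sl; rewrite /psi sat_subst.
rewrite (_ : [tuple _ | j < k] = [tuple y j | j < k]); last first.
  apply: tuple_eq => j; rewrite !tnth_mktuple yE.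
  change (@fint _ (reduct N) (size l) (FunA (cf j)) [tuple tnth (map_tuple c (in_tuple l)) i | i < size l] =
    @fint _ (reduct N) (size l) (FunA (cf j)) (map_tuple c (in_tuple l))).
  by rewrite mktuple_tnth.
move=> ->; rewrite (_ : (fun s => _) = (fun s => @sat _ exp k [tuple F j s | j < k] phi)) //.
apply/funext => s; apply/propext; rewrite sat_subst.
rewrite (_ : [tuple _ | j < k] = [tuple F j s | j < k]) //.
apply: tuple_eq => j; rewrite !tnth_mktuple fE.
change (f0 j [tuple tnth (map_tuple s (in_tuple l)) i | i < size l] = f0 j (map_tuple s (in_tuple l))).
by rewrite mktuple_tnth.
Qed.

Lemma denotes_eq f g y z : denotes (N := N) f y -> denotes g z -> y = z <-> QU (fun s => f s = g s).
Proof.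
move=> fy gz.
have := @denotes_sat 2 (fun j => if j == ord0 then f else g) (fun j => if j == ord0 then y else z)
  (Eq (Var S ord0) (Var S ord_max)).
rewrite /= !tnth_mktuple /= => ->; last by move=> j; case: ifP.
rewrite (_ : (fun s => _) = (fun s => f s = g s)) //.
by apply/funext => s; rewrite !tnth_mktuple.
Qed.

Lemma denotes_const l : denotes (N := N) (fun s => s l) (c l).
Proof.
pose f0 (t : 1.-tuple M) := thead t.
have cf : coded_fun f0.
  apply/(coded_funP hG).
  rewrite (_ : (fun s => _) = (fun s : 'I_1 -> M => s ord0)); first exact: dterm_var.
  by apply/funext => s; rewrite /f0 /thead tnth_mktuple.
exists 1, [tuple l], f0, cf; split=> //.
pose psi : formula S 1 := Eq (Var S ord0) (@App S 1 1 (FunA cf) (fun j => Var S j)).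
have : @sat _ (reduct N) 1 (map_tuple c [tuple l]) psi.
  apply/model_complete => //; apply: QU_all => //; first exact: dfn_sat_map.
  move=> s; change (s l = f0 [tuple tnth (map_tuple s [tuple l]) j | j < 1]).
  by rewrite mktuple_tnth.
change (c l = @fint _ (reduct N) 1 (FunA cf) [tuple tnth (map_tuple c [tuple l]) j | j < 1] ->
  c l = @fint _ (reduct N) 1 (FunA cf) (map_tuple c [tuple l])).
by rewrite mktuple_tnth.
Qed.

End OneModel.

Local Notation G := (@limit_power MA U d L).

Lemma limit_models : models G (T_U U L).
Proof.
move=> _ [n [l [phi [sl Gphi ->]]]]; rewrite sat_inst.
rewrite map_tupleE (Los hG hwc hU phi (F := fun j s => s (tnth l j))).
  rewrite (_ : (fun s => _) = (fun s => @sat _ exp n (map_tuple s l) phi)).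
    exact/QU_truth.
  by apply/funext => s; rewrite map_tupleE.
by move=> j; exact: dterm_var.
Qed.

Lemma denotes_limit f y : denotes (N := G) f y -> y = q U f.
Proof.
move=> [n [l [f0 [cf [sl fE ->]]]]].
rewrite map_tupleE (lim_fintE hG hU (FunA cf) (F := fun j s => s (tnth l j))).
  by congr q; apply/funext => s; rewrite fE map_tupleE.
by move=> j; exact: dterm_var.
Qed.

(** Send the class of [f] to the element that [f] denotes in [N].  The new
    constants occurring in a formula are denoted by variables, so
    elementarity follows from [Los] on one side and [denotes_sat] on the other. *)
Lemma limit_prime : prime_model (T_U U L) G.
Proof.
split; first exact: limit_models.
move=> N NT.
have /choice[h hP] (x : G) : exists y : reduct N, denotes (rep x) y.
  by apply: denotes_ex; exact: dterm_rep.
exists h => n phi e.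
have [l0 H] := uninst_formula phi.
have [phi' E] := H _ (in_tuple l0) (fun _ => id).
rewrite !E.
pose F (j : 'I_(n + size l0)) : fn := match fintype.split j with
  | inl j => rep (tnth e j) | inr j => fun s => s (tnth (in_tuple l0) j) end.
have dF j : dterm (F j).
  by rewrite /F; case: (fintype.split j) => k; [exact: dterm_rep|exact: dterm_var].
have e1 : extend (in_tuple l0) e = [tuple q U (F j) | j < n + size l0].
  apply: tuple_eq => j; rewrite tnth_mktuple -(splitK j) /F unsplitK.
  case: (fintype.split j) => k /=; first by rewrite tnth_lshift q_rep.
  by rewrite tnth_rshift tnth_map.
have e2 : forall j, denotes (F j) (tnth (extend (in_tuple l0) (map_tuple h e)) j).
  move=> j; rewrite -{2}(splitK j) /F.
  case: (fintype.split j) => k /=; first by rewrite tnth_lshift tnth_map.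
  by rewrite tnth_rshift tnth_map; exact: denotes_const.
rewrite e1 Los // -(denotes_sat NT phi' e2) mktuple_tnth.
by [].
Qed.

Lemma gaifman_prime : prime_model (T_U U L) (gaifman_full U L).
Proof.
exact: (epsilon_spec (inhabits (trivial_structure _)) (prime_model (T_U U L)) (ex_intro _ _ limit_prime)).
Qed.

Local Notation GL := (gaifman_full U L).
Let GT : models GL (T_U U L). Proof. by have [] := gaifman_prime. Qed.

(** A prime model embeds in the limit power, in which every element is denoted; the
    embedding is elementary, hence injective and compatible with terms, so
    that [y] itself is the value of the term. *)
Lemma gaifman_rep (y : gaifman U L) : exists2 f, dterm f & denotes (N := GL) f y.
Proof.
have [_ /(_ G limit_models)[h hE]] := gaifman_prime.
have hinj (x z : GL) : h x = h z -> x = z.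
  move=> e; apply/(hE 2 (Eq (Var _ ord0) (Var _ ord_max)) [tuple x; z]).
  by rewrite /= !tnth_map.
pose f := rep (h y); have df : dterm f by exact: dterm_rep.
have [y' y'f] := denotes_ex GL df.
exists f => //; suff -> : y = y' by [].
apply: hinj; rewrite -(q_rep hG hU (h y)) -/f; symmetry; apply: denotes_limit.
have [n [l [f0 [cf [sl fE yE]]]]] := y'f.
exists n, l, f0, cf; split=> //.
pose psi : formula (with_consts S L) 1 := Eq (Var _ ord0)
  (@App (with_consts S L) 1 n (@OldF S L n (FunA cf : fsym S n))
    (fun j => @App (with_consts S L) 1 0 (NewC S (tnth l j)) (tnth [tuple]))).
have psiE (N : structure (with_consts S L)) (e : 1.-tuple N) : @sat _ N 1 e psi <->
    tnth e ord0 = @fint _ (reduct N) n (FunA cf) (map_tuple (@new_const S L N) l).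
  rewrite -(_ : [tuple @eval _ N 1 e (@App (with_consts S L) 1 0 (NewC S (tnth l j)) (tnth [tuple])) | j < n] =
    map_tuple (@new_const S L N) l) //.
  apply: tuple_eq => j; rewrite tnth_mktuple tnth_map /= /new_const; congr fint.
  by apply: tuple_eq => -[].
have := hE 1 psi [tuple y']; rewrite !psiE tnth_map => -[h1 _]; exact: h1.
Qed.

Definition gval (f : fn) : gaifman U L :=
  epsilon (univ_inh (gaifman U L)) (fun y => denotes (N := GL) f y).

Lemma gvalP f : dterm f -> denotes (N := GL) f (gval f).
Proof. by move=> df; apply: (epsilon_spec (univ_inh (gaifman U L))); exact: denotes_ex. Qed.

Lemma gval_denotes f y : denotes (N := GL) f y -> y = gval f.
Proof.
move=> fy; have df : dterm f.
  by have [n [l [f0 [cf [sl fE _]]]]] := fy; exact: dterm_of_rep fE.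
apply/(denotes_eq GT fy (gvalP df)); exact: eqv_refl.
Qed.

Lemma gval_surj (y : gaifman U L) : exists2 f, dterm f & y = gval f.
Proof. by have [f df fy] := gaifman_rep y; exists f => //; exact: gval_denotes. Qed.

Lemma gval_eq f g : dterm f -> dterm g -> gval f = gval g <-> QU (fun s => f s = g s).
Proof. by move=> df dg; exact: (denotes_eq GT (gvalP df) (gvalP dg)). Qed.

Lemma gval_sat k (F : 'I_k -> fn) (phi : formula S k) : (forall j, dterm (F j)) ->
  @sat _ (gaifman U L) k [tuple gval (F j) | j < k] phi <->
  QU (fun s => @sat _ exp k [tuple F j s | j < k] phi).
Proof. by move=> dF; apply: (denotes_sat GT) => j; exact: gvalP. Qed.

Lemma gval_const l : gaifman_const U l = gval (fun s => s l).
Proof. by apply: gval_denotes; exact: (denotes_const GT). Qed.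

Lemma gval_std x : std (gaifman U L) x = gval (fun=> x).
Proof.
have [_ h] := @gval_sat 1 (fun _ => fun=> x)
  (Eq (Var S ord0) (@App S 1 0 (ConstA x) (tnth [tuple]))) (fun _ => dterm_const hG _ x).
have /h : QU (fun s => @sat _ exp 1 [tuple x | _ < 1]
    (Eq (Var S ord0) (@App S 1 0 (ConstA x) (tnth [tuple])))).
  apply: QU_all => //; last by move=> s; rewrite /= tnth_mktuple.
  exact: dfn_prop.
rewrite /= tnth_mktuple => ->; rewrite /std; congr fint.
by apply: tuple_eq => -[].
Qed.

End OneOrder.

(** The graph by which the map is defined is single-valued, as equality of two
    values in [K] is equality for almost all assignments, which is preserved by
    renaming along [i]. *)
Lemma gaifman_map_gval d (K : orderType d) d' (L : orderType d') (i : K -> L) f :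
  order_embedding i -> dterm f ->
  gaifman_map U i (gval f) = gval (fun s => f (fun k => s (i k))).
Proof.
move=> hi df.
have [KT _] := gaifman_prime (L := K).
have graphP x y : denotes (N := gaifman_full U K) f x -> gaifman_graph i x y ->
   y = gval (fun s => f (fun k => s (i k))).
  move=> fx [n [f0 [cf [k [sk xE yE]]]]].
  have fx' : denotes (N := gaifman_full U K) (fun s => f0 (map_tuple s k)) x.
    by exists n, k, f0, cf.
  have d0 : dterm (fun s : K -> M => f0 (map_tuple s k)) by exact: (dterm_of_rep cf).
  have e := proj1 (denotes_eq KT fx' fx) erefl.
  have di (g : (K -> M) -> M) : dterm g -> dterm (fun s : L -> M => g (fun k => s (i k))).
    move=> dg; exact: (dfn_ren (fun o : option K => omap i o) dg).
  have -> : y = gval (fun s : L -> M => f0 (map_tuple (fun k => s (i k)) k)).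
    apply: gval_denotes; exists n, (map_tuple i k), f0, cf; split.
    + rewrite /= sorted_map; apply: sub_sorted sk => u v /=.
      by rewrite (leW_mono hi).
    + by move=> s; congr f0; apply: tuple_eq => j; rewrite !tnth_map.
    + rewrite yE; congr fint; apply: tuple_eq => j; by rewrite !tnth_map.
  apply/gval_eq; [exact: di d0|exact: di|].
  apply/(QU_embed hG hU (P := fun s => f0 (map_tuple s k) = f s) hi) => //.
  exact: dfn_eqf.
apply: (graphP (gval f)); first exact: gvalP.
apply: (epsilon_spec (sets_inh (gaifman_eps U L))).
have [n [l [f0 [cf [sl fE yE]]]]] := gvalP df.
by eexists; exists n, f0, cf, l; split.
Qed.

End Prime.

(** * First-order predicates, uniformly in the structure *)

Section Uniform.
Variable MA : class_structure.
Local Notation S := (L0A MA).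

(** First-order definability uniformly over all structures, again without writing
    formulas.  It transfers notions such as being an ordinal between the
    universe and the Gaifman models.  The parameter [d] gives a value to
    variables of the formula that are not in [V], which may be empty. *)
Definition fo V (P : forall N : structure S, (V -> N) -> Prop) : Prop :=
  exists n (phi : formula S n) (a : 'I_n -> option V),
  forall (N : structure S) (s : V -> N) (d : N),
    P N s <-> @sat S N n [tuple oapp s d (a j) | j < n] phi.

Implicit Types N : structure S.

Lemma fo_iff V (P Q : forall N, (V -> N) -> Prop) :
  (forall N s, P N s <-> Q N s) -> fo P -> fo Q.
Proof. by move=> PQ [n [phi [a H]]]; exists n, phi, a => N s d; rewrite -PQ. Qed.

Lemma fo_imp V (P Q : forall N, (V -> N) -> Prop) :
  fo P -> fo Q -> fo (fun N s => P N s -> Q N s).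
Proof.
move=> [n [phi [a H]]] [n' [phi' [a' H']]].
exists (n + n'), (Imp (fsubst (fun j => Var S (lshift n' j)) phi)
                      (fsubst (fun j => Var S (rshift n j)) phi')),
  (fun j => match fintype.split j with inl k => a k | inr k => a' k end) => N s d.
rewrite (H _ _ d) (H' _ _ d) /= !sat_subst.
rewrite (_ : [tuple _ | j < n] = [tuple oapp s d (a j) | j < n]); last first.
  by apply: tuple_eq => j; rewrite !tnth_mktuple /= tnth_mktuple (unsplitK (inl j)).
rewrite (_ : [tuple _ | j < n'] = [tuple oapp s d (a' j) | j < n']) //.
by apply: tuple_eq => j; rewrite !tnth_mktuple /= tnth_mktuple (unsplitK (inr j)).
Qed.

Lemma fo_bot V : fo (fun N (s : V -> N) => False).
Proof. by exists 0, (Bot S 0), (fun=> None) => N s d. Qed.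

Lemma fo_all V (P : forall N, (V -> N) -> N -> Prop) :
  fo (fun N (s : option V -> N) => P N (fun v => s (Some v)) (s None)) ->
  fo (fun N s => forall x, P N s x).
Proof.
move=> [n [phi [a H]]].
exists n, (All (fsubst (fun j => if a j is Some None then Var S ord0 else Var S (lift ord0 j)) phi)),
  (fun j => if a j is Some (Some v) then Some v else None) => N s d.
pose ocs x (o : option V) : N := if o is Some v then s v else x.
have E x : P N s x <-> sat (tcons x [tuple oapp s d (if a j is Some (Some v) then Some v else None) | j < n])
  (fsubst (fun j => if a j is Some None then Var S ord0 else Var S (lift ord0 j)) phi).
  rewrite (H N (ocs x) d) sat_subst.
  rewrite (_ : [tuple oapp (ocs x) d (a j) | j < n] = [tuple eval
    (tcons x [tuple oapp s d (if a j is Some (Some v) then Some v else None) | j < n])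
    (if a j is Some None then Var S ord0 else Var S (lift ord0 j)) | j < n]) //.
  apply: tuple_eq => j; rewrite !tnth_mktuple.
  by case aj: (a j) => [[v|]|] //=; rewrite tnth_tconsS tnth_mktuple aj.
by split=> h x; apply/E; exact: h.
Qed.

Lemma fo_eq V (v w : V) : fo (fun N s => s v = s w).
Proof.
exists 2, (Eq (Var S ord0) (Var S ord_max)), (fun j => if j == ord0 then Some v else Some w) => N s d.
by rewrite /= !tnth_mktuple.
Qed.

Lemma fo_in V (v w : V) : fo (fun N s => @isin (eps_reduct N) (s v) (s w)).
Proof.
exists 2, (@Rel S 2 2 (MemA MA) (fun j => Var S j)), (fun j => if j == ord0 then Some v else Some w) => N s d.
rewrite /= (_ : [tuple _ | i < 2] = [tuple s v; s w]) //.
by apply: tuple_eq => -[[|[|//]] jn]; rewrite !tnth_mktuple.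
Qed.

Lemma fo_not V (P : forall N, (V -> N) -> Prop) : fo P -> fo (fun N s => ~ P N s).
Proof. by move=> dP; exact: fo_imp dP (fo_bot V). Qed.

Lemma fo_or V (P Q : forall N, (V -> N) -> Prop) : fo P -> fo Q -> fo (fun N s => P N s \/ Q N s).
Proof.
move=> dP dQ; apply: fo_iff (fo_imp (fo_not dP) dQ) => N s.
split=> [H|[]//]; by have [|/H] := pselect (P N s); [left|right].
Qed.

Lemma fo_and V (P Q : forall N, (V -> N) -> Prop) : fo P -> fo Q -> fo (fun N s => P N s /\ Q N s).
Proof.
move=> dP dQ; apply: fo_iff (fo_not (fo_imp dP (fo_not dQ))) => N s.
by split=> [H|[p r] H]; [split; apply: contrapT => F; apply: H|exact: H].
Qed.

Lemma fo_iff2 V (P Q : forall N, (V -> N) -> Prop) : fo P -> fo Q -> fo (fun N s => P N s <-> Q N s).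
Proof. by move=> dP dQ; apply: fo_and; exact: fo_imp. Qed.

Lemma fo_ex V (P : forall N, (V -> N) -> N -> Prop) :
  fo (fun N (s : option V -> N) => P N (fun v => s (Some v)) (s None)) ->
  fo (fun N s => exists x, P N s x).
Proof.
move=> dP; apply: (fo_iff (P := fun N s => ~ forall x, ~ P N s x)).
  by move=> N s; split=> [/existsNP[x /contrapT]|[x Px] /(_ x)//]; exists x.
by apply: fo_not; apply: fo_all; exact: fo_not.
Qed.

Lemma fo_ex2 V (P Q : forall N, (V -> N) -> N -> Prop) :
  fo (fun N (s : option V -> N) => P N (fun v => s (Some v)) (s None)) ->
  fo (fun N (s : option V -> N) => Q N (fun v => s (Some v)) (s None)) ->
  fo (fun N s => exists2 x, P N s x & Q N s x).
Proof.
move=> dP dQ; apply: (fo_iff (P := fun N s => exists x, P N s x /\ Q N s x)).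
  by move=> N s; split=> [[x [pP pQ]]|[x pP pQ]]; exists x.
by apply: fo_ex; exact: fo_and.
Qed.

Lemma fo_and3 V (P Q R : forall N, (V -> N) -> Prop) : fo P -> fo Q -> fo R ->
  fo (fun N s => [/\ P N s, Q N s & R N s]).
Proof.
move=> dP dQ dR; apply: fo_iff (fo_and dP (fo_and dQ dR)) => N s.
by split=> [[? []]|[]].
Qed.

Lemma fo_and5 V (P Q R T T' : forall N, (V -> N) -> Prop) : fo P -> fo Q -> fo R ->
  fo T -> fo T' -> fo (fun N s => [/\ P N s, Q N s, R N s, T N s & T' N s]).
Proof.
move=> dP dQ dR dT dT'; apply: fo_iff (fo_and dP (fo_and dQ (fo_and dR (fo_and dT dT')))) => N s.
by split=> [[? [? [? []]]]|[]].
Qed.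

Lemma fo_or3 V (P Q R : forall N, (V -> N) -> Prop) : fo P -> fo Q -> fo R ->
  fo (fun N s => [\/ P N s, Q N s | R N s]).
Proof.
move=> dP dQ dR; apply: fo_iff (fo_or dP (fo_or dQ dR)) => N s.
by split=> [[?|[?|?]]|[?|?|?]]; [constructor 1|constructor 2|constructor 3|left|right;left|right;right].
Qed.

End Uniform.

Ltac fo_step :=
  lazymatch goal with
  | |- fo (fun N s => False) => apply: fo_bot
  | |- fo (fun N s => ~ _) => apply: fo_not
  | |- fo (fun N s => _ /\ _) => apply: fo_and
  | |- fo (fun N s => _ \/ _) => apply: fo_or
  | |- fo (fun N s => _ <-> _) => apply: fo_iff2
  | |- fo (fun N s => and3 _ _ _) => apply: fo_and3
  | |- fo (fun N s => and5 _ _ _ _ _) => apply: fo_and5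
  | |- fo (fun N s => or3 _ _ _) => apply: fo_or3
  | |- fo (fun N s => @ex2 _ _ _) => apply: fo_ex2
  | |- fo (fun N s => @ex _ _) => apply: fo_ex
  | |- fo (fun N s => isin _ _) => apply: fo_in
  | |- fo (fun N s => rint _ _) => apply: fo_in
  | |- fo (fun N s => _ = _) => apply: fo_eq
  | |- fo (fun N s => forall x, _) => first [apply: fo_imp | apply: fo_all]
  end.

Ltac fo_tac := repeat (fo_step; cbv beta).

Section Transfer.
Variable MA : class_structure.
Local Notation M := (set_part MA).
Local Notation A := (@classes MA).
Local Notation S := (L0A MA).

Lemma fo_is_ord : fo (fun (N : structure S) (s : unit -> N) => @is_ord (eps_reduct N) (s tt)).
Proof.
rewrite /is_ord /transitive_in /subset_in /is_empty; fo_tac.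
Qed.

Lemma fo_rank_le : fo (fun (N : structure S) (s : bool -> N) =>
  @rank_le (eps_reduct N) (s true) (s false)).
Proof.
rewrite /rank_le /is_rank /is_fun /class_fun /is_dom /app /crel /is_opair /is_upair /ext.
rewrite /transitive_in /subset_in /ord_le /=; fo_tac.
Qed.

Variable U : set (set MA).
Hypotheses (hG : GBC MA) (hwc : Ord_weakly_compact MA)
  (hU : generic_ultrafilter MA U).
Local Notation exp := (expansion MA).

Context {d : Order.disp_t} {L : orderType d}.

(** The truth lemma for predicates. *)
Lemma gval_fo V (P : forall N : structure S, (V -> N) -> Prop) (F : V -> (L -> M) -> M) :
  fo P -> (forall v, dterm (F v)) ->
  P (gaifman U L) (fun v => gval U (F v)) <-> QU U (fun s => P exp (fun v => F v s)).
Proof.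
move=> [n [phi [a H]]] dF.
pose F' j := oapp F (fun=> pt MA) (a j).
have dF' j : dterm (F' j) by rewrite /F'; case: (a j) => [v|] /=; [|exact: dterm_const].
rewrite (H _ _ (gval U (fun=> pt MA))).
rewrite (_ : [tuple _ | j < n] = [tuple gval U (F' j) | j < n]); last first.
  by apply: tuple_eq => j; rewrite !tnth_mktuple /F'; case: (a j).
rewrite gval_sat //.
rewrite (_ : (fun s => _) = (fun s => P exp (fun v => F v s))) //.
apply/funext => s; apply/propext; rewrite (H exp _ (pt MA)).
rewrite (_ : [tuple _ | j < n] = [tuple oapp (fun v => F v s) (pt MA) (a j) | j < n]) //.
by apply: tuple_eq => j; rewrite !tnth_mktuple /F'; case: (a j).
Qed.

Lemma gval_ord f : dterm f -> Ord (gaifman_eps U L) (gval U f) <-> QU U (fun s => Ord M (f s)).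
Proof. by move=> df; exact: (gval_fo (F := fun _ => f) fo_is_ord). Qed.

Lemma gval_in f g : dterm f -> dterm g ->
  @isin (gaifman_eps U L) (gval U f) (gval U g) <-> QU U (fun s => isin (f s) (g s)).
Proof.
move=> df dg; apply: (gval_fo (F := fun b : bool => if b then f else g) (fo_in MA true false)).
by case.
Qed.

Lemma gval_rank_le f g : dterm f -> dterm g ->
  @rank_le (gaifman_eps U L) (gval U f) (gval U g) <-> QU U (fun s => @rank_le M (f s) (g s)).
Proof.
move=> df dg; apply: (gval_fo (F := fun b : bool => if b then f else g) fo_rank_le).
by case.
Qed.

End Transfer.

(** * Supports of the elements of the limit power *)

Section Supports.
Variable MA : class_structure.
Local Notation M := (set_part MA).
Local Notation A := (@classes MA).
Variable U : set (set MA).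
Hypotheses (hG : GBC MA) (hwc : Ord_weakly_compact MA)
  (hU : generic_ultrafilter MA U).

Local Notation WL := (@WL MA U _).

Lemma fsuppW V (S S' : {pred V}) (f : (V -> M) -> M) : {subset S <= S'} -> fsupp S f -> fsupp S' f.
Proof. by move=> SS sf s s' ss; apply: sf => v /SS; exact: ss. Qed.

Lemma WL_ren (V V' : eqType) (j : V -> V') (q : seq V) P' P s' : injective j ->
  (forall s'', (forall w, (forall v, w <> j v) -> s'' w = s' w) ->
     P' s'' <-> P (fun v => s'' (j v))) ->
  WL (map j q) P' s' <-> WL q P (fun v => s' (j v)).
Proof.
move=> ij; elim: q s' => [|x q IH] s' HP /=; first exact: HP.
have E a : (fun v => upd s' (j x) a (j v)) = upd (fun v => s' (j v)) x a.
  by apply/funext => v; rewrite /upd (inj_eq ij).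
have H a : WL (map j q) P' (upd s' (j x) a) <-> WL q P (upd (fun v => s' (j v)) x a).
  rewrite -E; apply: IH => s'' ss; apply: HP => w wj; rewrite ss // /upd.
  by case: eqP => // /wj.
by split; apply: UqS => a /H.
Qed.

Lemma dterm_upd (V : eqType) (f g : (V -> M) -> M) x : dterm f -> dterm g ->
  dterm (fun s => f (upd s x (g s))).
Proof.
move=> df dg; rewrite /dterm.
have dQ := dfn_ren (fun o : option V => if o is Some v then
  (if v == x then None else Some (Some v)) else Some None) df.
apply: dfn_iff (dfn_bind dQ (dterm_wk dg)) => s Y /=.
suff -> : (fun v => ocons (g (fun v => s (Some v))) s (if v == x then None else Some (Some v))) =
  upd (fun v => s (Some v)) x (g (fun v => s (Some v))) by [].
by apply/funext => v; rewrite /upd; case: eqP.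
Qed.

(** The almost constant value of [g] in the variables [q], if there is one: a function
    of the remaining variables. *)
Definition limval (V : eqType) (q : seq V) (g : (V -> M) -> M) (s : V -> M) : M :=
  select hG hwc (fun y => WL q (fun s' => g s' = y) s).

Lemma dfn_limval (V : eqType) (q : seq V) g : dterm g ->
  dfn (fun (s : option V -> M) (_ : set M) => WL q (fun s' => g s' = s None) (fun v => s (Some v))).
Proof.
move=> dg.
have dW := @dfn_WL MA U hG hwc hU _ (map Some q) (fun s : option V -> M => g (fun v => s (Some v)) = s None).
apply: dfn_iff (dW _) => [s Y|].
  apply: (@WL_ren _ _ Some q _ (fun s' => g s' = s None)) => [x y []//|s'' ss].
  by rewrite ss.
by apply: (dfn2 (R := eq)); [exact: def2_eq|exact: dterm_wk|exact: dterm_var].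
Qed.

Lemma dterm_limval (V : eqType) (q : seq V) g : dterm g -> dterm (limval q g).
Proof. by move=> dg; apply: dterm_select; exact: dfn_limval. Qed.

Lemma limval_spec (V : eqType) (q : seq V) g s : dterm g ->
  (exists y, WL q (fun s' => g s' = y) s) -> WL q (fun s' => g s' = limval q g s) s.
Proof.
move=> dg; apply: (select_spec hG hwc (P := fun y => WL q (fun s' => g s' = y) s)).
exact: (dfn_def1 (P := fun s Y y => WL q (fun s' => g s' = y) s) s (gbc_subsort hG (pt MA)) (dfn_limval q dg)).
Qed.

Lemma WL_functional (V : eqType) (q : seq V) (g : (V -> M) -> M) s y y' :
  WL q (fun s' => g s' = y) s -> WL q (fun s' => g s' = y') s -> y = y'.
Proof.
move=> h h'; apply/(WL_const hG hU q _ s).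
by apply: WLS (WL_and hU h h') => s' [-> ->].
Qed.

Lemma limval_eq (V : eqType) (q : seq V) g s y : dterm g ->
  WL q (fun s' => g s' = y) s -> limval q g s = y.
Proof. by move=> dg h; exact: (WL_functional (limval_spec dg (ex_intro _ y h)) h). Qed.

Lemma WL_upd_inv (V : eqType) (S : {pred V}) (q : seq V) P x a s : supp S P ->
  (x \in S -> x \in q) -> WL q P (upd s x a) <-> WL q P s.
Proof.
move=> sP xS; split; apply: (WL_supp (l := q) sP) => v; rewrite inE /upd => /andP[vS vq];
  case: eqP => // vx; by rewrite vx in vS vq; rewrite xS in vq.
Qed.

(** Completeness of the iterated ultrafilter, by induction on the number of
    variables: the limit value in the later variables is a definable function of
    the first one, to which [Uq_complete] applies. *)
Lemma WL_complete (V : eqType) (q : seq V) (g : (V -> M) -> M) (P : M -> Prop) s :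
  dterm g -> small P -> WL q (fun s' => P (g s')) s ->
  exists2 y, P y & WL q (fun s' => g s' = y) s.
Proof.
move=> dg sP; elim: q s => [|x q IH] s /=; first by exists (g s).
move=> h.
have dk : dfun1 (fun a => limval q g (upd s x a)).
  have := dfn_subst (fun o : option V => match o with None => inl false
    | Some v => if v == x then inl true else inr (s v) end) (dterm_limval q dg).
  apply: dfn_iff => s' Y /=.
  suff -> : (fun v => aval s' (if v == x then inl true else inr (s v))) = upd s x (s' true) by [].
  by apply/funext => v; rewrite /upd; case: eqP.
have [|y Py yE] := Uq_complete hG hU dk sP.
  by apply: UqS h => a /IH[y Py yE]; rewrite (limval_eq dg yE).
exists y => //; apply: UqS (Uq_and hU h yE) => a [/IH[z _ zE] <-].
by rewrite (limval_eq dg zE).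
Qed.

Section OneOrder.
Context {d : Order.disp_t} {L : orderType d}.
Local Notation QU := (@QU MA U d L).
Local Notation fn := ((L -> M) -> M).

Lemma fsupp_eq (S S' : {pred L}) (f g : fn) : fsupp S f -> fsupp S' g ->
  supp [pred v | (v \in S) || (v \in S')] (fun s => f s = g s).
Proof.
move=> sf sg s s' ss; rewrite (sf s s') ?(sg s s') // => v vS; apply: ss;
  by rewrite inE vS ?orbT.
Qed.

Lemma sorted_split (l : seq L) x : sorted <%O l -> x \in l ->
  exists p q, [/\ l = p ++ x :: q, x \notin p, x \notin q &
    forall v, v \in p -> v \notin q].
Proof.
move=> /sorted_uniq_lt + xl; case/splitPr: xl => p q.
rewrite cat_uniq /= => /and4P[_ h xq _]; exists p, q.
split=> //; first by apply: contra h => xp; apply/orP; left.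
move=> v vp; apply: contra h => vq; apply/orP; right; by apply/hasP; exists v.
Qed.

(** With the variables before [l] fixed, the equation would hold for unboundedly
    many values of [l], while the limit of [g] in the later variables is one
    value. *)
Lemma var_not_in_support (l : L) (S : seq L) (g : fn) : dterm g -> fsupp [in S] g ->
  l \notin S -> ~ QU (fun s => s l = g s).
Proof.
move=> dg sg lS h.
have sP : supp [in l :: S] (fun s : L -> M => s l = g s).
  move=> s s' ss e; rewrite -(ss l) ?mem_head // e; apply: sg => v vS.
  by apply: ss; rewrite in_cons vS orbT.
have sP' : supp [in sortl (l :: S)] (fun s : L -> M => s l = g s).
  by apply: supp_sub sP => v; rewrite mem_sortl.
have W := proj1 (QUE hG hU (fun=> pt MA) (sortl_sorted _) sP') h.
have lS' : l \in sortl (l :: S) by rewrite mem_sortl mem_head.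
have [p [q [E lp lq pq]]] := sorted_split (sortl_sorted (l :: S)) lS'.
have uq : uniq q.
  have := sorted_uniq_lt (sortl_sorted (l :: S)); rewrite E cat_uniq => /and3P[_ _] /=.
  by case/andP.
rewrite E WL_cat in W.
apply/(WL_const hG hU p False (fun=> pt MA)); apply: WLS W => s /= W.
have W' : Uq U (fun a => WL q (fun s' => g s' = a) s).
  apply: UqS W => a W.
  apply/(@WL_upd_inv _ [in S] q _ l a s).
  - by move=> u u' uu <-; apply: sg => v vS; rewrite uu.
  - by rewrite unfold_in (negPf lS).
  by apply: WLS_at W => // u _ uE <-; rewrite uE // /upd eqxx.
have [a oa Wa] := Uq_ex hG hU W'.
have [b [_ Wb ab]] := Uq_unbounded hU W' oa.
by rewrite (WL_functional Wa Wb) in ab; exact: (in_irr hG ab).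
Qed.

(** With the variables in [p] fixed, the values of [g] range over the set of
    elements of bounded rank, so by completeness [g] is almost constant
    in the variables [q]; its limit value replaces [g]. *)
Lemma rank_le_support (p q : seq L) (S : {pred L}) (f g : fn) : dterm f -> dterm g ->
  sorted <%O (p ++ q) -> fsupp [in p] f -> fsupp S g -> {subset S <= p ++ q} ->
  QU (fun s => rank_le (g s) (f s)) ->
  exists h : fn, [/\ dterm h, fsupp [pred v | (v \in S) && (v \notin q)] h & QU (fun s => g s = h s)].
Proof.
move=> df dg spq sf sg Spq gf.
have sE s s' : (forall v, v \in [pred v | (v \in S) && (v \notin q)] -> s v = s' v) ->
    (fun y => WL q (fun s0 => g s0 = y) s) = (fun y => WL q (fun s0 => g s0 = y) s').
  move=> ss; apply/funext => y; apply/propext.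
  have sy : supp S (fun s0 => g s0 = y) by move=> u u' uu <-; apply: sg => v /uu ->.
  by split; apply: (WL_supp (l := q) sy) => v vS; rewrite ss.
have sh : fsupp [pred v | (v \in S) && (v \notin q)] (limval q g).
  by move=> s s' ss; rewrite /limval (sE s s').
have dh : dterm (limval q g) by exact: dterm_limval.
exists (limval q g); split=> //.
have sR : supp [in p ++ q] (fun s => rank_le (g s) (f s)).
  move=> s s' ss; rewrite (sf s s') ?(sg s s') // => v vS; apply: ss; first exact: Spq.
  by rewrite unfold_in /= mem_cat; apply/orP; left.
have sH : supp [in p ++ q] (fun s => g s = limval q g s).
  move=> s s' ss; rewrite (sg s s') ?(sh s s') // => v; last by move/Spq/ss.
  by rewrite inE => /andP[/Spq/ss].
have W := proj1 (QUE hG hU (fun=> pt MA) spq sR) gf.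
apply/(QUE hG hU (fun=> pt MA) spq sH).
have /= := sorted_uniq_lt spq; rewrite cat_uniq => /and3P[_ pq uq].
move: W; rewrite !WL_cat; apply: WLS => s W.
have W1 : WL q (fun s' => isin (rank hG (g s')) (osucc (rank hG (f s)))) s.
  apply: WLS_at W => // s' _ ss /(rank_leP hG) h.
  have <- : f s' = f s.
    by apply: sf => v vp; apply: ss; apply: contra pq => vq; apply/hasP; exists v.
  by apply/(in_osucc hG).
have [y _ yE] := WL_complete dg (rank_lt_small hG (ord_succ hG (ord_rank hG (f s)))) W1.
have e := limval_eq dg yE; rewrite -e in yE; apply: WLS_at yE => // s' _ ss ->.
by apply: sh => v; rewrite inE => /andP[_ vq]; rewrite ss.
Qed.

(** With the variables before [x] fixed, [h1] agrees with [h2], in which [x] does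
    not occur, for almost all values of [x].  So almost any two values of [x]
    give the same function of the later variables, and a fixed good value can
    be put for [x].  It is chosen by [select] as one that agrees with almost all
    others, a condition involving neither [x] nor the later variables. *)
Lemma drop_variable (x : L) (S1 S2 : seq L) (h1 h2 : fn) : dterm h1 -> dterm h2 ->
  fsupp [in S1] h1 -> fsupp [in S2] h2 -> x \notin S2 -> QU (fun s => h1 s = h2 s) ->
  exists h : fn, [/\ dterm h, fsupp [pred v | (v \in S1) && (v != x)] h & QU (fun s => h1 s = h s)].
Proof.
move=> d1 d2 s1 s2 xS2 h12.
pose l := sortl (x :: S1 ++ S2); have sl : sorted <%O l by exact: sortl_sorted.
have xl : x \in l by rewrite mem_sortl mem_head.
have [p [q [E xp xq pq]]] := sorted_split sl xl.
have uq : uniq q.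
  have := sorted_uniq_lt sl; rewrite E cat_uniq => /and3P[_ _] /=.
  by case/andP.
pose R s a a' := WL q (fun s' => h1 (upd s' x a) = h1 (upd s' x a')) s.
have sR a a' : supp [pred v | (v \in S1) && (v != x)] (fun s' => h1 (upd s' x a) = h1 (upd s' x a')).
  have e c u u' : (forall v, v \in [pred v | (v \in S1) && (v != x)] -> u v = u' v) ->
      h1 (upd u x c) = h1 (upd u' x c).
    move=> uu; apply: s1 => v vS; rewrite /upd; case: eqP => // /eqP vx.
    by apply: uu; rewrite inE vS.
  by move=> u u' uu; rewrite (e a _ _ uu) (e a' _ _ uu).
have R_inv s s' a a' : (forall v, v \in S1 -> v != x -> v \notin q -> s v = s' v) -> R s a a' -> R s' a a'.
  move=> ss; apply: (WL_supp (l := q) (sR a a')) => v; rewrite !inE => /andP[/andP[vS vx] vq].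
  exact: ss.
(* A value of [x] that agrees with almost all others, for almost all later variables. *)
pose a0 s := select hG hwc (fun a => Uq U (R s a)).
have dR : dfn (fun (s : option (option L) -> M) (_ : set M) =>
    R (fun v => s (Some (Some v))) (s (Some None)) (s None)).
  pose P' (s : option (option L) -> M) := h1 (upd (fun v => s (Some (Some v))) x (s (Some None))) =
        h1 (upd (fun v => s (Some (Some v))) x (s None)).
  have dP' : dfn (fun s (_ : set M) => P' s).
    have d3 (o : option (option L)) : dterm (fun s : option (option L) -> M =>
        h1 (upd (fun v => s (Some (Some v))) x (s o))).
      have := dfn_ren (fun o' : option L => if o' is Some v then
        (if v == x then Some o else Some (Some (Some v))) else None) d1.
      apply: dfn_iff => s Y /=.
      suff -> : (fun v => s (if v == x then Some o else Some (Some (Some v)))) =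
        upd (fun v => s (Some (Some (Some v)))) x (s (Some o)) by [].
      by apply/funext => v; rewrite /upd; case: eqP.
    by apply: (dfn2 (R := eq)); [exact: def2_eq|exact: d3|exact: d3].
  apply: dfn_iff (@dfn_WL MA U hG hwc hU _ (map (fun v => Some (Some v)) q) _ dP') => s Y.
  apply: (@WL_ren _ _ (fun v => Some (Some v)) q _ (fun s' => h1 (upd s' x (s (Some None))) = h1 (upd s' x (s None)))).
    by move=> v w [].
  by move=> s'' ss; rewrite /P' !ss.
have dUR : dfn (fun (s : option L -> M) (_ : set M) => Uq U (R (fun v => s (Some v)) (s None))).
  exact: (dfn_Uq hG hwc hU (P := fun s a => R (fun v => s (Some v)) (s None) a)).
have da0 : dterm a0 by exact: dterm_select.
pose h s := h1 (upd s x (a0 s)).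
have dh : dterm h by exact: dterm_upd.
have a0_inv s s' : (forall v, v \in S1 -> v != x -> v \notin q -> s v = s' v) -> a0 s = a0 s'.
  move=> ss; rewrite /a0; suff -> : (fun a => Uq U (R s a)) = (fun a => Uq U (R s' a)) by [].
  apply/funext => a; apply/propext; split; apply: UqS => a'; apply: R_inv => // v vS vx vq.
  by rewrite ss.
have sh : fsupp [pred v | (v \in S1) && (v != x)] h.
  move=> s s' ss; rewrite /h (a0_inv s s') => [|v vS vx _]; last by apply: ss; rewrite inE vS.
  by apply: s1 => v vS; rewrite /upd; case: eqP => // /eqP vx; apply: ss; rewrite inE vS.
exists h; split=> //.
have sub v : v \in [pred v | (v \in S1) || (v \in S2)] -> v \in l.
  by rewrite mem_sortl !inE mem_cat => ->; rewrite orbT.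
have sP1 : supp [in l] (fun s => h1 s = h2 s).
  by move=> u u' uu; apply: (fsupp_eq s1 s2) => v /sub; exact: uu.
have sP2 : supp [in l] (fun s => h1 s = h s).
  move=> u u' uu; apply: (fsupp_eq s1 sh) => v vS; apply: uu; apply: sub; move: vS.
  by rewrite !inE => /orP[->//|/andP[->]].
have W := proj1 (QUE hG hU (fun=> pt MA) sl sP1) h12.
apply/(QUE hG hU (fun=> pt MA) sl sP2).
move: W; rewrite E !WL_cat; apply: WLS => s /= W.
(* The values that agree with [h2] witness that such an [a0] exists. *)
pose good a := WL q (fun s' => h1 (upd s' x a) = h2 s') s.
have updx (s' : L -> M) a : s' x = a -> upd s' x a = s'.
  by move=> <-; apply/funext => v; rewrite /upd; case: eqP => // ->.
have xS : x \in [pred v | v != x] -> x \in q by rewrite inE /= eqxx.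
have Wg : Uq U good.
  apply: UqS W => a W.
  have sg : supp [pred v | v != x] (fun s' => h1 (upd s' x a) = h2 s').
    move=> u u' uu; have -> : upd u x a = upd u' x a.
      by apply/funext => v; rewrite /upd; case: eqP => // /eqP vx; exact: uu.
    rewrite (s2 u u') // => v vS; apply: uu; rewrite inE; apply: contraNneq xS2 => <-.
    exact: vS.
  apply: (proj1 (WL_upd_inv a s sg xS)).
  by apply: WLS_at W => // s' _ ss; rewrite updx // ss // /upd eqxx.
have gR a a' : good a -> good a' -> R s a a'.
  by move=> ga ga'; apply: WLS (WL_and hU ga ga') => s' [-> ->].
have exa : exists a, Uq U (R s a).
  have [a _ ga] := Uq_ex hG hU Wg; exists a; apply: UqS Wg => a'; exact: gR.
have Ua0 : Uq U (R s (a0 s)).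
  apply: (select_spec hG hwc (P := fun a => Uq U (R s a))) => //.
  exact: (dfn_def1 (P := fun s Y a => Uq U (R s a)) s (gbc_subsort hG (pt MA)) dUR).
apply: UqS Ua0 => a Ra.
have sE : supp [pred v | v != x] (fun s' => h1 (upd s' x (a0 s)) = h1 (upd s' x a)).
  move=> u u' uu; have e b : upd u x b = upd u' x b.
    by apply/funext => v; rewrite /upd; case: eqP => // /eqP vx; exact: uu.
  by rewrite !e.
have {}Ra : WL q (fun s' => h1 (upd s' x (a0 s)) = h1 (upd s' x a)) (upd s x a).
  by exact: (proj2 (WL_upd_inv a s sE xS)).
apply: WLS_at Ra => // s' _ ss.
rewrite [upd s' x a]updx; last by rewrite ss // /upd eqxx.
move=> <-; rewrite /h; congr (h1 (upd s' x _)); apply: a0_inv => v vS vx vq.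
by rewrite ss // /upd (negPf vx).
Qed.

End OneOrder.
End Supports.

(** * Properties of the Gaifman functor *)

Section Gaifman.
Variable MA : class_structure.
Local Notation M := (set_part MA).
Local Notation A := (@classes MA).
Variable U : set (set MA).
Hypotheses (hG : GBC MA) (hwc : Ord_weakly_compact MA)
  (hU : generic_ultrafilter MA U).
Local Notation exp := (expansion MA).
Local Notation S := (L0A MA).

Lemma sorted_split_down d (L : orderType d) (D : {pred L}) (l : seq L) : sorted <%O l ->
  (forall x y, x \in l -> y \in l -> (x < y)%O -> y \in D -> x \in D) ->
  l = [seq x <- l | x \in D] ++ [seq x <- l | x \notin D].
Proof.
elim: l => [//|x l IH] sl HD.
have sl' := path_sorted sl.
have xl y : y \in l -> (x < y)%O.
  by move=> yl; have := order_path_min lt_trans sl; move/allP/(_ y yl).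
have HD' u v : u \in l -> v \in l -> (u < v)%O -> v \in D -> u \in D.
  by move=> ul vl; apply: HD; rewrite in_cons ?ul ?vl orbT.
rewrite /=; have [xD|xD] /= := boolP (x \in D); first by rewrite -IH.
have nD y : y \in l -> y \notin D.
  move=> yl; apply/negP => yD; have := HD x y; rewrite mem_head in_cons yl orbT (negPf xD).
  by move=> /(_ isT isT (xl y yl) yD).
have -> : [seq x <- l | x \in D] = [::].
  by apply/eqP; rewrite -(negbK (_ == _)) -has_filter; apply/hasPn => y /nD.
by congr cons; symmetry; apply/all_filterP/allP => y /nD.
Qed.

Lemma sorted_cat1 d (L : orderType d) (l : seq L) x : sorted <%O l ->
  (forall y, y \in l -> (y < x)%O) -> sorted <%O (l ++ [:: x]).
Proof.
move=> sl lx; rewrite cats1 (sorted_pairwise lt_trans) pairwise_rcons.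
by rewrite -(sorted_pairwise lt_trans) sl andbT; apply/allP.
Qed.

Lemma sub_sorted_map d (K : orderType d) d' (L : orderType d') (i : K -> L) (l : seq K) :
  order_embedding i -> sorted <%O l -> sorted <%O (map i l).
Proof.
by move=> hi; rewrite sorted_map; apply: sub_sorted => x y /=; rewrite (leW_mono hi).
Qed.

Section Pull.
Context {d : Order.disp_t} {K : orderType d} {d' : Order.disp_t} {L : orderType d'}.
Variable i : K -> L.
Hypothesis hi : order_embedding i.

Lemma emb_inj : injective i. Proof. exact: inc_inj. Qed.

Lemma emb_lt x y : (i x < i y)%O = (x < y)%O. Proof. exact: (leW_mono hi). Qed.

Lemma dterm_emb (f : (K -> M) -> M) : dterm f -> dterm (fun s : L -> M => f (fun k => s (i k))).
Proof. exact: (dfn_ren (fun o : option K => omap i o)). Qed.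

Lemma fsupp_emb (l : seq K) (f : (K -> M) -> M) : fsupp [in l] f ->
  fsupp [in map i l] (fun s : L -> M => f (fun k => s (i k))).
Proof. by move=> sf s s' ss; apply: sf => k kl; apply: ss; exact: map_f. Qed.

(** A function supported on the range of [i] comes from a function on [K]; the
    variables outside the range are given the default value. *)
Lemma pull (Sl : {pred L}) (T : {pred K}) (h : (L -> M) -> M) : dterm h -> fsupp Sl h ->
  (forall l, l \in Sl -> exists2 k, k \in T & i k = l) ->
  exists h' : (K -> M) -> M, [/\ dterm h', fsupp T h' & forall s, h s = h' (fun k => s (i k))].
Proof.
move=> dh sh ST.
pose rho (l : L) : K + M := if pselect (exists k, i k = l) is left e then inl (projT1 (cid e)) else inr (pt MA).
have rhoE k : rho (i k) = inl k.
  rewrite /rho; case: pselect => [e|[]]; last by exists k.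
  by case: cid => k' /= /emb_inj ->.
exists (fun t => h (fun l => aval t (rho l))); split.
- have := dfn_subst (fun o : option L => if o is Some l then
     match rho l with inl k => inl (Some k) | inr c => inr c end else inl None) dh.
  apply: dfn_iff => s Y /=.
  suff -> : (fun v => aval s match rho v with inl k => inl (Some k) | inr c => inr c end) =
    (fun l => aval (fun v => s (Some v)) (rho l)) by [].
  by apply/funext => v; case: (rho v).
- move=> s s' ss; apply: sh => l /ST[k kT <-]; rewrite rhoE; exact: ss.
- by move=> s; apply: sh => l /ST[k kT <-]; rewrite rhoE.
Qed.

Lemma map_gval f : dterm f -> gaifman_map U i (gval U f) = gval U (fun s => f (fun k => s (i k))).
Proof. exact: gaifman_map_gval. Qed.

Lemma QU_emb_eq (f g : (K -> M) -> M) : dterm f -> dterm g ->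
  QU U (fun s : L -> M => f (fun k => s (i k)) = g (fun k => s (i k))) <-> QU U (fun s => f s = g s).
Proof.
move=> df dg; apply: (QU_embed hG hU (P := fun s => f s = g s)) => //.
exact: dfn_eqf.
Qed.

Lemma map_const k : gaifman_map U i (gaifman_const U k) = gaifman_const U (i k).
Proof. by rewrite !gval_const // map_gval //; exact: dterm_var. Qed.

(** Elements of the range are supported on the range of [i], and [c_l] is not
    unless [l] is in it. *)
Lemma const_in_range l (y : gaifman_eps U K) :
  gaifman_map U i y = gaifman_const U l -> range i l.
Proof.
have [f df ->] := gval_surj hG hwc hU y; rewrite map_gval // gval_const // => e.
have [l0 sf] := dterm_fsupp df.
apply: contrapT => nl.
apply: (var_not_in_support hG hU (dterm_emb df) (fsupp_emb sf) (l := l)).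
  by apply/negP => /mapP[k _ lE]; apply: nl; exists k.
have := proj1 (gval_eq hG hwc hU (dterm_emb df) (dterm_var hG l)) e.
exact: eqv_sym.
Qed.

Lemma elementary_map : @elementary_embedding _ (gaifman U K) (gaifman U L) (gaifman_map U i).
Proof.
move=> n phi e.
have /choice[F FE] (j : 'I_n) : exists f : (K -> M) -> M, dterm f /\ tnth e j = gval U f.
  by have [f df fE] := gval_surj hG hwc hU (tnth e j); exists f.
have dF j : dterm (F j) by have [] := FE j.
have -> : e = [tuple gval U (F j) | j < n].
  by apply: tuple_eq => j; rewrite tnth_mktuple; have [] := FE j.
rewrite gval_sat //.
rewrite (_ : map_tuple _ _ = [tuple gval U (fun s => F j (fun k => s (i k))) | j < n]); last first.
  by apply: tuple_eq => j; rewrite tnth_map !tnth_mktuple map_gval.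
rewrite gval_sat //; last by move=> j; exact: dterm_emb.
by rewrite -(QU_embed hG hU hi (dfn_sat_comp hG phi dF)).
Qed.

End Pull.

Lemma gaifman_theory d (L : orderType d) : models (gaifman U L) (theory exp).
Proof.
move=> phi phiT.
have := gval_sat hG hwc hU phi (F := fun _ => fun _ : L -> M => pt MA) (fun _ => dterm_const hG _ _).
rewrite (_ : [tuple _ | _ < 0] = [tuple]); last by apply: tuple_eq => -[].
move=> ->; rewrite (_ : (fun _ => _) = (fun=> @sat _ exp 0 [tuple] phi)).
  by apply/QU_const.
by apply/funext => s; rewrite (_ : [tuple _ | _ < 0] = [tuple]) //; apply: tuple_eq => -[].
Qed.

Lemma gaifman_id d (L : orderType d) : gaifman_map U (@id L) = id.
Proof.
apply/funext => y; have [f df ->] := gval_surj hG hwc hU y.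
by rewrite map_gval.
Qed.

Lemma comp_embedding d1 (L1 : orderType d1) d2 (L2 : orderType d2) d3 (L3 : orderType d3)
  (j : L1 -> L2) (j' : L2 -> L3) : order_embedding j -> order_embedding j' ->
  order_embedding (j' \o j).
Proof. by move=> hj hj' x y /=; rewrite hj' hj. Qed.

Lemma gaifman_comp d1 (L1 : orderType d1) d2 (L2 : orderType d2) d3 (L3 : orderType d3)
  (j : L1 -> L2) (j' : L2 -> L3) : order_embedding j -> order_embedding j' ->
  gaifman_map U (j' \o j) = gaifman_map U j' \o gaifman_map U j.
Proof.
move=> hj hj'; apply/funext => y; have [f df ->] := gval_surj hG hwc hU y.
rewrite /= !map_gval //; first exact: dterm_emb.
exact: comp_embedding.
Qed.

Section OneOrder.
Context {d' : Order.disp_t} {L : orderType d'}.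
Local Notation fn := ((L -> M) -> M).

Lemma gaifman_sat n (phi : formula S n) (l : n.-tuple L) : sorted <%O l ->
  @sat _ (gaifman U L) n (map_tuple (gaifman_const U (L := L)) l) phi <->
  Upow MA U n (truth_set phi).
Proof.
move=> sl; rewrite -(QU_truth hG hwc hU phi sl).
rewrite (_ : map_tuple _ l = [tuple gval U (fun s => s (tnth l j)) | j < n]); last first.
  by apply: tuple_eq => j; rewrite tnth_map tnth_mktuple gval_const.
rewrite gval_sat //; last by move=> j; exact: dterm_var.
rewrite (_ : (fun s => _) = (fun s => @sat _ exp n (map_tuple s l) phi)) //.
by apply/funext => s; rewrite map_tupleE.
Qed.

Lemma const_ord l : Ord (gaifman_eps U L) (gaifman_const U l).
Proof.
rewrite gval_const //; apply/(gval_ord hG hwc hU); [exact: dterm_var|exact: QU_var_ord].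
Qed.

Lemma const_lt l l' : ord_lt (gaifman_const U l : gaifman_eps U L) (gaifman_const U l') <-> (l < l')%O.
Proof.
have iE x y : @isin (gaifman_eps U L) (gaifman_const U x) (gaifman_const U y) <->
    QU U (fun s : L -> M => isin (s x) (s y)).
  by rewrite !gval_const // gval_in //; exact: dterm_var.
rewrite /ord_lt iE; split=> [h|]; last exact: QU_var_lt.
rewrite ltNge le_eqVlt; apply/negP => /orP[/eqP e|ll'].
  have [s] := QU_ex hG hU h; rewrite e; exact: (in_irr hG).
have [s []] := QU_ex hG hU (QU_and hG hU h (QU_var_lt hG hU ll')).
by move/(in_asym hG).
Qed.

Lemma const_inj (x y : L) : gaifman_const U x = gaifman_const U y -> x = y.
Proof.
rewrite !gval_const // => /(gval_eq hG hwc hU (dterm_var hG _) (dterm_var hG _)) xy.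
have ne (u v : L) : (u < v)%O -> QU U (fun s : L -> M => s u = s v) -> False.
  move=> uv e; have [s [se]] := QU_ex hG hU (QU_and hG hU e (QU_var_lt hG hU uv)).
  by rewrite se; exact: (in_irr hG).
case: (ltgtP x y) => // h; first by case: (ne _ _ h xy).
by case: (ne _ _ h (eqv_sym xy)).
Qed.

(** A support of least size.  By [drop_variable], no description can avoid one of
    its variables. *)
Lemma min_support (f : fn) : dterm f -> exists l (f' : fn),
  [/\ sorted <%O l, dterm f', fsupp [in l] f', QU U (fun s => f s = f' s) &
   forall l1 (f1 : fn), dterm f1 -> fsupp [in l1] f1 -> QU U (fun s => f s = f1 s) ->
     size l <= size (undup l1)].
Proof.
move=> df.
pose P n := `[< exists l (f' : fn), [/\ sorted <%O l, dterm f', fsupp [in l] f',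
  QU U (fun s => f s = f' s) & size l = n] >].
have Pn l1 (f1 : fn) : dterm f1 -> fsupp [in l1] f1 -> QU U (fun s => f s = f1 s) ->
    P (size (undup l1)).
  move=> d1 s1 q1; apply/asboolP; exists (sortl l1), f1; split=> //.
  - exact: sortl_sorted.
  - by apply: fsuppW s1 => v; rewrite mem_sortl.
  - by rewrite size_sort.
have exP : exists n, P n.
  have [l0 s0] := dterm_fsupp df; exists (size (undup l0)); apply: Pn s0 _ => //.
  exact: eqv_refl.
case: (ex_minnP exP) => n /asboolP[l [f' [sl d0 s0 q0 <-]]] nm.
by exists l, f'; split=> // l1 f1 d1 s1 q1; apply: nm; exact: Pn q1.
Qed.

Lemma dfn_WL_param (q : seq L) (f : fn) (R : M -> M -> Prop) : def2 R -> dterm f ->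
  dfn (fun (s : option L -> M) (_ : set M) => WL U q (fun s' => R (s None) (f s')) (fun v => s (Some v))).
Proof.
move=> dR df.
have dW := @dfn_WL MA U hG hwc hU _ (map Some q) (fun s : option L -> M => R (s None) (f (fun v => s (Some v)))).
apply: dfn_iff (dW _) => [s Y|].
  apply: (@WL_ren MA U L (option L) Some q _ (fun s' => R (s None) (f s'))) => [x y []//|s'' ss].
  by rewrite ss.
by apply: (dfn2 (R := R)); [exact: dR|exact: dterm_var|exact: dterm_wk].
Qed.

(** The set coded by [f] is [{x | QU (x in f)}], a class as the quantifiers preserve
    definability.  Conversely the elements of [X] of rank below [c_l] form an
    element coding [X], because [c_l] is above the rank of every standard set. *)
Lemma gaifman_SSy : [set: L] !=set0 -> SSy (gaifman U L) = MA.
Proof.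
move=> [l0 _].
suff clE : [set X | exists c : eps_reduct (gaifman U L), X = [set x | isin (std (gaifman U L) x) c]] = A.
  rewrite /SSy clE; by case: (MA).
have stdE f x : dterm f -> @isin (eps_reduct (gaifman U L)) (std (gaifman U L) x) (gval U f) <->
    QU U (fun s => isin x (f s)).
  by move=> df; rewrite gval_std //; apply: gval_in => //; exact: dterm_const.
rewrite predeqE => X; split.
  move=> [c ->]; have [f df ->] := gval_surj hG hwc hU c.
  have [l1 sf1] := dterm_fsupp df; pose l := sortl l1.
  have sf : fsupp [in l] f by apply: fsuppW sf1 => v; rewrite mem_sortl.
  have E x : QU U (fun s => isin x (f s)) <-> WL U l (fun s => isin x (f s)) (fun=> pt MA).
    apply: QUE => //; first exact: sortl_sorted.
    by move=> s s' ss; rewrite (sf s s').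
  suff d1 : def1 (fun x => WL U l (fun s => isin x (f s)) (fun=> pt MA)).
    have := class_of_def1 hG d1; congr A; rewrite predeqE => x /=.
    by split=> [/E h|/(stdE _ _ df) h]; [exact/(stdE _ _ df)|exact/E].
  exact: (dfn_def1 (P := fun s Y x => WL U l (fun s' => isin x (f s')) s) (fun=> pt MA)
    (gbc_subsort hG (pt MA)) (dfn_WL_param l (@def2_in MA) df)).
move=> AX.
pose P a w := X w /\ isin (rank hG w) a.
have sP a : small (P a).
  apply: (small_sub hG (rank_lt_small hG (ord_rank hG a))); first by rewrite /P; def_tac.
  move=> w [_ wa]; have := rank_in hG wa; rewrite rank_ord //; exact: ord_rank.
have dF : dfun1 (fun a => mkset (P a)).
  apply: (dfn_iff (P := fun s _ => forall w, isin w (s false) <-> P (s true) w)).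
    by move=> s Y; rewrite mkset_uniq.
  by rewrite /P; dfn_tac.
pose f (s : L -> M) := mkset (P (s l0)).
have df : dterm f by apply: (dterm1 hG dF); exact: dterm_var.
exists (gval U f); rewrite predeqE => x; apply: iff_trans _ (iff_sym (stdE _ x df)).
have E s : isin x (f s) <-> X x /\ isin (rank hG x) (s l0) by exact: mksetP.
have dx : dfn (fun s (_ : set M) => isin x (f s)).
  by apply: dfn2; [exact: def2_in|exact: dterm_const|].
split=> [Xx|h]; last by have [s /E[]] := QU_ex hG hU h.
have h : QU U (fun s : L -> M => isin (rank hG x) (s l0)).
  apply/(QUE hG hU (l := [:: l0]) (fun=> pt MA)) => //.
    by move=> s s' ss; rewrite ss // inE.
  apply: UqS (Uq_tail hG hU (ord_rank hG x)) => a [oa ra] /=.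
  by rewrite /upd eqxx.
by apply: QUS h => // s h; apply/E.
Qed.

End OneOrder.

Section OneMap.
Context {d : Order.disp_t} {K : orderType d} {d' : Order.disp_t} {L : orderType d'}.
Variable i : K -> L.
Hypothesis hi : order_embedding i.

Lemma dfn_ord (f : (L -> M) -> M) : dterm f -> dfn (fun s (_ : set M) => Ord M (f s)).
Proof. by move=> df; apply: dfn1 => //; exact: def1_Ord. Qed.

Lemma dfn_rank_le (f g : (L -> M) -> M) : dterm f -> dterm g ->
  dfn (fun s (_ : set M) => rank_le (f s) (g s)).
Proof.
move=> df dg; apply: (dfn_iff (P := fun s _ => ord_le (rank hG (f s)) (rank hG (g s)))).
  by move=> s Y; rewrite (rank_leP hG).
rewrite /ord_le; apply: dfn_or; apply: dfn2 => //;
  by [exact: def2_in|exact: def2_eq|apply: dterm1 => //; exact: dfun1_rank].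
Qed.

Lemma QU_le_rank_le (l l' : L) : (l <= l')%O -> QU U (fun s : L -> M => rank_le (s l) (s l')).
Proof.
rewrite le_eqVlt => ll'.
have dr := dfn_rank_le (dterm_var hG l) (dterm_var hG l').
case/orP: ll' => [/eqP e|ll'].
  by apply: QU_all => // s; rewrite e; apply/(rank_leP hG); right.
apply: QUS (QU_var_lt hG hU ll') => // s h; apply/(rank_leP hG); left; exact: rank_in.
Qed.

(** If [i] is initial, its range is an initial part of any list of variables and
    [rank_le_support] applies; conversely [l <= i k] puts [c_l] below [c_(i k)],
    and [const_in_range] applies. *)
Lemma initial_rank_initial : initial_map i <->
  @rank_initial (gaifman_eps U K) (gaifman_eps U L) (gaifman_map U i).
Proof.
split=> [ini a b|ri l k lk].
  have [f df ->] := gval_surj hG hwc hU a; have [g dg ->] := gval_surj hG hwc hU b.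
  rewrite map_gval // gval_rank_le //; last exact: dterm_emb.
  move=> gf.
  have [lf sf] := dterm_fsupp df; have [lg sg] := dterm_fsupp dg.
  pose D : {pred L} := [pred l | `[< range i l >]].
  pose m := sortl (lg ++ map i lf); have sm : sorted <%O m by exact: sortl_sorted.
  have E : m = [seq x <- m | x \in D] ++ [seq x <- m | x \notin D].
    apply: sorted_split_down => // x y _ _ xy; rewrite !inE => -[k _ ky].
    by apply: (ini x k); rewrite ky; exact: ltW.
  have [|||h [dh sh gh]] := rank_le_support hG hwc hU (p := [seq x <- m | x \in D])
    (q := [seq x <- m | x \notin D]) (S := [in lg]) (dterm_emb i df) dg _ _ sg _ gf.
  - by rewrite -E.
  - apply: fsuppW (fsupp_emb (i := i) sf) => v vl; rewrite mem_filter mem_sortl mem_cat.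
    rewrite vl orbT andbT.
    by rewrite inE; case/mapP: vl => k _ ->; exists k.
  - by move=> v vl; rewrite -E mem_sortl mem_cat; apply/orP; left.
  have [|h' [dh' sh' hE]] := pull hi (T := predT) dh sh.
    move=> l; rewrite inE mem_filter mem_sortl mem_cat => /andP[ll].
    by rewrite ll /= andbT negbK inE => -[k _ ki]; exists k.
  have e : h = (fun s : L -> M => h' (fun k => s (i k))) by apply/funext => s.
  by exists (gval U h'); rewrite map_gval // -e; apply/gval_eq.
have [|a' e] := ri (gaifman_const U k) (gaifman_const U l).
  rewrite map_const // !gval_const // gval_rank_le //; try exact: dterm_var.
  exact: QU_le_rank_le.
exact: (const_in_range hi (esym e)).
Qed.

(** An inverse of [i] induces an inverse by functoriality, and elementary maps
    preserve the symbols.  Conversely surjectivity on constants gives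
    surjectivity of [i]. *)
Lemma iso_iff : order_isomorphism i <->
  @isomorphism _ (gaifman U K) (gaifman U L) (gaifman_map U i).
Proof.
split=> [[_ [j ij ji]]|[[g gi ig] _ _]].
  have hj : order_embedding j by move=> x y; rewrite -hi !ji.
  have ele := elementary_map hi.
  split.
  - exists (gaifman_map U j) => y.
      rewrite -[LHS]/((gaifman_map U j \o gaifman_map U i) y) -gaifman_comp //.
      by rewrite (_ : j \o i = id) ?gaifman_id //; apply/funext => x; exact: ij.
    rewrite -[LHS]/((gaifman_map U i \o gaifman_map U j) y) -gaifman_comp //.
    by rewrite (_ : i \o j = id) ?gaifman_id //; apply/funext => x; exact: ji.
  - move=> k f t.
    have := proj1 (ele k.+1 (Eq (Var S ord0) (@App S k.+1 k f (fun j => Var S (lift ord0 j))))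
      (tcons (fint f t) t)).
    have tE (N : structure S) (x : N) (u : k.-tuple N) :
        [tuple eval (tcons x u) (Var S (lift ord0 j0)) | j0 < k] = u.
      by apply: tuple_eq => m; rewrite tnth_mktuple /= tnth_tconsS.
    have mE : map_tuple (gaifman_map U i) (tcons (fint f t) t) =
        tcons (gaifman_map U i (fint f t)) (map_tuple (gaifman_map U i) t) by exact/val_inj.
    rewrite mE => H.
    have {}H : fint f t = fint f [tuple eval (tcons (fint f t : gaifman U K) t) (Var S (lift ord0 j0)) | j0 < k] ->
      gaifman_map U i (fint f t) = fint f [tuple eval (tcons (gaifman_map U i (fint f t) : gaifman U L)
        (map_tuple (gaifman_map U i) t)) (Var S (lift ord0 j0)) | j0 < k] by exact: H.
    by rewrite !tE in H; exact: H.
  - move=> k r t.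
    have := ele k (@Rel S k k r (fun j => Var S j)) t.
    have tE (N : structure S) (u : k.-tuple N) : [tuple eval u (Var S j0) | j0 < k] = u.
      by apply: tuple_eq => m; rewrite tnth_mktuple.
    by rewrite -[sat _ _]/(rint r _) -[sat (map_tuple _ _) _]/(rint r _) !tE.
split=> //.
have sur l : exists k, i k = l.
  by have [k _ kl] := const_in_range hi (ig (gaifman_const U l)); exists k.
have /choice[j jE] := sur.
by exists j => // k; apply: (emb_inj hi); rewrite jE.
Qed.

(** If [l0] is above the range, it is quantified last, and almost all its values are
    above the value of [f], which is fixed by then. *)
Lemma bounded_iff (l0 : L) : (forall k, (i k < l0)%O) <->
  (forall x, Ord (gaifman_eps U K) x -> ord_lt (gaifman_map U i x) (gaifman_const U l0)).
Proof.
split=> [hl x|H k]; last first.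
  have := H _ (const_ord k); rewrite map_const //; exact: (proj1 (const_lt _ _)).
have [f df ->] := gval_surj hG hwc hU x; rewrite gval_ord // => fo.
rewrite map_gval // gval_const // /ord_lt gval_in //; [|exact: dterm_emb|exact: dterm_var].
have [l1 sf1] := dterm_fsupp df; pose l := sortl l1; have sl : sorted <%O l by exact: sortl_sorted.
have sf : fsupp [in l] f by apply: fsuppW sf1 => v; rewrite mem_sortl.
have do_ : dfn (fun s (_ : set M) => Ord M (f s)).
  by apply: dfn1 => //; exact: def1_Ord.
have sl' : sorted <%O (map i l ++ [:: l0]).
  apply: sorted_cat1; last by move=> _ /mapP[k _ ->].
  by apply: (sub_sorted_map hi).
have sfi := fsupp_emb (i := i) sf.
have /(QUE hG hU (l := map i l ++ [:: l0]) (fun=> pt MA)) : QU U (fun s : L -> M => Ord M (f (fun k => s (i k)))).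
  exact/(QU_embed hG hU hi do_).
move=> /(_ sl') W.
have {}W : WL U (map i l ++ [:: l0]) (fun s : L -> M => Ord M (f (fun k => s (i k)))) (fun=> pt MA).
  by apply: W => s s' ss; rewrite (sfi s s') // => v vl; apply: ss; rewrite mem_cat; apply/orP; left.
apply/(QUE hG hU (l := map i l ++ [:: l0]) (fun=> pt MA)) => //.
  move=> s s' ss; rewrite (sfi s s') ?(ss l0) // => [|v vl]; first by rewrite mem_cat mem_seq1 eqxx orbT.
  by apply: ss; rewrite mem_cat; apply/orP; left.
move: W; rewrite !WL_cat; apply: WLS => s /= W.
have uE a : (fun k => upd s l0 a (i k)) = (fun k => s (i k)).
  by apply/funext => k; rewrite /upd lt_eqF.
have {}W : Ord M (f (fun k => s (i k))).
  by apply/(Uq_const hG hU); apply: UqS W => a; rewrite uE.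
apply: UqS (Uq_tail hG hU W) => a [oa fa].
by rewrite uE /upd eqxx.
Qed.

Lemma QU_tri (f g : (L -> M) -> M) : dterm f -> dterm g ->
  QU U (fun s => Ord M (f s)) -> QU U (fun s => Ord M (g s)) ->
  [\/ QU U (fun s => isin (f s) (g s)), QU U (fun s => f s = g s) | QU U (fun s => isin (g s) (f s))].
Proof.
move=> df dg of_ og.
have d1 : dfn (fun s (_ : set M) => isin (f s) (g s)) by apply: dfn2 => //; exact: def2_in.
have d2 : dfn (fun s (_ : set M) => isin (g s) (f s)) by apply: dfn2 => //; exact: def2_in.
have [h1|h1] := QU_ultra hG hwc hU d1; first by constructor 1.
have [h2|h2] := QU_ultra hG hwc hU (dfn_eqf hG df dg); first by constructor 2.
constructor 3; apply: QUS (QU_and hG hU (QU_and hG hU h1 h2) (QU_and hG hU of_ og)) => // s.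
by move=> [[n1 n2] [o1 o2]]; case: (ord_tri hG o1 o2).
Qed.

(** Let [a] be the first variable outside the range of [i] on which [g] depends, and
    [b] a smaller element outside the range.  If [g] were below [c_b], it would
    depend on variables up to [b] only, by [rank_le_support]; all of these are in
    the range, and so [g] would be. *)
Lemma cofinal_below :
  ~ (exists2 l, (~` range i) l & forall l', (~` range i) l' -> (l <= l')%O) ->
  downward_cofinal (gaifman_const U (L := L) @` (~` range i))
   (Ord (gaifman_eps U L) `\`
    gaifman_map U (@suborder_incl d' L (range i)) @` Ord (gaifman_eps U (suborder (range i)))).
Proof.
move=> nomin; pose j := @suborder_incl d' L (range i).
have hj : order_embedding j by move=> x y.
have rj l : range i l -> exists k, j k = l.
  move=> il; have ml : l \in range i by rewrite inE.
  by exists (exist _ l ml).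
split=> [_ [l nl <-]|y [oy ny]].
  split; first exact: const_ord.
  move=> [x _ e]; have [k _ kl] := const_in_range hj e.
  by apply: nl; rewrite -kl; have := valP k; rewrite inE.
have [g dg yE] := gval_surj hG hwc hU y; rewrite {}yE in oy ny *.
have og := proj1 (gval_ord hG hwc hU dg) oy.
have inimage (h : (L -> M) -> M) (S0 : {pred L}) : dterm h -> fsupp S0 h -> QU U (fun s => g s = h s) ->
    (forall l, l \in S0 -> range i l) -> False.
  move=> dh sh gh S0i.
  have [|h' [dh' _ hE]] := pull hj (T := predT) dh sh.
    by move=> l /S0i/rj[k kl]; exists k.
  have e : h = (fun s : L -> M => h' (fun k => s (j k))) by apply/funext => s.
  have e2 : gval U g = gaifman_map U j (gval U h') by rewrite map_gval // -e; apply/gval_eq.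
  apply: ny; exists (gval U h') => //.
  apply/(gval_ord hG hwc hU dh').
  have dh'o : dfn (fun s (_ : set M) => Ord M (h' s)) by apply: dfn1 => //; exact: def1_Ord.
  apply/(QU_embed hG hU hj dh'o).
  have dho : dfn (fun s (_ : set M) => Ord M (h s)) by exact: dfn_ord.
  have : QU U (fun s => Ord M (h s)) by apply: QUS (QU_and hG hU gh og) => // s [<-].
  by rewrite {1}e.
have [l1 sg1] := dterm_fsupp dg; pose l := sortl l1; have sl : sorted <%O l by exact: sortl_sorted.
have sg : fsupp [in l] g by apply: fsuppW sg1 => v; rewrite mem_sortl.
have [a [al na amin]] : exists a, [/\ a \in l, ~ range i a & forall v, v \in l -> (v < a)%O -> range i v].
  case E: [seq v <- l | `[< ~ range i v >]] => [|a r].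
    exfalso; apply: (inimage g [in l]) => //; first exact: eqv_refl.
    move=> v vl; apply: contrapT => nv.
    have : v \in [seq v <- l | `[< ~ range i v >]] by rewrite mem_filter vl andbT; apply/asboolP.
    by rewrite E.
  have : a \in [seq v <- l | `[< ~ range i v >]] by rewrite E mem_head.
  rewrite mem_filter => /andP[/asboolP na al]; exists a; split=> // v vl va.
  apply: contrapT => nv.
  have : v \in [seq v <- l | `[< ~ range i v >]] by rewrite mem_filter vl andbT; apply/asboolP.
  have sr : sorted <%O (a :: r) by rewrite -E; apply: sorted_filter => //; exact: lt_trans.
  rewrite E in_cons => /orP[/eqP ev|vr]; first by rewrite ev ltxx in va.
  have /allP/(_ v vr) av := order_path_min lt_trans sr.
  by have := lt_trans va av; rewrite ltxx.
have [b nb ba] : exists2 b, ~ range i b & (b < a)%O.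
  apply: contrapT => N; apply: nomin; exists a => // c nc.
  by rewrite leNgt; apply/negP => ca; apply: N; exists c.
exists (gaifman_const U b); first by exists b.
rewrite /ord_le gval_const //.
have dv := dterm_var hG b.
case: (QU_tri dv dg (QU_var_ord hG hU b) og) => h.
- by left; apply/gval_in.
- by right; apply/gval_eq.
exfalso.
have hr : QU U (fun s => rank_le (g s) (s b)).
  apply: QUS h => //; first exact: dfn_rank_le.
  by move=> s gb; apply/(rank_leP hG); left; exact: rank_in.
pose D : {pred L} := [pred v | (v <= b)%O].
pose m := sortl (b :: l); have sm : sorted <%O m by exact: sortl_sorted.
have E : m = [seq x <- m | x \in D] ++ [seq x <- m | x \notin D].
  apply: sorted_split_down => // u v _ _ uv; rewrite !inE; exact: le_trans (ltW uv).
have sub v : v \in b :: l -> v \in m by rewrite mem_sortl.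
have [|||h' [dh' sh' gh']] := rank_le_support hG hwc hU (p := [seq x <- m | x \in D])
    (q := [seq x <- m | x \notin D]) (S := [in l]) dv dg _ _ sg _ hr.
- by rewrite -E.
- by move=> s s'; apply; rewrite mem_filter sub ?mem_head // andbT inE.
- by move=> v vl; rewrite -E; apply: sub; rewrite in_cons; apply/orP; right.
apply: (inimage h' _ dh' sh' gh') => v; rewrite inE mem_filter => /andP[vl].
have vm : v \in m by apply: sub; rewrite in_cons; apply/orP; right.
rewrite vm andbT negbK inE => vb; apply: amin => //; exact: le_lt_trans vb ba.
Qed.

(** Let [l] be a least support of [g], and suppose that the two images of [g]
    agree.  Their supports are [map j l] and [map j' l]; a variable in the first
    outside the second could be dropped, against minimality.  Thus these lists
    have the same members, and as both are increasing, [j] and [j'] agree on [l],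
    so that [l] is in the range of [i]. *)
Lemma equalizer_iff d1 (L' : orderType d1) (j j' : L -> L') :
  order_embedding j -> order_embedding j' ->
  equalizer i j j' <-> equalizer (gaifman_map U i) (gaifman_map U j) (gaifman_map U j').
Proof.
move=> hj hj'; split=> [eq|eq].
  rewrite /equalizer predeqE => y; split=> [[x _ <-]|].
    have [f df ->] := gval_surj hG hwc hU x; rewrite /= !map_gval //; try exact: dterm_emb.
    congr gval; apply/funext => s; congr f; apply/funext => k; congr s.
    have : [set y | j y = j' y] (i k) by rewrite -eq; exists k.
    by [].
  have [g0 dg0 ->] := gval_surj hG hwc hU y; rewrite /= !map_gval // => e.
  have [l [g [sl dg sg gg gmin]]] := min_support dg0.
  have eg : gval U g0 = gval U g by apply/gval_eq.
  have {e} e : QU U (fun s : L' -> M => g (fun v => s (j v)) = g (fun v => s (j' v))).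
    apply/(gval_eq hG hwc hU (dterm_emb j dg) (dterm_emb j' dg)).
    by rewrite -(map_gval hj dg) -(map_gval hj' dg) -eg !map_gval.
  have sub x : x \in map j l -> x \in map j' l.
    move=> xl; apply: contrapT => /negP nx.
    have [h [dh sh gh]] := drop_variable hG hwc hU (dterm_emb j dg) (dterm_emb j' dg)
      (fsupp_emb (i := j) sg) (fsupp_emb (i := j') sg) nx e.
    have /mapP[x0 x0l xE] := xl.
    have [|h' [dh' sh' hE]] := pull hj (T := [in rem x0 l]) dh sh.
      move=> z; rewrite inE => /andP[/mapP[z0 z0l ->] zx]; exists z0 => //.
      rewrite unfold_in /= mem_rem_uniq ?sorted_uniq_lt // inE z0l andbT.
      by apply: contraNneq zx => ->; rewrite xE.
    have e' : h = (fun s : L' -> M => h' (fun k => s (j k))) by apply/funext => s.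
    rewrite e' in gh; have {}gh := proj1 (QU_emb_eq hj dg dh') gh.
    have := gmin _ h' dh' sh'; rewrite undup_id ?rem_uniq ?sorted_uniq_lt // size_rem //.
    have q2 : QU U (fun s => g0 s = h' s) by exact: eqv_trans gg gh.
    move=> /(_ q2); case: (l) x0l => //= a r _; by rewrite ltnn.
  have sm (j0 : L -> L') : order_embedding j0 -> sorted <%O (map j0 l).
    by move=> h0; apply: (sub_sorted_map h0).
  have mapE : map j l = map j' l.
    apply: lt_sorted_eq; [exact: sm|exact: sm|].
    have uj : uniq (map j l) by apply: sorted_uniq_lt; exact: sm.
    have szj : size (map j' l) <= size (map j l) by rewrite !size_map.
    by have [_] := uniq_min_size uj sub szj.
  have jj v : v \in l -> j v = j' v by move/eq_in_map: mapE; apply.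
  have [|h' [dh' sh' hE]] := pull hi (T := predT) dg sg.
    move=> v vl; have : range i v by rewrite eq; exact: jj.
    by move=> [k _ kv]; exists k.
  have e' : g = (fun s : L -> M => h' (fun k => s (i k))) by apply/funext => s.
  by exists (gval U h') => //; rewrite map_gval // -e' eg.
rewrite /equalizer predeqE => l; split=> [[k _ <-]|e].
  have : [set y | gaifman_map U j y = gaifman_map U j' y] (gaifman_const U (i k)).
    by rewrite -eq -map_const //; exists (gaifman_const U k).
  rewrite /= !map_const // => ec.
  exact: const_inj ec.
have : range (gaifman_map U i) (gaifman_const U l).
  by rewrite eq /= !map_const // e.
by move=> [x _ xe]; exact: (const_in_range hi xe).
Qed.

End OneMap.

(** Let [k] be the last variable of a least support of [f], which is
    non-empty because the ordinal is not standard.  If the image under [i'] were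
    not above the image under [i], which is supported strictly below [i' k], then
    by [rank_le_support] it would not depend on [i' k], and [k] could be dropped. *)
Lemma map_lt_iff d (K : orderType d) d' (L : orderType d') (i i' : K -> L) :
  order_embedding i -> order_embedding i' ->
  (forall k, (i k < i' k)%O) <->
  (forall x, (Ord (gaifman_eps U K) `\` @std MA (gaifman U K) @` Ord MA) x ->
     ord_lt (gaifman_map U i x) (gaifman_map U i' x)).
Proof.
move=> hi hi'; split=> [ii x [ox nx]|H k]; last first.
  have := H (gaifman_const U k); rewrite !map_const // => H'; apply/const_lt; apply: H'.
  split; first exact: const_ord.
  move=> [a oa]; rewrite gval_std // gval_const // => /(gval_eq hG hwc hU (dterm_const hG _ _) (dterm_var hG _)).
  move=> /eqv_sym; apply: (var_not_in_support hG hU (S := [::])) => //; exact: dterm_const.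
have [f0 df0 xE] := gval_surj hG hwc hU x.
have [l [f [sl df sf ff fmin]]] := min_support df0.
have ef : x = gval U f by rewrite xE; apply/gval_eq.
rewrite {}ef in ox nx *.
have of_ := proj1 (gval_ord hG hwc hU df) ox.
rewrite !map_gval // /ord_lt gval_in //; try exact: dterm_emb.
have dfo : dfn (fun s (_ : set M) => Ord M (f s)) by exact: dfn_ord.
have o1 := proj2 (QU_embed hG hU hi dfo) of_; have o2 := proj2 (QU_embed hG hU hi' dfo) of_.
apply: contrapT => nlt.
have hr : QU U (fun s : L -> M => rank_le (f (fun k => s (i' k))) (f (fun k => s (i k)))).
  have dr := dfn_rank_le (dterm_emb i' df) (dterm_emb i df).
  case: (QU_tri (dterm_emb i df) (dterm_emb i' df) o1 o2) => // h.
    by apply: QUS h => // s h; apply/(rank_leP hG); right; rewrite h.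
  by apply: QUS h => // s h; apply/(rank_leP hG); left; exact: rank_in.
case/lastP: l sl sf fmin => [|l k] sl sf fmin.
  apply: nx; exists (f (fun=> pt MA)).
    have [s fs] := QU_ex hG hU of_; by rewrite (sf _ s).
  rewrite gval_std //; apply/gval_eq => //; first exact: dterm_const.
  have dc : dterm (fun _ : K -> M => f (fun=> pt MA)) by exact: dterm_const.
  by apply: QU_all (dfn_eqf hG dc df) _ => // s; exact: sf.
have lk v : v \in l -> (v < k)%O.
  by move=> vl; move: sl; rewrite (sorted_pairwise lt_trans) pairwise_rcons => /andP[/allP/(_ v vl)].
pose D : {pred L} := [pred v | (v < i' k)%O].
pose m := sortl (map i (rcons l k) ++ map i' (rcons l k)); have sm : sorted <%O m by exact: sortl_sorted.
have E : m = [seq x <- m | x \in D] ++ [seq x <- m | x \notin D].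
  apply: sorted_split_down => // u v _ _ uv; rewrite !inE; exact: lt_trans uv.
have [|||h [dh sh gh]] := rank_le_support hG hwc hU (p := [seq x <- m | x \in D])
    (q := [seq x <- m | x \notin D]) (S := [in map i' (rcons l k)])
    (dterm_emb i df) (dterm_emb i' df) _ _ (fsupp_emb (i := i') sf) _ hr.
- by rewrite -E.
- apply: fsuppW (fsupp_emb (i := i) sf) => v vl; rewrite mem_filter mem_sortl mem_cat vl /= andbT.
  case/mapP: vl => u; rewrite mem_rcons in_cons inE => /orP[/eqP -> ->|ul ->] //.
  by apply: lt_trans (ii k); rewrite emb_lt //; exact: lk.
- by move=> v vl; rewrite -E mem_sortl mem_cat; apply/orP; right.
have [|h' [dh' sh' hE]] := pull hi' (T := [in l]) dh sh.
  move=> v; rewrite inE mem_filter mem_sortl mem_cat => /andP[vl].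
  rewrite vl orbT andbT negbK inE; case/mapP: vl => u ul ->; rewrite emb_lt // => uk.
  exists u => //; move: ul; rewrite mem_rcons in_cons => /orP[/eqP ue|//].
  by rewrite ue ltxx in uk.
have e' : h = (fun s : L -> M => h' (fun k => s (i' k))) by apply/funext => s.
rewrite e' in gh; have {}gh := proj1 (QU_emb_eq hi' df dh') gh.
have := fmin _ h' dh' sh' (eqv_trans hG hU df0 dh' ff gh).
rewrite size_rcons leqNgt ltnS; apply/negP; rewrite negbK; exact: size_undup.
Qed.

End Gaifman.

(** * Squares of infinite cardinals *)

Lemma injective_card_le T T' (f : T -> T') : injective f -> [set: T] #<= [set: T'].
Proof.
move=> fi; have e : f @` [set: T] #= [set: T] by apply: inj_card_eq => x y _ _ /fi.
move: e; rewrite card_eq_le => /andP[_ h].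
by apply: card_le_trans h _; exact: subset_card_le.
Qed.

Section Square.
Variable X : Type.
Implicit Types (B C : set X).

Definition inj_on B C (f : X -> X) :=
  (forall x, B x -> C (f x)) /\ (forall x y, B x -> B y -> f x = f y -> x = y).

(** A maximal partial injection, from Zorn's lemma, is everywhere defined or onto. *)
Lemma comparability B C : (exists f, inj_on B C f) \/ (exists f, inj_on C B f).
Proof.
pose P (G : set (X * X)) := [/\ forall x y, G (x, y) -> B x /\ C y,
  forall x y y', G (x, y) -> G (x, y') -> y = y' &
  forall x x' y, G (x, y) -> G (x', y) -> x = x'].
have [|G [[GBC Gf Gi] Gmax]] := @Zorn_bigcup _ P.
  move=> F FP Ftot.
  have two p p' : (\bigcup_(X0 in F) X0) p -> (\bigcup_(X0 in F) X0) p' ->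
      exists G, [/\ P G, G p & G p'].
    move=> [G FG Gp] [G' FG' Gp'].
    by case: (Ftot _ _ FG FG') => GG; [exists G'|exists G]; split=> //; by [exact: FP|exact: GG].
  split=> [x y [G /FP[GBC _ _] /GBC//]|x y y' h h'|x x' y h h'].
    by have [G [[_ Gf _] h1 h2]] := two _ _ h h'; exact: Gf h1 h2.
  by have [G [[_ _ Gi] h1 h2]] := two _ _ h h'; exact: Gi h1 h2.
have [Bdom|Bdom] := pselect (forall x, B x -> exists y, G (x, y)).
  left; have /choice[f fE] x : exists y, B x -> G (x, y).
    have [/Bdom[y xy]|nB] := pselect (B x); first by exists y.
    by exists x.
  exists f; split=> [x /fE/GBC[]//|x y Bx By e].
  by have := fE y By; rewrite -e; exact: Gi (fE x Bx).
have [Cran|Cran] := pselect (forall y, C y -> exists x, G (x, y)).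
  right; have /choice[f fE] y : exists x, C y -> G (x, y).
    have [/Cran[x xy]|nC] := pselect (C y); first by exists x.
    by exists y.
  exists f; split=> [x /fE/GBC[]//|x y Cx Cy e].
  by have := fE y Cy; rewrite -e; exact: Gf (fE x Cx).
exfalso; have /existsNP[x /not_implyP[Bx nx]] := Bdom.
have /existsNP[y /not_implyP[Cy ny]] := Cran.
apply: (Gmax (G `|` [set (x, y)])).
  split; first by left.
  by move=> /(_ (x, y)) h; apply: nx; exists y; apply: h; right.
have inv u v : (G `|` [set (x, y)]) (u, v) -> G (u, v) \/ u = x /\ v = y.
  by case=> [|[-> ->]]; [left|right].
split=> [u v /inv[/GBC//|[-> ->]]//|u v v' /inv h /inv h'|u u' v /inv h /inv h'].
  case: h h' => [h|[-> ->]] [h'|[e ->]] //; first exact: Gf h h'.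
  - by case: nx; exists v; rewrite -e.
  - by case: nx; exists v'.
case: h h' => [h|[-> ->]] [h'|[-> e]] //; first exact: Gi h h'.
- by case: ny; exists u; rewrite -e.
- by case: ny; exists u'.
Qed.

Variable e : nat -> X.
Hypothesis e_inj : injective e.

(** Graphs of injections of a square [B * B] into [B], where [B] contains a given
    countable set. *)
Definition square_graph (G : set (X * X * X)) := exists B : set X,
  [/\ forall n, B (e n),
      forall x y, B x -> B y -> exists2 z, B z & G (x, y, z),
      forall x y z, G (x, y, z) -> [/\ B x, B y & B z],
      forall p z z', G (p, z) -> G (p, z') -> z = z' &
      forall p p' z, G (p, z) -> G (p', z) -> p = p'].

(** The pairing of natural numbers, kept inside all graphs considered so that
    Zorn's lemma starts from an infinite [B]. *)
Definition base_graph : set (X * X * X) :=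
  [set t | exists m n, t = (e m, e n, e (pickle (m, n)))].

Lemma square_base : square_graph base_graph.
Proof.
exists (range e); split.
- by move=> n; exists n.
- move=> _ _ [m _ <-] [n _ <-]; exists (e (pickle (m, n))); first by exists (pickle (m, n)).
  by exists m, n.
- by move=> x y z [m [n [-> -> ->]]]; split; by [exists m|exists n|exists (pickle (m, n))].
- move=> [x y] z z' [m [n [-> -> ->]]] [m' [n' [/e_inj -> /e_inj -> ->]]]//.
- move=> [x y] [x' y'] z [m [n [-> -> ->]]] [m' [n' [-> -> /e_inj]]].
  by move=> /(pcan_inj pickleK)[-> ->].
Qed.

(** Take a maximal [B].  If the complement of [B] injects into [B], two copies of
    [B] cover the type and [B * B] has room for them.  Otherwise the
    complement contains a disjoint copy of [B], into which the three new parts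
    of the square of the union can be mapped, against maximality. *)
Lemma square_injection : exists f : X * X -> X, injective f.
Proof.
pose P G := square_graph (G `|` base_graph).
have [|G [[B [Be BG GB Gf Gi]] Gmax]] := @Zorn_bigcup _ P.
  move=> F FP Ftot.
  have [[G0 FG0]|F0] := pselect (F !=set0); last first.
    suff -> : \bigcup_(X0 in F) X0 = set0 by rewrite /P set0U; exact: square_base.
    by rewrite predeqE => t; split=> // -[G FG _]; case: F0; exists G.
  have /choice[BF BFP] G : exists B : set X, F G ->
     [/\ forall n, B (e n),
      forall x y, B x -> B y -> exists2 z, B z & (G `|` base_graph) (x, y, z),
      forall x y z, (G `|` base_graph) (x, y, z) -> [/\ B x, B y & B z],
      forall p z z', (G `|` base_graph) (p, z) -> (G `|` base_graph) (p, z') -> z = z' &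
      forall p p' z, (G `|` base_graph) (p, z) -> (G `|` base_graph) (p', z) -> p = p'].
    have [/FP[B HB]|nF] := pselect (F G); first by exists B.
    by exists set0.
  have up G : F G -> (G `|` base_graph) `<=` (\bigcup_(X0 in F) X0) `|` base_graph.
    by move=> FG t [Gt|bt]; [left; exists G|right].
  have one t : ((\bigcup_(X0 in F) X0) `|` base_graph) t -> exists2 G, F G & (G `|` base_graph) t.
    by move=> [[G FG Gt]|bt]; [exists G => //; left|exists G0 => //; right].
  have mono G G' : F G -> F G' -> G `<=` G' -> BF G `<=` BF G'.
    move=> FG FG' GG x Bx; have [_ h _ _ _] := BFP G FG.
    have [z _ xz] := h x x Bx Bx; have [_ _ h' _ _] := BFP G' FG'.
    by have [] := h' x x z; first by case: xz => [/GG|]; [left|right].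
  have two t t' : ((\bigcup_(X0 in F) X0) `|` base_graph) t ->
      ((\bigcup_(X0 in F) X0) `|` base_graph) t' ->
      exists G, [/\ F G, (G `|` base_graph) t & (G `|` base_graph) t'].
    move=> /one[G FG Gt] /one[G' FG' Gt'].
    case: (Ftot _ _ FG FG') => GG; [exists G'|exists G]; split=> //.
      by case: Gt => [/GG|]; [left|right].
    by case: Gt' => [/GG|]; [left|right].
  exists (\bigcup_(G in F) BF G); split.
  - by move=> n; exists G0 => //; have [] := BFP G0 FG0.
  - move=> x y [G FG Gx] [G' FG' Gy].
    have [G1 [FG1 x1 y1]] : exists G1, [/\ F G1, BF G1 x & BF G1 y].
      case: (Ftot _ _ FG FG') => GG.
        by exists G'; split=> //; exact: mono GG _ Gx.
      by exists G; split=> //; exact: mono GG _ Gy.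
    have [_ h _ _ _] := BFP G1 FG1; have [z Bz xyz] := h x y x1 y1.
    by exists z; [exists G1|exact: up FG1 _ xyz].
  - move=> x y z /one[G FG Gt]; have [_ _ h _ _] := BFP G FG.
    by have [? ? ?] := h x y z Gt; split; exists G.
  - move=> p z z' h h'; have [G [FG Gt Gt']] := two _ _ h h'.
    by have [_ _ _ hf _] := BFP G FG; exact: hf Gt Gt'.
  - move=> p p' z h h'; have [G [FG Gt Gt']] := two _ _ h h'.
    by have [_ _ _ _ hi] := BFP G FG; exact: hi Gt Gt'.
pose H := G `|` base_graph.
have [f fE] : exists f : X * X -> X, forall x y, B x -> B y -> B (f (x, y)) /\ H (x, y, f (x, y)).
  have /choice[f fE] (p : X * X) : exists z, B p.1 -> B p.2 -> B z /\ H (p, z).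
    have [[B1 B2]|nB] := pselect (B p.1 /\ B p.2).
      by have [z Bz pz] := BG _ _ B1 B2; exists z; case: p pz {B1 B2}.
    by exists p.1 => B1 B2; case: nB.
  by exists f => x y; exact: (fE (x, y)).
have fB x y : B x -> B y -> B (f (x, y)) by move=> Bx By; have [] := fE x y Bx By.
have f_inj x y x' y' : B x -> B y -> B x' -> B y' -> f (x, y) = f (x', y') -> x = x' /\ y = y'.
  move=> Bx By Bx' By' ff; have [_ h] := fE x y Bx By; have [_ h'] := fE x' y' Bx' By'.
  by rewrite -ff in h'; have [-> ->] := Gi _ _ _ h h'.
have tag n m x y : B x -> B y -> f (x, e n) = f (y, e m) -> n = m /\ x = y.
  by move=> Bx By /f_inj[] // -> /e_inj.
case: (comparability (~` B) B) => -[g [gB g_inj]].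
  pose h x := if pselect (B x) then f (x, e 0) else f (g x, e 1).
  have hB x : B (h x) by rewrite /h; case: pselect => Bx; apply: fB => //; exact: gB.
  have h_inj : injective h.
    move=> x y; rewrite /h; case: pselect => Bx; case: pselect => By.
    - by move=> /tag[].
    - by move=> /tag[] //; exact: gB.
    - by move=> /tag[] //; exact: gB.
    - by move=> /tag[|//|_]; [exact: gB|exact: gB|exact: g_inj].
  exists (fun p => f (h p.1, h p.2)) => -[x y] [x' y'] /= /f_inj[] // /h_inj -> /h_inj ->.
  by [].
exfalso.
pose D := g @` B.
have DB x : D x -> ~ B x by move=> [y By <-]; exact: gB.
pose B' := B `|` D.
have /choice[k kE] x : exists y, D x -> B y /\ g y = x.
  by have [[y By <-]|nD] := pselect (D x); [exists y|exists x].
pose r x := if pselect (B x) then x else k x.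
have rB x : B' x -> B (r x).
  by rewrite /r; case: pselect => // nB [//|/kE[]].
(* The tag says which of the coordinates are new, as [r] forgets it. *)
pose t x y := if pselect (B x) then 0 else if pselect (B y) then 1 else 2.
have r_inj x x' : B' x -> B' x' -> (B x <-> B x') -> r x = r x' -> x = x'.
  rewrite /r; case: pselect => Bx; case: pselect => Bx' /=.
  - by [].
  - by move=> _ _ [b1 _]; case: (Bx' (b1 Bx)).
  - by move=> _ _ [_ b2]; case: (Bx (b2 Bx')).
  - by move=> [//|/kE[_ gx]] [//|/kE[_ gx']] _ kk; rewrite -gx -gx' kk.
pose w x y := g (f (f (r x, r y), e (t x y))).
have wD x y : B' x -> B' y -> D (w x y).
  by move=> hx hy; exists (f (f (r x, r y), e (t x y))) => //; apply: (fB _ _ _ (Be _)); apply: (fB); exact: rB.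
pose N := [set z : X * X * X | [/\ B' z.1.1, B' z.1.2, ~ (B z.1.1 /\ B z.1.2) & z.2 = w z.1.1 z.1.2]].
have NH x y z : N (x, y, z) -> H (x, y, z) -> False.
  by move=> [_ _ nB _] /GB[Bx By _]; apply: nB.
apply: (Gmax (G `|` N)).
  split; first by left.
  move=> sub; have Dg : D (g (e 0)) by exists (e 0).
  have Nt : N (g (e 0), g (e 0), w (g (e 0)) (g (e 0))).
    split=> //=; [by right|by right|by move=> [/(DB _ Dg)]].
  by apply: NH (Nt) _; left; apply: sub; right.
have split z : ((G `|` N) `|` base_graph) z <-> H z \/ N z.
  by split=> [[[|]|]|[[|]|]]; [left; left|right|left; right|left; left|right|left; right].
exists B'; split.
- by move=> n; left.
- move=> x y hx hy; have [[Bx By]|nB] := pselect (B x /\ B y).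
    have [Bf Hf] := fE x y Bx By; exists (f (x, y)); first by left.
    by apply/split; left.
  by exists (w x y); [right; exact: wD|apply/split; right].
- move=> x y z /split[/GB[Bx By Bz]|[/= hx hy _ ->]]; first by split; left.
  by split=> //; right; exact: wD.
- move=> [x y] z z' /split[h|h] /split[h'|h'].
  + exact: Gf h h'.
  + by case: (NH _ _ _ h' _); have [_ _ nB _] := h'; have [Bx By _] := GB _ _ _ h; case: nB.
  + by have [_ _ nB _] := h; have [Bx By _] := GB _ _ _ h'; case: nB.
  + by case: h => /= _ _ _ ez; case: h' => /= _ _ _ ez'; rewrite ez ez'.
- move=> [x y] [x' y'] z /split[h|h] /split[h'|h'].
  + exact: Gi h h'.
  + have [_ _ Bz] := GB _ _ _ h; have [/= hx hy _ e'] := h'.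
    by case: (DB z) => //; rewrite e'; exact: wD.
  + have [_ _ Bz] := GB _ _ _ h'; have [/= hx hy _ e'] := h.
    by case: (DB z) => //; rewrite e'; exact: wD.
  case: h => /= hx hy nB ez; case: h' => /= hx' hy' nB' ez'.
  have ww : w x y = w x' y' by rewrite -ez.
  have Bw u v : B' u -> B' v -> B (f (r u, r v)) by move=> hu hv; apply: fB; exact: rB.
  have {}ww := g_inj _ _ (fB _ _ (Bw x y hx hy) (Be _)) (fB _ _ (Bw x' y' hx' hy') (Be _)) ww.
  have [tt rr] := tag _ _ _ _ (Bw x y hx hy) (Bw x' y' hx' hy') ww.
  have [rx ry] := f_inj _ _ _ _ (rB _ hx) (rB _ hy) (rB _ hx') (rB _ hy') rr.
  have [bx by_] : (B x <-> B x') /\ (B y <-> B y').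
    move: tt nB nB'; rewrite /t /=.
    by case: (pselect (B x)) => b1; case: (pselect (B x')) => b2;
       case: (pselect (B y)) => b3; case: (pselect (B y')) => b4 //= _; tauto.
  by rewrite (r_inj _ _ hx hx' bx rx) (r_inj _ _ hy hy' by_ ry).
Qed.

End Square.

Lemma seq_injection (X : Type) (e : nat -> X) : injective e ->
  exists f : seq X * nat -> X, injective f.
Proof.
move=> ei; have [pr pr_inj] := square_injection ei.
have pr2 x y x' y' : pr (x, y) = pr (x', y') -> x = x' /\ y = y'.
  by move=> /pr_inj[-> ->].
pose enc (s : seq X) := foldr (fun x r => pr (x, r)) (e 0) s.
have enc_inj s s' : size s = size s' -> enc s = enc s' -> s = s'.
  elim: s s' => [|x s IH] [|x' s'] //= [ss'] /pr2[-> /(IH _ ss') ->].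
  by [].
exists (fun p => pr (pr (e (size p.1), enc p.1), e p.2)) => -[s n] [s' n'] /=.
by move=> /pr2[/pr2[/ei ss /(enc_inj _ _ ss) ->] /ei ->].
Qed.

(** * The cardinality of the Gaifman models *)

Section Cardinality.
Variable MA : class_structure.
Local Notation M := (set_part MA).
Local Notation A := (@classes MA).
Variable U : set (set MA).
Hypotheses (hG : GBC MA) (hwc : Ord_weakly_compact MA)
  (hU : generic_ultrafilter MA U) (hA : countable A).
Context {d : Order.disp_t} {L : orderType d}.

Definition code_of n (f : n.-tuple M -> M) : set M :=
  [set z | exists2 t : n.+1.-tuple M, (exists s : n.-tuple M, t = [tuple of rcons s (f s)]) & tuple_code t z].

Lemma code_of_inj n (f f' : n.-tuple M -> M) : code_of f = code_of f' -> f = f'.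
Proof.
move=> e; apply/funext => s.
have : code_of f (tcode (rcons s (f s))).
  by exists [tuple of rcons s (f s)]; [exists s|apply/(tuple_codeE hG)].
rewrite e => -[t [s' ->]] /(tuple_codeE hG)/(tcode_inj hG) /=.
by rewrite !size_rcons !size_tuple => /(_ erefl)/rcons_inj[/val_inj -> ->].
Qed.

(** An element is determined by a list of variables and a class coding a
    function: this bounds the number of elements. *)
Definition described (y : gaifman U L) (l : seq L) (C : set M) := exists n (l' : n.-tuple L)
  (f : n.-tuple M -> M) (cf : coded_fun f), [/\ tval l' = l, C = code_of f &
    y = @fint _ (gaifman U L) n (FunA cf) (map_tuple (gaifman_const U (L := L)) l')].

Lemma described_ex y : exists l C, A C /\ described y l C.
Proof.
have [f df [n [l [f0 [cf [sl fE ->]]]]]] := gaifman_rep hG hwc hU y.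
by exists l, (code_of f0); split=> //; exists n, l, f0, cf.
Qed.

Lemma described_inj y y' l C : described y l C -> described y' l C -> y = y'.
Proof.
move=> [n [l1 [f [cf [l1E CE ->]]]]] [n' [l2 [f' [cf' [l2E CE' ->]]]]].
have nn : n' = n by rewrite -(size_tuple l1) -(size_tuple l2) l1E l2E.
subst n'; have ll : l1 = l2 by apply: val_inj; rewrite /= l1E l2E.
have ff : f = f' by apply: code_of_inj; rewrite -CE -CE'.
by subst f' l2; rewrite (Prop_irrelevance cf cf').
Qed.

(** Infinitely many standard elements, needed when [L] is finite. *)
Definition ordn n : M := iter n (@osucc MA) (zero MA).

Lemma ordn_lt m n : m < n -> isin (ordn m) (ordn n).
Proof.
elim: n => [//|n IH]; rewrite ltnS leq_eqVlt => /orP[/eqP ->|/IH mn] /=; rewrite (in_osucc hG).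
  by right.
by left.
Qed.

Lemma ordn_inj : injective ordn.
Proof.
move=> m n e; case: (ltngtP m n) => // /ordn_lt; rewrite e => h; by case: (in_irr hG h).
Qed.

Lemma gaifman_card : [set: gaifman U L] #= [set: (L + nat)%type].
Proof.
rewrite card_eq_le; apply/andP; split.
  have /countable_injP[g g_inj] := hA.
  have /choice[F FE] (y : gaifman U L) : exists p : seq L * set M, A p.2 /\ described y p.1 p.2.
    by have [l [C [AC yC]]] := described_ex y; exists (l, C).
  have ei : injective (@inr L nat) by move=> m n [].
  have [h h_inj] := seq_injection ei.
  apply: (@injective_card_le _ _ (fun y => h (map inl (F y).1, g (F y).2))) => y y' /h_inj[e1 e2].
  have [A1 y1] := FE y; have [A2 y2] := FE y'.
  have e3 : (F y).1 = (F y').1 by apply: inj_map e1 => u v [].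
  have e4 : (F y).2 = (F y').2 by apply: g_inj e2; rewrite inE.
  by rewrite e3 e4 in y1; exact: described_inj y1 y2.
pose F (x : L + nat) : gaifman U L := match x with
  | inl l => gaifman_const U l | inr n => std (gaifman U L) (ordn n) end.
apply: (@injective_card_le _ _ F) => x y.
have ne l n : gaifman_const U l <> std (gaifman U L) (ordn n) :> gaifman U L.
  rewrite gval_const // gval_std //.
  move=> /(gval_eq hG hwc hU (dterm_var hG _) (dterm_const hG _ _)).
  by apply: (var_not_in_support hG hU (S := [::])) => //; exact: dterm_const.
case: x y => [l|m] [l'|n] /=.
- by move=> /(const_inj hG hwc hU) ->.
- by move=> /ne.
- by move=> /esym/ne.
move=> e; have {}e : gval U (fun _ : L -> M => ordn m) = gval U (fun=> ordn n).
  rewrite -(gval_std hG hwc hU (ordn m)) -(gval_std hG hwc hU (ordn n)); exact: e.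
have := proj1 (gval_eq hG hwc hU (dterm_const hG _ _) (dterm_const hG _ _)) e.
by move=> /(QU_const hG hU)/ordn_inj ->.
Qed.

End Cardinality.

(** * The Gaifman functor of a generic ultrafilter *)

Theorem theorem8p6 (MA : class_structure) (U : set (set MA))
  (hGBC : GBC MA) (hwc : Ord_weakly_compact MA)
  (hcountM : countable [set: MA]) (hcountA : countable (@classes MA))
  (hU : generic_ultrafilter MA U)
  (d : Order.disp_t) (K : orderType d) (d' : Order.disp_t) (L : orderType d')
  (i : K -> L) (hi : order_embedding i) :
  (* (a) *)
  (forall n (phi : formula (L0A MA) n) (l : n.-tuple L), sorted <%O l ->
     (@sat _ (gaifman U L) n (map_tuple (@gaifman_const MA U d' L) l) phi <->
      Upow MA U n [set t | Ord_tuples MA n t /\ @sat _ (expansion MA) n t phi])) /\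
  (* (b) *)
  @elementary_embedding _ (gaifman U K) (gaifman U L) (gaifman_map U i) /\
  (* (c) *)
  [/\ (forall d1 (L1 : orderType d1),
         models (gaifman U L1) (theory (expansion MA))),
      (forall d1 (L1 : orderType d1) d2 (L2 : orderType d2) (j : L1 -> L2),
         order_embedding j ->
         @elementary_embedding _ (gaifman U L1) (gaifman U L2)
           (gaifman_map U j)),
      (forall d1 (L1 : orderType d1),
         gaifman_map U (@id L1) = id)
    & (forall d1 (L1 : orderType d1) d2 (L2 : orderType d2)
              d3 (L3 : orderType d3) (j : L1 -> L2) (j' : L2 -> L3),
         order_embedding j -> order_embedding j' ->
         gaifman_map U (j' \o j) = gaifman_map U j' \o gaifman_map U j)] /\
  (* (d) *)
  ([set: L] !=set0 -> SSy (gaifman U L) = MA) /\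
  (* (e) *)
  [set: gaifman U L] #= [set: (L + nat)%type] /\
  (* (f) *)
  (initial_map i <->
   @rank_initial (gaifman_eps U K) (gaifman_eps U L) (gaifman_map U i)) /\
  (* (g) *)
  (order_isomorphism i <->
   @isomorphism _ (gaifman U K) (gaifman U L) (gaifman_map U i)) /\
  (* (h) *)
  (forall l0 : L,
     (forall k, (i k < l0)%O) <->
     (forall x, Ord (gaifman_eps U K) x ->
        ord_lt (gaifman_map U i x) (gaifman_const U l0))) /\
  (* (i) *)
  (~ (exists2 l, (~` range i) l & forall l', (~` range i) l' -> (l <= l')%O) ->
   downward_cofinal (@gaifman_const MA U d' L @` (~` range i))
     (Ord (gaifman_eps U L) `\`
      gaifman_map U (@suborder_incl d' L (range i))
        @` Ord (gaifman_eps U (suborder (range i))))) /\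
  (* (j) *)
  (forall d1 (L' : orderType d1) (j j' : L -> L'),
     order_embedding j -> order_embedding j' ->
     (equalizer i j j' <->
      equalizer (gaifman_map U i) (gaifman_map U j) (gaifman_map U j'))) /\
  (* (k) *)
  (forall i' : K -> L, order_embedding i' ->
     ((forall k, (i k < i' k)%O) <->
      (forall x, (Ord (gaifman_eps U K) `\`
                  @std MA (gaifman U K) @` Ord MA) x ->
         ord_lt (gaifman_map U i x) (gaifman_map U i' x)))).
Proof.
split; first by move=> n phi l sl; exact: gaifman_sat.
split; first exact: elementary_map.
split.
  split.
  - by move=> d1 L1; exact: gaifman_theory.
  - by move=> d1 L1 d2 L2 j hj; exact: elementary_map.
  - by move=> d1 L1; exact: gaifman_id.
  - by move=> d1 L1 d2 L2 d3 L3 j j' hj hj'; exact: gaifman_comp.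
split; first exact: gaifman_SSy.
split; first exact: gaifman_card.
split; first exact: initial_rank_initial.
split; first exact: iso_iff.
split; first by move=> l0; exact: bounded_iff.
split; first exact: cofinal_below.
split; first by move=> d1 L' j j' hj hj'; exact: equalizer_iff.
by move=> i' hi'; exact: map_lt_iff.
Qed.
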